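(* For every $\varepsilon>0$, $$\sum_{n\le x}\phi^{(e)}(n)=C_1x+C_2x^{1/3}+O(x^{1/5+\varepsilon}),$$ where $$C_1=\prod_p\left(1+\sum_{a=3}^{\infty}\frac{\phi(a)-\phi(a-1)}{p^a}\right),\qquad C_2=\zeta(1/3)\prod_p\left(1+\sum_{a=5}^{\infty}\frac{\phi(a)-\phi(a-1)-\phi(a-3)+\phi(a-4)}{p^{a/3}}\right),$$ the products running over all primes $p$.
   Context: $\phi$ denotes Euler's totient function and $\zeta$ the Riemann zeta function. For $n=\prod_{i=1}^r p_i^{a_i}>1$ in canonical form (distinct primes $p_i$, $a_i\ge1$), $\phi^{(e)}(n)$ is the number of integers $\prod_{i=1}^r p_i^{c_i}$ with $1\le c_i\le a_i$ and $\gcd(c_i,a_i)=1$ for all $i$; equivalently $\phi^{(e)}(n)=\prod_{i=1}^r\phi(a_i)$. Also $\phi^{(e)}(1)=1$. *)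

(* Defs.v *)
From Stdlib Require Import Reals ClassicalEpsilon.
From Coquelicot Require Import Coquelicot.
From mathcomp Require Import all_boot.

Set Implicit Arguments.
Unset Strict Implicit.
Unset Printing Implicit Defensive.

(* phi^(e)(n) counts the d = prod p_i^{c_i} with 1 <= c_i <= a_i and
   gcd(c_i, a_i) = 1.  Having d | n says c_i <= a_i (and that d has no other
   primes), and primes d = primes n says c_i >= 1 for every i.
   For n = 1 the only candidate is d = 1, so phi_e 1 = 1. *)
Definition phi_e (n : nat) : nat :=
  count (fun d => (primes d == primes n) &&
                  all (fun p => coprime (logn p d) (logn p n)) (primes n))
        (divisors n).

(* For x >= 0, the n counted are 1 <= n <= floor x. *)
Definition summatory (f : nat -> nat) (x : R) : R :=
  INR (\sum_(1 <= n < (Z.to_nat (Int_part x)).+1) f n).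

Definition Cexp (z : C) : C :=
  (exp (Re z) * cos (Im z), exp (Re z) * sin (Im z))%R.

(* n^{-s} for n >= 1, with the real logarithm of n. *)
Definition dirichlet_term (s : C) (n : nat) : C :=
  Cexp (- s * RtoC (ln (INR n)))%C.

Definition analytic_at (f : C -> C) (c : C) : Prop :=
  exists (a : nat -> C) (r : posreal), forall z : C,
    (Cmod (z - c) < r)%R -> @is_pseries C_AbsRing C_NormedModule a (z - c)%C (f z).

(* The Dirichlet series on Re s > 1, continued analytically to the punctured
   half-plane {Re s > 0} \ {1}.  This domain is connected, so the continuation
   is unique there. *)
Definition is_riemann_zeta (f : C -> C) : Prop :=
  (forall s : C, (1 < Re s)%R ->
     @is_series C_AbsRing C_NormedModule (fun n => dirichlet_term s n.+1) (f s)) /\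
  (forall s : C, (0 < Re s)%R -> s <> RtoC 1 -> analytic_at f s).

(* Meaningful only on {Re s > 0} \ {1}. *)
Definition zeta : C -> C :=
  epsilon (inhabits (fun _ : C => RtoC 0)) is_riemann_zeta.

Local Open Scope R_scope.

(* prod_p (1 + sum_{a >= m} t p a), over all primes p in increasing order. *)
Definition euler_factor (m : nat) (t : nat -> nat -> R) (p : nat) : R :=
  1 + Series (fun k => t p (m + k)%N).

Definition euler_partial (m : nat) (t : nat -> nat -> R) (N : nat) : R :=
  \big[Rmult/1]_(0 <= p < N | prime p) euler_factor m t p.

Definition euler_product (m : nat) (t : nat -> nat -> R) : R :=
  real (Lim_seq (euler_partial m t)).

Definition euler_product_converges (m : nat) (t : nat -> nat -> R) : Prop :=
  (forall p, prime p -> ex_series (fun k => t p (m + k)%N)) /\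
  ex_finite_lim_seq (euler_partial m t).

Definition phiR (a : nat) : R := INR (totient a).

Definition term1 (p a : nat) : R :=
  (phiR a - phiR (a - 1)%N) / INR p ^ a.

Definition term2 (p a : nat) : R :=
  (phiR a - phiR (a - 1)%N - phiR (a - 3)%N + phiR (a - 4)%N)
    / Rpower (INR p) (INR a / 3).

Definition coefC1 : R := euler_product 3 term1.

(* zeta(1/3) is real, so taking the real part loses nothing. *)
Definition coefC2 : R := Re (zeta (RtoC (1 / 3))) * euler_product 5 term2.

(* Main.v *)
Require Import Defs.
From Stdlib Require Import Reals Lra Lia ZArith Classical ClassicalEpsilon.
From Coquelicot Require Import Coquelicot.
From HB Require Import structures.
From mathcomp Require Import all_boot zify.
Local Open Scope R_scope.

(* The Dirichlet series of [phi_e] is [zeta(s) zeta(3s) G(s)], where the Euler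
   product [G] converges absolutely for [Re s > 1/5]; so it suffices to show
     #{(a, b) : a b^3 <= N} = zeta(3) N + zeta(1/3) N^(1/3) + O(N^(1/5+eps))
   and to sum this, for [N / m], against the coefficients of [G].  Dirichlet's
   hyperbola method with [b <= N^(1/4)] and Euler-Maclaurin reduce the count to
   the sums of [psi(t) = {t} - 1/2] over [N / b^3] and [(N / a)^(1/3)].  These
   are estimated by Vinogradov's elementary method: near a point where [f'] is
   close to a fraction with denominator [q], [q] consecutive values of [f] are
   nearly equidistributed modulo 1 and contribute [O(1)].
   The function [zeta] is obtained from
     (s - 1) zeta(s) = 1 + sum_n ((s - 1) n^-s + (n + 1)^(1-s) - n^(1-s)),
   whose terms are estimated in the norm [sum_k |a_k| r^k] of their Taylor
   coefficients, and the partial sums of this series identify [zeta(1/3)] with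
   the constant in the Euler-Maclaurin formula for [sum n^(-1/3)]. *)

(** The trivial bound for the sums of [psi] is [N^(1/4)], too weak for the exponent 1/5. On the
    dyadic range near [m = Z t], blocks of length at most [t] are used; their number is [O(Z)] up to
    a logarithm once [1/(t lam)] is [O(Z)], where [lam] is the size of [f'']. For both [N / b^3] and
    [(N / a)^(1/3)] this amounts to [t^4 = O(Z)], which for [Z ~ N^(1/5)] holds exactly up to
    [m ~ N^(1/4)]: hence the place where the hyperbola is cut. The exponent 1/5 arises a second
    time, independently, as the abscissa of [G], whose local factors are [1 + O(p^(-5s))]; [eps]
    pays for the logarithms and for the absolute convergence of [G] at [1/5 + eps]. Since [zeta] is
    picked by [epsilon] from a specification, its value at 1/3 is known only once a continuation is
    shown to exist and any two are shown to agree there. The norm on Taylor coefficients is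
    submultiplicative, so analyticity passes through products, exponentials and infinite sums by
    handling coefficients alone, with no contour integrals. *)

HB.instance Definition _ :=
  Monoid.isComLaw.Build R 0 Rplus
    (fun x y z => esym (Rplus_assoc x y z)) Rplus_comm Rplus_0_l.
HB.instance Definition _ :=
  Monoid.isComLaw.Build R 1 Rmult
    (fun x y z => esym (Rmult_assoc x y z)) Rmult_comm Rmult_1_l.
HB.instance Definition _ :=
  Monoid.isMulLaw.Build R 0 Rmult Rmult_0_l Rmult_0_r.
HB.instance Definition _ :=
  Monoid.isAddLaw.Build R Rmult Rplus
    (fun x y z => Rmult_plus_distr_r x y z) Rmult_plus_distr_l.

(** * Finite sums of real numbers *)

Lemma rsum_le (I : Type) (r : seq I) (P : pred I) (F G : I -> R) :
  (forall i, P i -> F i <= G i) ->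
  \big[Rplus/0]_(i <- r | P i) F i <= \big[Rplus/0]_(i <- r | P i) G i.
Proof.
move=> H; elim/big_rec2: _ => [|i y1 y2 Pi le]; first exact: Rle_refl.
by apply: Rplus_le_compat => //; apply: H.
Qed.

Lemma rsum_abs (I : Type) (r : seq I) (P : pred I) (F : I -> R) :
  Rabs (\big[Rplus/0]_(i <- r | P i) F i)
    <= \big[Rplus/0]_(i <- r | P i) Rabs (F i).
Proof.
elim/big_rec2: _ => [|i y1 y2 Pi le]; first by rewrite Rabs_R0; lra.
by apply: Rle_trans (Rabs_triang _ _) _; lra.
Qed.

Lemma rsum_scal (I : Type) (r : seq I) (P : pred I) (F : I -> R) (c : R) :
  \big[Rplus/0]_(i <- r | P i) (c * F i)
    = c * \big[Rplus/0]_(i <- r | P i) F i.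
Proof. by rewrite big_distrr. Qed.

Lemma rsum_const (I : Type) (r : seq I) (c : R) :
  \big[Rplus/0]_(i <- r) c = INR (size r) * c.
Proof.
elim: r => [|x r IH]; first by rewrite big_nil /= Rmult_0_l.
by rewrite big_cons IH [size _]/= S_INR Rmult_plus_distr_r Rmult_1_l Rplus_comm.
Qed.

Lemma rsum_opp (I : Type) (r : seq I) (P : pred I) (F : I -> R) :
  \big[Rplus/0]_(i <- r | P i) (- F i)
    = - \big[Rplus/0]_(i <- r | P i) F i.
Proof.
elim/big_rec2: _ => [|i y1 y2 Pi ->]; ring.
Qed.

Lemma rsum_minus (I : Type) (r : seq I) (P : pred I) (F G : I -> R) :
  \big[Rplus/0]_(i <- r | P i) (F i - G i)
    = \big[Rplus/0]_(i <- r | P i) F i - \big[Rplus/0]_(i <- r | P i) G i.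
Proof.
by rewrite /Rminus big_split /= rsum_opp.
Qed.

Lemma rsum_ge0 (I : Type) (r : seq I) (P : pred I) (F : I -> R) :
  (forall i, P i -> 0 <= F i) -> 0 <= \big[Rplus/0]_(i <- r | P i) F i.
Proof.
move=> H; elim/big_rec: _ => [|i y Pi le]; first by lra.
by have := H i Pi; lra.
Qed.

Lemma INR_sum (I : Type) (r : seq I) (P : pred I) (F : I -> nat) :
  INR (\sum_(i <- r | P i) F i) = \big[Rplus/0]_(i <- r | P i) INR (F i).
Proof.
elim/big_rec2: _ => [|i y1 y2 Pi <-] //.
by rewrite plus_INR.
Qed.

Lemma rsum_sum_n (F : nat -> R) (n : nat) :
  \big[Rplus/0]_(0 <= i < n.+1) F i = sum_n F n.
Proof.
elim: n => [|n IH]; first by rewrite big_nat1 sum_O.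
by rewrite big_nat_recr //= IH sum_Sn.
Qed.

Lemma INR_leq (m n : nat) : (m <= n)%N -> INR m <= INR n.
Proof. by move/leP/le_INR. Qed.

Lemma INR_ltn (m n : nat) : (m < n)%N -> INR m < INR n.
Proof. by move/ltP/lt_INR. Qed.

Lemma INR_gt0 (n : nat) : (0 < n)%N -> 0 < INR n.
Proof. by move/INR_ltn. Qed.

Lemma INR_ge1 (n : nat) : (0 < n)%N -> 1 <= INR n.
Proof. by move/INR_leq. Qed.

(** * Vinogradov's elementary estimate for sums of [psi] *)

Definition psi (t : R) : R := frac_part t - 1 / 2.

Lemma psi_bound (t : R) : Rabs (psi t) <= 1 / 2.
Proof.
rewrite /psi; have [H1 H2] := base_fp t; apply: Rabs_le; lra.
Qed.

Lemma Int_part_le (x y : R) : x <= y -> (Int_part x <= Int_part y)%Z.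
Proof.
move=> le.
have [H1 _] := base_Int_part x; have [_ H2] := base_Int_part y.
have : IZR (Int_part x) < IZR (Int_part y + 1) by rewrite plus_IZR; lra.
by move/lt_IZR; lia.
Qed.

(** [psi] jumps, so it is not Lipschitz, but all its jumps go down: [t - psi t] is monotone. Moving
    the argument to either end of [[z - d, z + d]] therefore costs at most the drift [2 * d], in one
    direction at each end. *)
Lemma psi_perturb (z e d : R) :
  Rabs e <= d -> psi (z + d) - 2 * d <= psi (z + e) <= psi (z - d) + 2 * d.
Proof.
move=> /Rabs_le_between [e1 e2].
have l1 : IZR (Int_part (z + e)) <= IZR (Int_part (z + d)).
  by apply: IZR_le; apply: Int_part_le; lra.
have l2 : IZR (Int_part (z - d)) <= IZR (Int_part (z + e)).
  by apply: IZR_le; apply: Int_part_le; lra.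
by rewrite /psi /frac_part; lra.
Qed.

Lemma rsum_INR (q : nat) :
  \big[Rplus/0]_(0 <= j < q) INR j = INR q * (INR q - 1) / 2.
Proof.
elim: q => [|q IH]; first by rewrite big_geq //=; lra.
by rewrite big_nat_recr //= IH; rewrite -/(INR q.+1) S_INR; lra.
Qed.

(** The divisibility hypothesis makes the [q] residues pairwise distinct, so they are a permutation
    of [0, ..., q - 1]. *)
Lemma residues_sum (q : nat) (a m : Z) : (0 < q)%N ->
  (forall k, (0 < k < q)%N -> ~ (Z.of_nat q | Z.of_nat k * a)%Z) ->
  \big[Rplus/0]_(0 <= h < q) IZR ((m + Z.of_nat h * a) mod Z.of_nat q)
    = INR q * (INR q - 1) / 2.
Proof.
move=> q0 hq; set Q := Z.of_nat q.
have Q0 : (0 < Q)%Z by rewrite /Q; lia.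
pose u h := Z.to_nat ((m + Z.of_nat h * a) mod Q).
have uE h : IZR ((m + Z.of_nat h * a) mod Q) = INR (u h).
  rewrite INR_IZR_INZ /u Z2Nat.id //.
  by have := Z.mod_pos_bound (m + Z.of_nat h * a) Q Q0; lia.
have ult h : (u h < q)%N.
  have := Z.mod_pos_bound (m + Z.of_nat h * a) Q Q0.
  by rewrite /u /Q; lia.
have inj_lt h k : (h < k < q)%N -> u h <> u k.
  move=> /andP[hk kq] e.
  have e2 : ((m + Z.of_nat h * a) mod Q = (m + Z.of_nat k * a) mod Q)%Z.
    have h1 := Z.mod_pos_bound (m + Z.of_nat h * a) Q Q0.
    have h2 := Z.mod_pos_bound (m + Z.of_nat k * a) Q Q0.
    by move: e; rewrite /u; lia.
  apply: (hq (k - h)%N); first by lia.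
  exists ((m + Z.of_nat k * a) / Q - (m + Z.of_nat h * a) / Q)%Z.
  have d1 := Z.div_mod (m + Z.of_nat h * a) Q ltac:(lia).
  have d2 := Z.div_mod (m + Z.of_nat k * a) Q ltac:(lia).
  have -> : Z.of_nat (k - h) = (Z.of_nat k - Z.of_nat h)%Z by lia.
  by rewrite -/Q; nia.
rewrite (eq_bigr (fun h => INR (u h))) // -rsum_INR.
rewrite -(big_map u xpredT (fun x => INR x)).
apply: perm_big.
have inj : {in index_iota 0 q &, injective u}.
  move=> h k; rewrite !mem_index_iota !leq0n /= => hq1 kq1 e.
  case: (ltngtP h k) => // hk.
    by have := inj_lt h k; rewrite hk kq1 => /(_ isT).
  by have := inj_lt k h; rewrite hk hq1 => /(_ isT); rewrite e.
have un : uniq [seq u i | i <- index_iota 0 q].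
  by rewrite map_inj_in_uniq // iota_uniq.
apply: uniq_perm => //; first exact: iota_uniq.
have sub : {subset [seq u i | i <- index_iota 0 q] <= index_iota 0 q}.
  by move=> x /mapP[h _ ->]; rewrite mem_index_iota ult.
by have [] := uniq_min_size un sub; rewrite ?size_map.
Qed.

(* With [m = floor (q w)], the fractional part of [w + h a / q] is
   [(q w - m) / q] plus a residue modulo [q] divided by [q]. *)
Lemma psi_line (q : nat) (a : Z) (w : R) : (0 < q)%N ->
  (forall k, (0 < k < q)%N -> ~ (Z.of_nat q | Z.of_nat k * a)%Z) ->
  Rabs (\big[Rplus/0]_(0 <= h < q) psi (w + INR h * IZR a / INR q)) <= 1 / 2.
Proof.
move=> q0 hq.
set m := Int_part (INR q * w).
have qR := INR_gt0 q q0.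
have Q0 : (0 < Z.of_nat q)%Z by lia.
have [m1 m2] := base_Int_part (INR q * w); rewrite -/m in m1 m2.
have E h : psi (w + INR h * IZR a / INR q)
    = / INR q * IZR ((m + Z.of_nat h * a) mod Z.of_nat q)
      + (w - IZR m / INR q - 1 / 2).
  set r := ((m + Z.of_nat h * a) mod Z.of_nat q)%Z.
  set d := ((m + Z.of_nat h * a) / Z.of_nat q)%Z.
  have dm : (m + Z.of_nat h * a = Z.of_nat q * d + r)%Z.
    by apply: Z.div_mod; lia.
  have [r0 rq] : (0 <= r <= Z.of_nat q - 1)%Z.
    by have := Z.mod_pos_bound (m + Z.of_nat h * a) _ Q0; rewrite /r; lia.
  have dmR : IZR m + INR h * IZR a = INR q * IZR d + IZR r.
    by rewrite !INR_IZR_INZ -!mult_IZR -!plus_IZR dm.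
  have r0R := IZR_le _ _ r0.
  have rqR := IZR_le _ _ rq; rewrite minus_IZR -INR_IZR_INZ in rqR.
  have wE : w + INR h * IZR a / INR q
      = IZR d + (INR q * w - IZR m + IZR r) / INR q.
    apply: (Rmult_eq_reg_l (INR q)); last by lra.
    have -> : INR q * (w + INR h * IZR a / INR q)
       = INR q * w + INR h * IZR a by field; lra.
    have -> : INR q * (IZR d + (INR q * w - IZR m + IZR r) / INR q)
       = INR q * IZR d + (INR q * w - IZR m + IZR r) by field; lra.
    lra.
  have b1 : 0 <= (INR q * w - IZR m + IZR r) / INR q.
    by apply: Rdiv_le_0_compat; lra.
  have b2 : (INR q * w - IZR m + IZR r) / INR q < 1.
    by apply/Rlt_div_l; lra.
  have -> : psi (w + INR h * IZR a / INR q)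
      = w + INR h * IZR a / INR q - IZR d - 1 / 2.
    rewrite /psi /frac_part -(Int_part_spec _ d); first by [].
    by rewrite wE; split; lra.
  by rewrite wE; field; lra.
(* The sum collapses to [q w - m - 1/2], which is [psi (q w)]: averaging over the [q] shifts leaves
   a single sawtooth. *)
rewrite (eq_bigr _ (fun h _ => E h)) big_split /= rsum_scal residues_sum //.
rewrite rsum_const size_iota subn0.
have -> : / INR q * (INR q * (INR q - 1) / 2)
   + INR q * (w - IZR m / INR q - 1 / 2) = INR q * w - IZR m - 1 / 2.
  by field; lra.
apply: Rabs_le; lra.
Qed.

(** By [psi_perturb], the sum lies between the sums over the exact lines through [w + d] and
    [w - d], up to [2 * d] per term, and [psi_line] bounds both of these. *)
Lemma psi_block (q : nat) (a : Z) (w d : R) (u : nat -> R) : (0 < q)%N ->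
  (forall k, (0 < k < q)%N -> ~ (Z.of_nat q | Z.of_nat k * a)%Z) ->
  (forall h, (h < q)%N -> Rabs (u h - (w + INR h * IZR a / INR q)) <= d) ->
  Rabs (\big[Rplus/0]_(0 <= h < q) psi (u h)) <= 1 / 2 + 2 * d * INR q.
Proof.
move=> q0 hq hu.
have P h : (h < q)%N ->
   psi (w + d + INR h * IZR a / INR q) - 2 * d <= psi (u h)
   <= psi (w - d + INR h * IZR a / INR q) + 2 * d.
  move=> /hu /(psi_perturb (w + INR h * IZR a / INR q)).
  have -> : w + INR h * IZR a / INR q + (u h - (w + INR h * IZR a / INR q)) = u h.
    by lra.
  have -> : w + INR h * IZR a / INR q + d = w + d + INR h * IZR a / INR q by lra.
  by have -> : w + INR h * IZR a / INR q - d = w - d + INR h * IZR a / INR q by lra.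
have L1 := psi_line q a (w + d) q0 hq.
have L2 := psi_line q a (w - d) q0 hq.
have S1 : \big[Rplus/0]_(0 <= h < q) (psi (w + d + INR h * IZR a / INR q) - 2 * d)
    <= \big[Rplus/0]_(0 <= h < q) psi (u h).
  rewrite !big_nat; apply: rsum_le => h /andP[_ /P [? ?]]; lra.
have S2 : \big[Rplus/0]_(0 <= h < q) psi (u h)
   <= \big[Rplus/0]_(0 <= h < q) (psi (w - d + INR h * IZR a / INR q) + 2 * d).
  rewrite !big_nat; apply: rsum_le => h /andP[_ /P [? ?]]; lra.
move: S1; rewrite rsum_minus rsum_const size_iota subn0 => S1.
have {S2} S2 : \big[Rplus/0]_(0 <= h < q) psi (u h)
   <= \big[Rplus/0]_(0 <= h < q) psi (w - d + INR h * IZR a / INR q) + INR q * (2 * d).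
  apply: Rle_trans S2 _; rewrite [X in X <= _](big_split _ _ _ (fun h => psi _)) /=.
  by rewrite rsum_const size_iota subn0; apply: Rle_refl.
move: L1 L2 => /Rabs_le_between [? ?] /Rabs_le_between [? ?].
apply: Rabs_le; split; lra.
Qed.

(** Pigeonhole: the [T + 1] fractional parts of [j alpha], for [0 <= j <= T], lie in [T] intervals
    of length [1 / T]. Two of them share an interval, and [q] is the difference of their indices. *)
Lemma dirichlet_approx (alpha : R) (T : nat) : (0 < T)%N ->
  exists q : nat, exists a : Z, (0 < q <= T)%N /\
    Rabs (INR q * alpha - IZR a) <= / INR T.
Proof.
move=> T0; have TR := INR_gt0 T T0.
pose x (j : nat) := frac_part (INR j * alpha).
have x01 j : 0 <= x j < 1 by have [] := base_fp (INR j * alpha); rewrite /x; lra.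
pose z j := Int_part (INR T * x j).
have z1 j : IZR (z j) <= INR T * x j < IZR (z j) + 1.
  by have [] := base_Int_part (INR T * x j); rewrite /z; lra.
have z0 j : (0 <= z j < Z.of_nat T)%Z.
  have [h1 h2] := z1 j; have [h3 h4] := x01 j; split.
    have : IZR (-1) < IZR (z j) by nra.
    by move/lt_IZR; lia.
  by apply: lt_IZR; rewrite -INR_IZR_INZ; nra.
have zT j : (Z.to_nat (z j) < T)%N by have := z0 j; lia.
pose F (i : 'I_T.+1) := Ordinal (zT i).
have : ~~ injectiveb F.
  apply/negP => /injectiveP /leq_card; rewrite !card_ord; lia.
case/injectivePn => i [j ij /(congr1 val) /= e].
wlog lt_ij : i j ij e / (i < j)%N.
  move=> W; case: (ltngtP i j) => h; first exact: (W i j).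
    by apply: (W j i) => //; rewrite eq_sym.
  by case/eqP: ij; apply: val_inj.
exists (j - i)%N, (Int_part (INR j * alpha) - Int_part (INR i * alpha))%Z.
split; first by have := ltn_ord j; lia.
have e2 : z i = z j by have := z0 i; have := z0 j; lia.
have := z1 i; have := z1 j; rewrite e2 => -[h1 h2] [h3 h4].
rewrite minus_INR; last by apply/leP; lia.
rewrite minus_IZR.
have -> : (INR j - INR i) * alpha -
   (IZR (Int_part (INR j * alpha)) - IZR (Int_part (INR i * alpha)))
   = x j - x i by rewrite /x /frac_part; ring.
apply: (Rmult_le_reg_l (INR T)) => //.
rewrite -{1}(Rabs_pos_eq (INR T)); last by lra.
rewrite -Rabs_mult Rinv_r; last by lra.
by apply: Rabs_le; lra.
Qed.

(* Minimality of the denominator plays the role of coprimality. *)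
Lemma dirichlet_approx_min (alpha : R) (T : nat) : (0 < T)%N ->
  exists q : nat, exists a : Z, [/\ (0 < q <= T)%N,
    Rabs (INR q * alpha - IZR a) <= / INR T &
    forall k, (0 < k < q)%N -> ~ (Z.of_nat q | Z.of_nat k * a)%Z].
Proof.
move=> T0.
pose P q := exists a : Z, (0 < q <= T)%N /\
    Rabs (INR q * alpha - IZR a) <= / INR T.
have [q [[[a [q0 qa]] qmin] _]] : exists ! q, P q /\ forall q', P q' -> (q <= q')%coq_nat.
  apply: dec_inh_nat_subset_has_unique_least_element.
    by move=> n; apply: classic.
  exact: dirichlet_approx.
exists q, a; split=> // k kq [b kb].
have kb' : INR k * IZR a = IZR b * INR q.
  by rewrite !INR_IZR_INZ -!mult_IZR kb.
have kR : 0 < INR k by apply: INR_gt0; lia.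
have qR : INR k < INR q by apply: INR_ltn; lia.
suff /qmin : P k by lia.
(* From [k a = b q] the fraction [a / q] equals [b / k]. Its error [k alpha - b] is [k / q] times
   the old one, so [k] would be a smaller admissible denominator. *)
exists b; split; first by lia.
apply: Rle_trans qa.
have -> : INR k * alpha - IZR b = INR k / INR q * (INR q * alpha - IZR a).
  have -> : IZR b = INR k * IZR a / INR q by rewrite kb'; field; lra.
  by field; lra.
rewrite Rabs_mult (Rabs_pos_eq (INR k / INR q)); last first.
  by apply: Rdiv_le_0_compat; lra.
have : INR k / INR q <= 1 by apply/Rle_div_l; lra.
by have := Rabs_pos (INR q * alpha - IZR a); nra.
Qed.

Lemma size_partition (key : nat -> nat) (J : nat) (s : seq nat) :
  all (fun n => key n < J)%N s ->
  size s = (\sum_(0 <= j < J) count (fun n => key n == j) s)%N.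
Proof.
elim: s => [|x s IH] /=; first by rewrite big1.
case/andP => xJ /IH ->; rewrite big_split /=.
suff -> : (\sum_(0 <= i < J) (key x == i) = 1)%N by [].
rewrite (bigD1_seq (key x)) ?mem_index_iota ?iota_uniq //= eqxx big1 //.
by move=> i /negPf ni; rewrite eq_sym ni.
Qed.

Lemma spaced_size (q : nat) (L : R) (s : seq nat) : (0 < q)%N -> 0 <= L ->
  pairwise (fun n n' => n + q <= n')%N s ->
  (forall n n', n \in s -> n' \in s -> (n <= n')%N -> INR n' - INR n <= L) ->
  INR (size s) <= 1 + L / INR q.
Proof.
move=> q0 L0 sp hL; have qR := INR_gt0 q q0.
have LR : 0 <= L / INR q by apply: Rdiv_le_0_compat.
case: s sp hL => [|x s] sp hL; first by rewrite /=; lra.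
have key : forall s x, pairwise (fun n n' => n + q <= n')%N (x :: s) ->
    (x + q * size s <= last x s)%N.
  elim=> [|y r IH] z /=; first by move=> _; lia.
  by case/andP => /andP[zy _] /IH /= h; lia.
have lk := key s x sp.
have lx : (x <= last x s)%N by lia.
have l1 := hL x (last x s) (mem_head x s) (mem_last x s) lx.
have l2 := INR_leq _ _ lk; rewrite plus_INR mult_INR in l2.
suff h : INR (size s) <= L / INR q.
  rewrite (_ : size (x :: s) = (size s).+1) // S_INR. lra.
by apply/Rle_div_r => //; lra.
Qed.

(** Starting at [M], jump from [n] to [n + q n] until the next block would pass [E]; [s] lists the
    starting points. Fewer than [T] terms are left over and are bounded trivially. The spacing of
    [s] is what later limits the number of blocks. *)
Lemma greedy_blocks (q : nat -> nat) (T : nat) (u : nat -> R) (M E : nat) (c : R) :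
  (forall n, (0 < q n <= T)%N) -> (forall n, Rabs (u n) <= 1 / 2) -> (M <= E)%N ->
  (forall n, (M <= n)%N -> (n + q n <= E)%N ->
     Rabs (\big[Rplus/0]_(0 <= h < q n) u (n + h)%N) <= c) ->
  exists s : seq nat, [/\ all (fun n => (M <= n)%N && (n + q n <= E)%N) s,
    pairwise (fun n n' => n + q n <= n')%N s &
    Rabs (\big[Rplus/0]_(M <= n < E) u n) <= c * INR (size s) + INR T].
Proof.
move=> qT u1.
have [k] := ubnP (E - M)%N; elim: k M => // k IH M ltk leME hc.
have [le|gt] := leqP (M + q M) E; last first.
  exists [::]; split => //=.
  apply: Rle_trans (rsum_abs _ _ _ _) _.
  apply: Rle_trans (rsum_le _ _ _ _ (fun _ => 1 / 2) (fun n _ => u1 n)) _.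
  rewrite rsum_const size_iota.
  have : INR (E - M) <= INR T by apply: INR_leq; have := qT M; lia.
  by have := pos_INR (E - M); lra.
have qM := qT M.
have [|||s [s1 s2 s3]] := IH (M + q M)%N.
- by lia.
- by [].
- by move=> n n1 n2; apply: hc => //; lia.
exists (M :: s); split => /=.
- rewrite leqnn le /=; apply: sub_all s1 => n /andP[n1 n2]; apply/andP; lia.
- rewrite s2 andbT; apply: sub_all s1 => n /andP[n1 n2]; lia.
rewrite (@big_cat_nat _ _ _ (M + q M)%N) //=; last by lia.
have -> : \big[Rplus/0]_(M <= i < M + q M) u i
   = \big[Rplus/0]_(0 <= h < q M) u (M + h)%N.
  rewrite -{1}[M]add0n big_addn addnC addnK.
  by apply: eq_bigr => i _; rewrite addnC.
apply: Rle_trans (Rabs_triang _ _) _.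
have := hc M (leqnn M) le; rewrite -/(INR (size s).+1) S_INR; lra.
Qed.

(* [g] plays the role of [f'], and [lam] is the order of magnitude of [f'']. *)
Definition curved (f g : nat -> R) (M E : nat) (lam kap : R) : Prop :=
  (forall n n', (M <= n <= n')%N -> (n' <= E)%N ->
     lam * (INR n' - INR n) <= g n' - g n <= kap * lam * (INR n' - INR n)) /\
  (forall n h, (M <= n)%N -> (n + h <= E)%N ->
     Rabs (f (n + h)%N - f n - INR h * g n) <= kap * lam * INR h ^ 2).

Definition harmonic (T : nat) : R := \big[Rplus/0]_(1 <= k < T.+1) / INR k.

Lemma harmonic_ge1 (T : nat) : (0 < T)%N -> 1 <= harmonic T.
Proof.
move=> T0; rewrite /harmonic big_ltn //= Rinv_1.
suff : 0 <= \big[Rplus/0]_(2 <= i < T.+1) / INR i by lra.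
rewrite big_nat; apply: rsum_ge0 => i /andP[i1 _].
by apply/Rlt_le/Rinv_0_lt_compat/INR_gt0; lia.
Qed.

(** Each block costs [O(kap)], so blocks are to be counted, by denominator [k]. As [g] varies by at
    most [kap * lam * N], there are at most [k * kap * lam * N + 4] possible numerators. For a fixed
    numerator, [g] stays within [2 / (k T)], hence [n] within [2 / (k T lam)], and the starts are at
    least [k] apart. Summing over [k <= T] gives the bound, with [harmonic T] coming from the terms
    in [1 / k]. *)
Lemma curved_psi_sum (f g : nat -> R) (M E T : nat) (lam kap : R) :
  curved f g M E lam kap -> (M <= E)%N -> (0 < T)%N -> 0 < lam -> 1 <= kap ->
  lam * INR T ^ 3 <= 1 ->
  Rabs (\big[Rplus/0]_(M <= n < E) psi (f n))
    <= 40 * kap ^ 2 * harmonic T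
       * (INR (E - M) / INR T + / (INR T * lam) + INR T).
Proof.
move=> [cg cf] leME T0 lam0 kap1 lamT.
have TR := INR_ge1 T T0.
have [q hq] : exists q : nat -> nat, forall n, exists a : Z, [/\ (0 < q n <= T)%N,
    Rabs (INR (q n) * g n - IZR a) <= / INR T &
    forall k, (0 < k < q n)%N -> ~ (Z.of_nat (q n) | Z.of_nat k * a)%Z].
  have H n := constructive_indefinite_description _ (dirichlet_approx_min (g n) T T0).
  by exists (fun n => sval (H n)) => n; case: (H n).
have [a ha] : exists a : nat -> Z, forall n, [/\ (0 < q n <= T)%N,
    Rabs (INR (q n) * g n - IZR (a n)) <= / INR T &
    forall k, (0 < k < q n)%N -> ~ (Z.of_nat (q n) | Z.of_nat k * a n)%Z].
  have H n := constructive_indefinite_description _ (hq n).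
  by exists (fun n => sval (H n)) => n; case: (H n).
have qT n : (0 < q n <= T)%N by case: (ha n).
(* The distance [d] from a line has two sources: the curvature, at most [kap lam q^2], and the
   approximation of the slope, at most [1 / T]. Since [q <= T] and [lam T^3 <= 1], [d q <= kap + 1],
   and [1/2 + 2 (kap + 1) <= 5 kap]. *)
have block n : (M <= n)%N -> (n + q n <= E)%N ->
   Rabs (\big[Rplus/0]_(0 <= h < q n) psi (f (n + h)%N)) <= 5 * kap.
  move=> Mn nE; have [/andP[q0 qleT] ga mq] := ha n.
  have qR := INR_ge1 _ q0; have qTR := INR_leq _ _ qleT.
  set d := kap * lam * INR (q n) ^ 2 + / INR T.
  have dq : d * INR (q n) <= kap + 1.
    have -> : d * INR (q n) = kap * (lam * INR (q n) ^ 3) + INR (q n) / INR T.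
      by rewrite /d; field; lra.
    have h1 : INR (q n) / INR T <= 1 by apply/Rle_div_l; lra.
    have h2 : lam * INR (q n) ^ 3 <= lam * INR T ^ 3.
      by apply: Rmult_le_compat_l; [lra | apply: pow_incr; lra].
    by nra.
  have hd h : (h < q n)%N ->
     Rabs (f (n + h)%N - (f n + INR h * IZR (a n) / INR (q n))) <= d.
    move=> hlt; have hR := INR_ltn _ _ hlt; have h0 := pos_INR h.
    have -> : f (n + h)%N - (f n + INR h * IZR (a n) / INR (q n))
      = (f (n + h)%N - f n - INR h * g n)
        + INR h / INR (q n) * (INR (q n) * g n - IZR (a n)) by field; lra.
    apply: Rle_trans (Rabs_triang _ _) _; apply: Rplus_le_compat.
      apply: Rle_trans (cf n h Mn ltac:(lia)) _.
      have : INR h ^ 2 <= INR (q n) ^ 2 by apply: pow_incr; lra.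
      have : 0 <= kap * lam by nra.
      by nra.
    rewrite Rabs_mult Rabs_pos_eq; last by apply: Rdiv_le_0_compat; lra.
    have : INR h / INR (q n) <= 1 by apply/Rle_div_l; lra.
    have : 0 <= INR h / INR (q n) by apply: Rdiv_le_0_compat; lra.
    by have := Rabs_pos (INR (q n) * g n - IZR (a n)); nra.
  have := psi_block (q n) (a n) (f n) d (fun h => f (n + h)%N) q0 mq hd; lra.
have [s [sM sp sB]] :=
  greedy_blocks q T (fun n => psi (f n)) M E (5 * kap) qT
    (fun n => psi_bound _) leME block.
set N := INR (E - M) in sB *.
have N0 : 0 <= N by apply: pos_INR.
have TlR : 0 < INR T * lam by nra.
have Tl0 : 0 < / (INR T * lam) by apply: Rinv_0_lt_compat.
have cnt k : (0 < k <= T)%N ->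
  INR (count (fun n => q n == k) s)
   <= (INR k * (kap * lam * N) + 4) * (1 + 2 / (INR k ^ 2 * (INR T * lam))).
  move=> /andP[k0 kT]; have kR := INR_ge1 _ k0.
  have k2 : 0 < INR k ^ 2 * (INR T * lam) by apply: Rmult_lt_0_compat; nra.
  rewrite -size_filter; set sk := [seq n <- s | q n == k].
  have skP n : n \in sk -> [/\ q n = k, (M <= n)%N & (n + q n <= E)%N].
    by rewrite mem_filter => /andP[/eqP qk ns]; have /andP[h1 h2] := allP sM n ns.
  have skp : pairwise (fun n n' => n + k <= n')%N sk.
    have := subseq_pairwise (filter_subseq (fun n => q n == k) s) sp.
    rewrite -/sk => h.
    apply: (sub_in_pairwise (P := mem sk)) h; last by apply/allP.
    by move=> n n' /skP[<- _ _] _.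
  have X0 : 0 <= INR k * (kap * lam * N).
    by apply: Rmult_le_pos; [lra | apply: Rmult_le_pos => //; nra].
  set X := INR k * (kap * lam * N) in X0 *.
  move: (base_Int_part (INR k * g M)).
  move: (Int_part (INR k * g M)) => ip [b1 b2].
  (* A lower bound for every numerator: [a n >= k g(n) - 1/T >= k g(M) - 1 >= ip - 1]. The rounding
     of [k g(M)] and the two errors account for the 3 in [X + 3]. *)
  pose a0 := (ip - 1)%Z.
  have iT : 0 < / INR T <= 1.
    split; first by apply: Rinv_0_lt_compat; lra.
    by rewrite -Rinv_1; apply: Rinv_le_contravar; lra.
  have aB n : n \in sk -> 0 <= IZR (a n - a0) <= X + 3.
    move=> /skP[qk Mn nE]; have [_ /Rabs_le_between [a1 a2] _] := ha n.
    rewrite qk in a1 a2.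
    have [g1 g2] := cg M n ltac:(lia) ltac:(lia).
    have nM : INR n - INR M <= N.
      by rewrite /N minus_INR; [have := INR_leq n E ltac:(lia); lra | lia].
    have nM0 : 0 <= INR n - INR M by have := INR_leq _ _ Mn; lra.
    have h1 : 0 <= INR k * (g n - g M) by apply: Rmult_le_pos; nra.
    have h2 : INR k * (g n - g M) <= X.
      apply: Rmult_le_compat_l; first by lra.
      apply: Rle_trans g2 _; apply: Rmult_le_compat_l; nra.
    by rewrite /a0 !minus_IZR; split; lra.
  move: (base_Int_part (X + 3)).
  move: (Int_part (X + 3)) => jp [J1 J2].
  pose J := Z.to_nat (jp + 1).
  have Jpos : (0 <= jp + 1)%Z.
    by apply: le_IZR; rewrite plus_IZR; lra.
  have JE : INR J = IZR jp + 1.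
    by rewrite INR_IZR_INZ /J Z2Nat.id // plus_IZR.
  have sz := size_partition (fun n => Z.to_nat (a n - a0)) J sk.
  rewrite sz; last first.
    apply/allP => n /aB [n0 n1].
    have z0 : (0 <= a n - a0)%Z by apply: le_IZR.
    suff : (a n - a0 < jp + 1)%Z by rewrite /J; lia.
    by apply: lt_IZR; rewrite plus_IZR; lra.
  rewrite INR_sum.
  set c := 1 + 2 / (INR k ^ 2 * (INR T * lam)).
  have c0 : 0 < c.
    have : 0 < 2 / (INR k ^ 2 * (INR T * lam)) by apply: Rdiv_lt_0_compat; lra.
    by rewrite /c; lra.
  apply: (Rle_trans _ (INR J * c)); last first.
    by apply: Rmult_le_compat_r; lra.
  have -> : INR J = INR (size (index_iota 0 J)) by rewrite size_iota subn0.
  rewrite -rsum_const; apply: rsum_le => j _.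
  rewrite -size_filter.
  have -> : c = 1 + (2 / (INR k * (INR T * lam))) / INR k.
    by rewrite /c; field; lra.
  have kTl : 0 < INR k * (INR T * lam) by nra.
  apply: spaced_size => //.
    by apply: Rdiv_le_0_compat; lra.
    exact: subseq_pairwise (filter_subseq _ _) skp.
  move=> n n'; rewrite !(mem_filter (fun n => Z.to_nat (a n - a0) == j)) => /andP[/eqP j1 ns] /andP[/eqP j2 ns'] nn'.
  have [qk Mn nE] := skP _ ns; have [qk' Mn' nE'] := skP _ ns'.
  have [n0 _] := aB _ ns; have [n0' _] := aB _ ns'.
  move/le_IZR: n0 => n0; move/le_IZR: n0' => n0'.
  have aE : a n = a n' by lia.
  have [_ /Rabs_le_between [a1 a2] _] := ha n.
  have [_ /Rabs_le_between [a1' a2'] _] := ha n'.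
  rewrite qk in a1 a2; rewrite qk' -aE in a1' a2'.
  have [g1 g2] := cg n n' ltac:(lia) ltac:(lia).
  apply/Rle_div_r => //.
  have h : INR k * (lam * (INR n' - INR n)) <= 2 * / INR T.
    by apply: Rle_trans (_ : INR k * (g n' - g n) <= _); nra.
  have -> : (INR n' - INR n) * (INR k * (INR T * lam))
     = INR T * (INR k * (lam * (INR n' - INR n))) by ring.
  have -> : 2 = INR T * (2 * / INR T) by field; lra.
  by apply: Rmult_le_compat_l; lra.
have sS : INR (size s) <= harmonic T * (3 * kap * (N / INR T)
     + 8 * / (INR T * lam) + 4 * INR T).
  rewrite (size_partition q T.+1 s); last first.
    by apply/allP => n _; have := qT n; lia.
  rewrite big_ltn // [X in (X + _)%N](_ : _ = 0%N) ?add0n; last first.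
    by apply/eqP; rewrite -leqn0 leqNgt -has_count; apply/negP=> /hasP[n _ /eqP e];
      have := qT n; lia.
  rewrite INR_sum.
  apply: (Rle_trans _ (\big[Rplus/0]_(1 <= k < T.+1)
     ((2 * kap * (N / INR T) + 8 * / (INR T * lam)) * / INR k
       + (N / INR T * kap / INR T + 4)))).
    rewrite !big_nat; apply: rsum_le => k kT.
    apply: Rle_trans (cnt k _) _; first by lia.
    have kR : 1 <= INR k by apply: INR_ge1; lia.
    have kTR : INR k <= INR T by apply: INR_leq; lia.
    have -> : (INR k * (kap * lam * N) + 4) * (1 + 2 / (INR k ^ 2 * (INR T * lam)))
      = INR k * (lam * (kap * N)) + 4 + / INR k * (2 * kap * (N / INR T))
        + 8 * / (INR T * lam) * (/ INR k * / INR k) by field; lra.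
    have h1 : / INR k * / INR k <= / INR k.
      rewrite -{3}[/ INR k]Rmult_1_r; apply: Rmult_le_compat_l.
        by apply/Rlt_le/Rinv_0_lt_compat; lra.
      by rewrite -Rinv_1; apply: Rinv_le_contravar; lra.
    (* The only term that grows with [k]. Here [k lam <= T lam <= 1 / T^2], so its sum over [k <= T]
       is at most [kap N / T]. *)
    have h2 : INR k * (lam * (kap * N)) <= N / INR T * kap / INR T.
      have -> : N / INR T * kap / INR T = (/ INR T * / INR T) * (kap * N) by field; lra.
      rewrite -Rmult_assoc; apply: Rmult_le_compat_r; first by nra.
      apply: (Rmult_le_reg_r (INR T ^ 2)); first by nra.
      have -> : / INR T * / INR T * INR T ^ 2 = 1 by field; lra.
      apply: Rle_trans lamT.
      have -> : INR k * lam * INR T ^ 2 = INR k * (lam * INR T ^ 2) by ring.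
      have -> : lam * INR T ^ 3 = INR T * (lam * INR T ^ 2) by ring.
      apply: Rmult_le_compat_r => //; nra.
    nra.
  rewrite big_split /= rsum_scal -/(harmonic T).
  rewrite rsum_const size_iota subn1 /=.
  have H1 := harmonic_ge1 T T0.
  have NT0 : 0 <= N / INR T by apply: Rdiv_le_0_compat; lra.
  have -> : INR T * (N / INR T * kap / INR T + 4) = N / INR T * kap + 4 * INR T.
    by field; lra.
  have : 0 <= N / INR T * kap by nra.
  by nra.
have H1 := harmonic_ge1 T T0.
have NT0 : 0 <= N / INR T by apply: Rdiv_le_0_compat; lra.
apply: Rle_trans sB _.
apply: Rle_trans (_ : 5 * kap * (harmonic T * (3 * kap * (N / INR T)
     + 8 * / (INR T * lam) + 4 * INR T)) + INR T <= _).
  apply: Rplus_le_compat_r; apply: Rmult_le_compat_l sS; lra.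
set x := N / INR T in NT0 *; set y := / (INR T * lam) in Tl0 *.
set t := INR T in TR *; set H := harmonic T in H1 *.
have e1 : 0 <= H * x * (kap * kap) by apply: Rmult_le_pos; nra.
have kk : kap <= kap * kap by nra.
have e2 : H * y * kap <= H * y * (kap * kap) by apply: Rmult_le_compat_l => //; nra.
have e3 : H * t * kap <= H * t * (kap * kap) by apply: Rmult_le_compat_l => //; nra.
have e4 : t <= H * t * (kap * kap).
  have : t <= H * t by nra.
  have : 1 <= kap * kap by nra.
  by nra.
by nra.
Qed.

(** * Sums of [psi (K n^-s)] over dyadic blocks *)

Lemma Rpower_pos (x y : R) : 0 < Rpower x y.
Proof. exact: exp_pos. Qed.

Lemma is_derive_Rpower (a t : R) : 0 < t ->
  is_derive (fun x => Rpower x a) t (a * Rpower t (a - 1)).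
Proof. by move=> t0; apply/is_derive_Reals; apply: derivable_pt_lim_power. Qed.

Lemma Rpower_anti (a b s : R) : 0 <= s -> 0 < a <= b ->
  Rpower b (- s) <= Rpower a (- s).
Proof.
move=> s0 [a0 ab]; rewrite !Rpower_Ropp.
apply: Rinv_le_contravar; first exact: Rpower_pos.
by apply: Rle_Rpower_l; lra.
Qed.

Lemma Rpower_mvt (a x y : R) : 0 < x -> x <= y ->
  exists c, x <= c <= y /\
    Rpower y a - Rpower x a = a * Rpower c (a - 1) * (y - x).
Proof.
move=> x0 xy.
have [|t tP|c] := MVT_gen (fun t => Rpower t a) x y (fun t => a * Rpower t (a - 1)).
- move=> t; rewrite Rmin_left // Rmax_right // => -[h _].
  by apply: is_derive_Rpower; lra.
- move: tP; rewrite Rmin_left // Rmax_right // => -[h _].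
  apply/derivable_continuous_pt/ex_derive_Reals_0.
  by eexists; apply: is_derive_Rpower; lra.
- rewrite Rmin_left // Rmax_right // => -[h1 h2].
  by exists c.
Qed.

(** The second derivative [K s (s + 1) t^(-s-2)] decreases, and its values at [M] and [2 M] differ
    by the factor [2^(s+2)]; so [lam] is its value at [2 M] and [kap] is that factor. The mean value
    theorem supplies both halves of [curved]. *)
Lemma curved_power (K s : R) (M E : nat) :
  0 < K -> 0 < s -> (0 < M)%N -> (E <= 2 * M)%N ->
  curved (fun n => K * Rpower (INR n) (- s))
         (fun n => K * (- s * Rpower (INR n) (- s - 1))) M E
         (K * s * (s + 1) * Rpower (2 * INR M) (- (s + 2))) (Rpower 2 (s + 2)).
Proof.
move=> K0 s0 M0 EM.
have MR := INR_ge1 _ M0.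
set lam := K * s * (s + 1) * Rpower (2 * INR M) (- (s + 2)).
have ks : 0 < K * s * (s + 1) by apply: Rmult_lt_0_compat; nra.
have lamE : Rpower 2 (s + 2) * lam = K * s * (s + 1) * Rpower (INR M) (- (s + 2)).
  rewrite /lam -Rpower_mult_distr; [|lra..].
  rewrite [Rpower 2 (- _)]Rpower_Ropp.
  by have := Rpower_pos 2 (s + 2) => h; field; lra.
have key x y : INR M <= x -> x <= y -> y <= 2 * INR M ->
    lam * (y - x) <=
    K * (- s * Rpower y (- s - 1)) - K * (- s * Rpower x (- s - 1))
    <= Rpower 2 (s + 2) * lam * (y - x).
  move=> Mx xy yM.
  have [c [cxy e]] := Rpower_mvt (- s - 1) x y ltac:(lra) xy.
  have -> : K * (- s * Rpower y (- s - 1)) - K * (- s * Rpower x (- s - 1))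
    = K * s * (s + 1) * Rpower c (- (s + 2)) * (y - x).
    have -> : - (s + 2) = - s - 1 - 1 by ring.
    have -> : K * (- s * Rpower y (- s - 1)) - K * (- s * Rpower x (- s - 1))
      = - (K * s) * (Rpower y (- s - 1) - Rpower x (- s - 1)) by ring.
    by rewrite e; ring.
  have [cx cy] := cxy.
  have h1 : Rpower (2 * INR M) (- (s + 2)) <= Rpower c (- (s + 2)).
    by apply: Rpower_anti; lra.
  have h2 : Rpower c (- (s + 2)) <= Rpower (INR M) (- (s + 2)).
    by apply: Rpower_anti; lra.
  rewrite lamE /lam; split; apply: Rmult_le_compat_r; try lra;
    by apply: Rmult_le_compat_l; lra.
have bd n : (n <= E)%N -> INR n <= 2 * INR M.
  by move=> nE; rewrite -[2]/(INR 2) -mult_INR; apply: INR_leq; lia.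
split=> [n n' /andP[Mn nn'] nE | n h Mn nhE].
  by apply: key; [exact: INR_leq | exact: INR_leq | exact: bd].
have nR := INR_leq _ _ Mn; have h0 := pos_INR h.
have nhR := bd _ nhE; rewrite plus_INR in nhR.
have [c [[c1 c2] e]] := Rpower_mvt (- s) (INR n) (INR n + INR h) ltac:(lra) ltac:(lra).
rewrite plus_INR.
have -> : K * Rpower (INR n + INR h) (- s) - K * Rpower (INR n) (- s)
    - INR h * (K * (- s * Rpower (INR n) (- s - 1)))
  = INR h * (K * (- s * Rpower c (- s - 1)) - K * (- s * Rpower (INR n) (- s - 1))).
  have -> : K * Rpower (INR n + INR h) (- s) - K * Rpower (INR n) (- s)
   = K * (Rpower (INR n + INR h) (- s) - Rpower (INR n) (- s)) by ring.
  by rewrite e; ring.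
have [k1 k2] := key (INR n) c nR c1 ltac:(lra).
have lam0 : 0 < lam by apply: Rmult_lt_0_compat => //; apply: Rpower_pos.
have kl : 0 < Rpower 2 (s + 2) * lam.
  by apply: Rmult_lt_0_compat => //; apply: Rpower_pos.
rewrite Rabs_pos_eq; last by apply: Rmult_le_pos => //; nra.
have -> : Rpower 2 (s + 2) * lam * INR h ^ 2
  = INR h * (Rpower 2 (s + 2) * lam * INR h) by ring.
apply: Rmult_le_compat_l => //.
apply: Rle_trans k2 _; apply: Rmult_le_compat_l; lra.
Qed.

Lemma harmonic_pow2 (j : nat) : harmonic (2 ^ j) <= 1 + INR j.
Proof.
elim: j => [|j IH]; first by rewrite /harmonic expn0 big_nat1 /=; lra.
rewrite S_INR /harmonic (@big_cat_nat _ _ _ (2 ^ j).+1) //=; last first.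
  by rewrite ltnS leq_exp2l.
rewrite -/(harmonic (2 ^ j)).
have p0 : (0 < 2 ^ j)%N by rewrite expn_gt0.
have pR := INR_gt0 _ p0.
suff : \big[Rplus/0]_((2 ^ j).+1 <= i < (2 ^ j.+1).+1) / INR i <= 1 by lra.
apply: (Rle_trans _ (\big[Rplus/0]_((2 ^ j).+1 <= i < (2 ^ j.+1).+1) / INR (2 ^ j))).
  rewrite !big_nat; apply: rsum_le => i /andP[i1 i2].
  by apply: Rinv_le_contravar => //; apply: INR_leq; lia.
rewrite rsum_const size_iota expnS.
have -> : ((2 * 2 ^ j).+1 - (2 ^ j).+1)%N = (2 ^ j)%N by lia.
by right; field; lra.
Qed.

Lemma Rpower2_ge1 (s : R) : 0 <= s -> 1 <= Rpower 2 s.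
Proof.
by move=> s0; rewrite -(Rpower_O 2); [apply: Rle_Rpower; lra | lra].
Qed.

(** On the range from [Z 2^j] to [Z 2^(j+1)] the choice [T = 2^j] makes the length divided by [T] at
    most [Z], and the hypotheses bound the other two terms of [curved_psi_sum] by [c Z]. Each range
    thus costs [O(Z (1 + j))], the second factor from [harmonic], and adding the ranges gives
    [(1 + j)^2]. The terms below [Z] are bounded trivially. *)
Lemma psi_sum_dyadic (K s c : R) (Z : nat) (j E : nat) :
  0 < K -> 0 < s -> (0 < Z)%N -> 0 <= c ->
  (forall i, (Z * 2 ^ i < E)%N ->
     let lam := K * s * (s + 1) * Rpower (2 * INR (Z * 2 ^ i)) (- (s + 2)) in
     [/\ lam * INR (2 ^ i) ^ 3 <= 1, / (INR (2 ^ i) * lam) <= c * INR Z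
       & INR (2 ^ i) <= c * INR Z]) ->
  (E <= Z * 2 ^ j)%N ->
  Rabs (\big[Rplus/0]_(1 <= n < E) psi (K * Rpower (INR n) (- s)))
    <= 40 * Rpower 2 (s + 2) ^ 2 * (1 + 2 * c) * INR Z * (1 + INR j) ^ 2.
Proof.
move=> K0 s0 Z0 c0.
have ZR := INR_ge1 _ Z0.
have k1 := Rpower2_ge1 (s + 2) ltac:(lra).
set kap := Rpower 2 (s + 2) in k1 *.
have kk : 1 <= kap ^ 2 by nra.
have kc : 1 <= kap ^ 2 * (1 + 2 * c) by nra.
have kcZ : INR Z <= kap ^ 2 * (1 + 2 * c) * INR Z by nra.
elim: j E => [|j IH] E cond leE.
  apply: Rle_trans (rsum_abs _ _ _ _) _.
  apply: Rle_trans (rsum_le _ _ _ _ (fun _ => 1 / 2) (fun n _ => psi_bound _)) _.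
  rewrite rsum_const size_iota /=.
  have h : INR (E - 1) <= INR Z by apply: INR_leq; lia.
  by have := pos_INR (E - 1); nra.
have j0 := pos_INR j.
have X0 : 0 <= 40 * kap ^ 2 * (1 + 2 * c) * INR Z by nra.
rewrite S_INR.
have [le|gt] := leqP E (Z * 2 ^ j).
  apply: Rle_trans (IH E cond le) _.
  by apply: Rmult_le_compat_l => //; nra.
set M := (Z * 2 ^ j)%N in gt.
have p0 : (0 < 2 ^ j)%N by rewrite expn_gt0.
have M0 : (0 < M)%N by rewrite muln_gt0 Z0.
rewrite (@big_cat_nat _ _ _ M) //=; last by lia.
apply: Rle_trans (Rabs_triang _ _) _.
have b1 := IH M (fun i iM => cond i ltac:(lia)) (leqnn M).
have [l1 l2 l3] := cond j gt; rewrite -/M in l1 l2.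
set lam := K * s * (s + 1) * Rpower (2 * INR M) (- (s + 2)) in l1 l2.
have lam0 : 0 < lam.
  apply: Rmult_lt_0_compat; last exact: Rpower_pos.
  by apply: Rmult_lt_0_compat; nra.
have EM : (E <= 2 * M)%N by move: leE; rewrite expnS /M; lia.
have b2 := curved_psi_sum _ _ M E (2 ^ j) lam kap
  (curved_power K s M E K0 s0 M0 EM) (ltnW gt) p0 lam0 k1 l1.
have hj := harmonic_pow2 j; have h1 := harmonic_ge1 _ p0.
have pR := INR_gt0 _ p0.
have q1 : INR (E - M) / INR (2 ^ j) <= INR Z.
  apply/Rle_div_l => //; rewrite -mult_INR; apply: INR_leq; rewrite -/M; lia.
have q0 : 0 <= INR (E - M) / INR (2 ^ j) by apply: Rdiv_le_0_compat => //; apply: pos_INR.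
have q2 : 0 < / (INR (2 ^ j) * lam) by apply: Rinv_0_lt_compat; nra.
set S := INR (E - M) / INR (2 ^ j) + / (INR (2 ^ j) * lam) + INR (2 ^ j) in b2.
have S0 : 0 <= S by rewrite /S; lra.
have S1 : S <= (1 + 2 * c) * INR Z by rewrite /S; lra.
have b3 : 40 * kap ^ 2 * harmonic (2 ^ j) * S
   <= 40 * kap ^ 2 * (1 + INR j) * ((1 + 2 * c) * INR Z).
  apply: Rmult_le_compat => //; first by nra.
  by apply: Rmult_le_compat_l; nra.
have -> : 40 * kap ^ 2 * (1 + 2 * c) * INR Z * (1 + (INR j + 1)) ^ 2
   = 40 * kap ^ 2 * (1 + 2 * c) * INR Z * (1 + INR j) ^ 2
     + 40 * kap ^ 2 * (1 + INR j) * ((1 + 2 * c) * INR Z)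
     + 40 * kap ^ 2 * (1 + 2 * c) * INR Z * (2 + INR j) by ring.
have : 0 <= 40 * kap ^ 2 * (1 + 2 * c) * INR Z * (2 + INR j) by nra.
lra.
Qed.

Lemma ln_INR_pow2 (i : nat) : ln (INR (2 ^ i)) = INR i * ln 2.
Proof.
elim: i => [|i IH]; first by rewrite expn0 /= ln_1; ring.
rewrite expnS mult_INR ln_mult; first by rewrite IH (S_INR i) -[INR 2]/2; ring.
  by apply: INR_gt0.
by apply: INR_gt0; rewrite expn_gt0.
Qed.

Lemma exp_le (x y : R) : x <= y -> exp x <= exp y.
Proof. by case=> [/exp_increasing|->]; lra. Qed.

Lemma ln_nonneg (x : R) : 1 <= x -> 0 <= ln x.
Proof. by move=> h; rewrite -ln_1; apply: ln_le; lra. Qed.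

(* For [f'' ~ x m^-5] ([s = 3]) or [f'' ~ x^(1/3) m^(-7/3)] ([s = 1/3]) on the
   dyadic block starting at [m = Z t], with [Z ~ x^(1/5)] and [m <= 16 x^(1/4)],
   the choice of block length [T = t] meets the requirements of
   [psi_sum_dyadic]. *)
Lemma block_conditions (s k x Z t : R) :
  (s = 3 /\ k = 1) \/ (s = 1 / 3 /\ k = 1 / 3) ->
  1 <= x -> 1 <= Z -> 1 <= t -> x <= Z ^ 5 -> Z ^ 5 <= 32 * x ->
  (Z * t) ^ 4 <= 65536 * x ->
  let lam := Rpower x k * s * (s + 1) * Rpower (2 * (Z * t)) (- (s + 2)) in
  [/\ lam * t ^ 3 <= 1, / (t * lam) <= exp (23 * ln 2) * Z
    & t <= exp (23 * ln 2) * Z].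
Proof.
move=> sk x1 Z1 t1 xZ Zx mx lam.
have l0 : 0 < ln 2 by rewrite -ln_1; apply: ln_increasing; lra.
set l := ln 2 in l0 *.
have lnp (y : R) (n : nat) : 0 < y -> ln (y ^ n) = INR n * ln y.
  by move=> y0; rewrite -ln_pow.
have Zt : 0 < Z * t by nra.
(* In logarithms all hypotheses and claims are linear in [ln x], [ln Z], [ln t] and [ln 2];
   [s (s + 1)], equal to 12 or 4/9, is enclosed between powers of 2. *)
have h1 : ln x <= 5 * ln Z.
  by have := ln_le x (Z ^ 5) ltac:(lra) xZ; rewrite lnp ?[INR 5]/=; lra.
have h2 : 5 * ln Z <= 5 * l + ln x.
  have := ln_le (Z ^ 5) (32 * x) (pow_lt Z 5 ltac:(lra)) Zx; rewrite lnp; last by lra.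
  rewrite (ln_mult 32 x); [|lra..].
  have -> : 32 = 2 ^ 5 by ring.
  by rewrite lnp ?[INR 5]/= -/l; lra.
have h3 : 4 * (ln Z + ln t) <= 16 * l + ln x.
  have := ln_le _ _ (pow_lt _ 4 Zt) mx; rewrite lnp //.
  rewrite (ln_mult Z t) ?(ln_mult 65536 x); [|lra..].
  have -> : 65536 = 2 ^ 16 by ring.
  by rewrite lnp ?[INR 4]/= ?[INR 16]/= -/l; lra.
have z0 := ln_nonneg _ Z1; have tau0 := ln_nonneg _ t1.
have lb : (s = 3 -> 3 * l <= ln (s * (s + 1)) <= 4 * l)
   /\ (s = 1 / 3 -> - 2 * l <= ln (s * (s + 1)) <= - l).
  split=> ->.
    have -> : 3 * l = ln (2 ^ 3) by rewrite lnp ?[INR _]/= -/l; lra.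
    have -> : 4 * l = ln (2 ^ 4) by rewrite lnp ?[INR _]/= -/l; lra.
    by split; apply: ln_le; lra.
  have -> : - 2 * l = ln (/ 2 ^ 2).
    by rewrite ln_Rinv ?lnp ?[INR _]/= -/l; lra.
  have -> : - l = ln (/ 2) by rewrite ln_Rinv -/l; lra.
  have -> : / 2 ^ 2 = 1 / 4 by field.
  by split; apply: ln_le; lra.
have s0 : 0 < s by case: sk => -[-> _]; lra.
have lamE : lam = exp (k * ln x + ln (s * (s + 1))
    - (s + 2) * (l + (ln Z + ln t))).
  have -> : lam = Rpower x k * (s * (s + 1) * Rpower (2 * (Z * t)) (- (s + 2))).
    by rewrite /lam; ring.
  have ss : 0 < s * (s + 1) by nra.
  move: (s * (s + 1)) ss => c c0.
  rewrite /Rpower (ln_mult 2) ?(ln_mult Z t); [|lra..].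
  rewrite -{1}(exp_ln c) // -!exp_plus; congr exp; rewrite -/l; ring.
have tE : t = exp (ln t) by rewrite exp_ln; lra.
have ZE : Z = exp (ln Z) by rewrite exp_ln; lra.
have t3 : t ^ 3 = exp (3 * ln t).
  have -> : 3 * ln t = ln t + (ln t + ln t) by ring.
  by rewrite !exp_plus -tE; ring.
rewrite lamE; set lz := ln Z in h1 h2 h3 z0 ZE *; set lt := ln t in h3 tau0 tE t3 *.
set lx := ln x in h1 h2 h3 *.
split.
- rewrite t3 -exp_plus -[X in _ <= X]exp_0; apply: exp_le.
  case: sk lb => -[-> ->] [lb1 lb2]; [have [? ?] := lb1 erefl|have [? ?] := lb2 erefl]; lra.
(* The case [s = 3] dictates the 23: [-ln (t lam)] is at most [7 ln 2 + 4 ln t] by [h2], and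
   [4 ln t <= 16 ln 2 + ln Z] by [h3] and [h1]. *)
- rewrite {1}tE {1}ZE -!exp_plus -exp_Ropp; apply: exp_le.
  case: sk lb => -[-> ->] [lb1 lb2]; [have [? ?] := lb1 erefl|have [? ?] := lb2 erefl]; lra.
- rewrite {1}tE {1}ZE -!exp_plus; apply: exp_le; lra.
Qed.

(** * Euler-Maclaurin summation of [n^-s] *)

(** The quantity is the error of the trapezoidal rule for [x^-s] on [[a, a + 1]]. As a function [G]
    of the length [t] it vanishes at 0, and two uses of the mean value theorem express its
    derivative through the second derivative of [x^-s]. Only the order of decay matters, not the
    constant. *)
Lemma trapezoid_Rpower (s a : R) : 0 < s -> s <> 1 -> 0 < a ->
  Rabs ((Rpower (a + 1) (1 - s) - Rpower a (1 - s)) / (1 - s)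
     - (Rpower a (- s) + Rpower (a + 1) (- s)) / 2)
    <= s * (s + 1) * Rpower a (- (s + 2)).
Proof.
move=> s0 s1 a0.
pose G t := (Rpower (a + t) (1 - s) - Rpower a (1 - s)) / (1 - s)
     - t * (Rpower a (- s) + Rpower (a + t) (- s)) / 2.
pose dG t := (Rpower (a + t) (- s) - Rpower a (- s)) / 2
     - t * (- s * Rpower (a + t) (- s - 1)) / 2.
have dsh b t : 0 <= t -> is_derive (fun t => Rpower (a + t) b) t (b * Rpower (a + t) (b - 1)).
  move=> t0.
  have h := is_derive_comp (fun x => Rpower x b) (fun t => a + t) t _ 1
    (is_derive_Rpower b (a + t) ltac:(lra)).
  move: h; rewrite /scal /= /mult /= Rmult_1_l; apply.
  by auto_derive => //; ring.
have GdG t : 0 <= t -> is_derive G t (dG t).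
  move=> t0.
  have d1 := dsh (1 - s) t t0; have d2 := dsh (- s) t t0.
  rewrite /G.
  evar_last.
    apply: is_derive_minus.
      apply: (is_derive_scal_l (fun t => Rpower (a + t) (1 - s) - Rpower a (1 - s)) t _ (/ (1 - s))).
      by apply: is_derive_minus d1 _; apply: is_derive_const.
    apply: (is_derive_scal_l (fun t => t * (Rpower a (- s) + Rpower (a + t) (- s))) t _ (/ 2)).
    apply: is_derive_mult; [exact: is_derive_id | | exact: Rmult_comm].
    by apply: is_derive_plus d2; apply: is_derive_const.
  rewrite /dG /minus /plus /opp /scal /mult /Hierarchy.zero /Hierarchy.one /= /mult /= /Hierarchy.one /=.
  have -> : 1 - s - 1 = - s by ring.
  by field; lra.
set M := s * (s + 1) * Rpower a (- (s + 2)).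
have M0 : 0 <= M by apply: Rmult_le_pos; [nra | apply/Rlt_le/Rpower_pos].
have bd t : 0 <= t <= 1 -> Rabs (dG t) <= M.
  move=> [t0 t1].
  have [c [[c1 c2] e1]] := Rpower_mvt (- s) a (a + t) a0 ltac:(lra).
  have [d [[d1 d2] e2]] := Rpower_mvt (- s - 1) c (a + t) ltac:(lra) c2.
  have -> : dG t = - (t / 2) * (- s) * (Rpower (a + t) (- s - 1) - Rpower c (- s - 1)).
    by rewrite /dG e1; field.
  rewrite e2.
  have -> : - s - 1 - 1 = - (s + 2) by ring.
  have h := Rpower_anti a d (s + 2) ltac:(lra) ltac:(lra).
  have h0 := Rpower_pos d (- (s + 2)).
  have -> : - (t / 2) * - s * ((- s - 1) * Rpower d (- (s + 2)) * (a + t - c))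
    = - (s * (s + 1) * (t * (a + t - c) / 2 * Rpower d (- (s + 2)))) by field.
  rewrite Rabs_Ropp Rabs_pos_eq; last first.
    apply: Rmult_le_pos; first by nra.
    by apply: Rmult_le_pos; nra.
  rewrite /M; apply: Rmult_le_compat_l; first by nra.
  have : t * (a + t - c) / 2 <= 1 by nra.
  have : 0 <= t * (a + t - c) / 2 by nra.
  by nra.
have [|t|c] := MVT_gen G 0 1 dG.
- by move=> t; rewrite Rmin_left ?Rmax_right; try lra; move=> [h _]; apply: GdG; lra.
- rewrite Rmin_left ?Rmax_right; try lra; move=> [h _].
  apply/derivable_continuous_pt/ex_derive_Reals_0.
  by eexists; apply: GdG.
rewrite Rmin_left ?Rmax_right; try lra; move=> [cc].
have -> : G 0 = 0 by rewrite /G Rplus_0_r; field; lra.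
have -> : (Rpower (a + 1) (1 - s) - Rpower a (1 - s)) / (1 - s)
     - (Rpower a (- s) + Rpower (a + 1) (- s)) / 2 = G 1 by rewrite /G; field; lra.
rewrite Rminus_0_r => ->; rewrite Rminus_0_r Rmult_1_r.
exact: bd.
Qed.

(** The Euler-Maclaurin approximation of [zeta(s)]. Keeping half of the last term improves the rate
    from [A^-s] to [A^-(s+1)]; without it the error multiplied by [N] would be of order
    [N^(1/4)]. *)
Definition em_seq (s : R) (A : nat) : R :=
  \big[Rplus/0]_(1 <= a < A.+1) Rpower (INR a) (- s)
    - Rpower (INR A) (1 - s) / (1 - s) - Rpower (INR A) (- s) / 2.

(** One step is a trapezoidal error, of order [A^(-s-2)]; it is dominated by a difference of
    [A^(-s-1)] so that the steps telescope. The factor [2^(s+2)] comes from comparing [A] with an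
    intermediate point, which is at most [2 A]. *)
Lemma em_seq_step (s : R) (A : nat) : 0 < s -> s <> 1 -> (0 < A)%N ->
  Rabs (em_seq s A.+1 - em_seq s A)
    <= s * Rpower 2 (s + 2) *
       (Rpower (INR A) (- (s + 1)) - Rpower (INR A.+1) (- (s + 1))).
Proof.
move=> s0 s1 A0; have AR := INR_ge1 _ A0.
rewrite /em_seq big_nat_recr //= -/(INR A.+1) S_INR.
set S := \big[Rplus/0]_(1 <= a < _) _.
have -> : S + Rpower (INR A + 1) (- s) - Rpower (INR A + 1) (1 - s) / (1 - s) -
  Rpower (INR A + 1) (- s) / 2 - (S - Rpower (INR A) (1 - s) / (1 - s) -
   Rpower (INR A) (- s) / 2)
  = - ((Rpower (INR A + 1) (1 - s) - Rpower (INR A) (1 - s)) / (1 - s)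
     - (Rpower (INR A) (- s) + Rpower (INR A + 1) (- s)) / 2) by field; lra.
rewrite Rabs_Ropp.
apply: Rle_trans (trapezoid_Rpower s (INR A) s0 s1 ltac:(lra)) _.
have [c [[c1 c2] e]] := Rpower_mvt (- (s + 1)) (INR A) (INR A + 1) ltac:(lra) ltac:(lra).
have -> : Rpower (INR A) (- (s + 1)) - Rpower (INR A + 1) (- (s + 1))
   = (s + 1) * Rpower c (- (s + 2)).
  have -> : - (s + 2) = - (s + 1) - 1 by ring.
  by rewrite -[LHS]Ropp_involutive Ropp_minus_distr e; ring.
have h : Rpower (2 * INR A) (- (s + 2)) <= Rpower c (- (s + 2)).
  by apply: Rpower_anti; lra.
have e2 : Rpower 2 (s + 2) * Rpower (2 * INR A) (- (s + 2)) = Rpower (INR A) (- (s + 2)).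
  rewrite -Rpower_mult_distr; [|lra..].
  rewrite [Rpower 2 (- _)]Rpower_Ropp.
  by have := Rpower_pos 2 (s + 2) => h2; field; lra.
rewrite -e2.
have -> : s * Rpower 2 (s + 2) * ((s + 1) * Rpower c (- (s + 2)))
  = s * (s + 1) * (Rpower 2 (s + 2) * Rpower c (- (s + 2))) by ring.
apply: Rmult_le_compat_l; first by nra.
by apply: Rmult_le_compat_l => //; apply/Rlt_le/Rpower_pos.
Qed.

Lemma Rpower_neg_lim (s : R) : 0 < s ->
  is_lim_seq (fun A => Rpower (INR A.+1) (- s)) 0.
Proof.
move=> s0.
apply: (is_lim_seq_ext (fun A => / Rpower (INR A.+1) s)).
  by move=> n; rewrite Rpower_Ropp.
apply: (is_lim_seq_inv _ p_infty) => //.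
apply/is_lim_seq_p_infty_Reals => M.
have [n hn] := INR_unbounded (Rpower (Rmax M 1) (/ s)).
exists n => m /leP nm.
have : INR n <= INR m.+1 by apply: INR_leq; lia.
move=> hm; apply: Rle_lt_trans (Rmax_l M 1) _.
have M1 := Rmax_r M 1; move: (Rmax M 1) M1 hn => M' M1 hn.
rewrite -{1}(Rpower_1 M'); last by lra.
have <- : / s * s = 1 by field; lra.
rewrite -Rpower_mult; apply: Rlt_Rpower_l => //; split; first exact: Rpower_pos.
lra.
Qed.

(** The limit is stated without the half term, which tends to 0, because that form is the one met
    again when [L] is identified with a value of [zeta]; the rate is stated for [em_seq], where it
    is better. *)
Lemma em_limit (s : R) : 0 < s -> s <> 1 ->
  exists L : R, is_lim_seq (fun A => \big[Rplus/0]_(1 <= a < A.+2) Rpower (INR a) (- s)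
                          - Rpower (INR A.+1) (1 - s) / (1 - s)) L
    /\ forall A, (0 < A)%N ->
       Rabs (em_seq s A - L) <= s * Rpower 2 (s + 2) * Rpower (INR A) (- (s + 1)).
Proof.
move=> s0 s1.
set C := s * Rpower 2 (s + 2).
have C0 : 0 < C by apply: Rmult_lt_0_compat => //; apply: Rpower_pos.
have tel A k : (0 < A)%N -> Rabs (em_seq s (A + k) - em_seq s A) <=
   C * (Rpower (INR A) (- (s + 1)) - Rpower (INR (A + k)) (- (s + 1))).
  move=> A0; elim: k => [|k IH].
    by rewrite addn0 !Rminus_diag Rabs_R0; lra.
  rewrite addnS.
  have h := em_seq_step s (A + k) s0 s1 ltac:(lia).
  have -> : em_seq s (A + k).+1 - em_seq s A
    = (em_seq s (A + k).+1 - em_seq s (A + k)) + (em_seq s (A + k) - em_seq s A) by ring.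
  apply: Rle_trans (Rabs_triang _ _) _; rewrite -/C in h; lra.
have tel2 A B : (0 < A <= B)%N -> Rabs (em_seq s B - em_seq s A) <=
   C * Rpower (INR A) (- (s + 1)).
  move=> /andP[A0 AB]; have := tel A (B - A)%N A0; rewrite subnKC // => h.
  apply: Rle_trans h _; apply: Rmult_le_compat_l; first by lra.
  by have := Rpower_pos (INR B) (- (s + 1)); lra.
have [L hL] : ex_finite_lim_seq (fun A => em_seq s A.+1).
  apply/ex_lim_seq_cauchy_corr => e.
  have := Rpower_neg_lim (s + 1) ltac:(lra).
  have eC : 0 < e / C by apply: Rdiv_lt_0_compat => //; apply: cond_pos.
  move/is_lim_seq_spec => /(_ (mkposreal _ eC)) [n hn].
  have key a b : (n <= a)%N -> (a <= b)%N -> Rabs (em_seq s b.+1 - em_seq s a.+1) < e.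
    move=> na ab.
    apply: Rle_lt_trans (tel2 a.+1 b.+1 ltac:(lia)) _.
    have := hn a (elimT leP na); rewrite Rminus_0_r /= -/(INR a.+1) => h.
    have := Rle_abs (Rpower (INR a.+1) (- (s + 1))) => h2.
    have -> : pos e = C * (e / C) by field; lra.
    by apply: Rmult_lt_compat_l => //; lra.
  exists n => a b /leP na /leP nb.
  case/orP: (leq_total a b) => ab; last exact: key.
  by rewrite Rabs_minus_sym; apply: key.
exists L; split.
  apply: (is_lim_seq_ext (fun A => em_seq s A.+1 + / 2 * Rpower (INR A.+1) (- s))).
    by move=> n; rewrite /em_seq; field; lra.
  rewrite -[L](_ : L + / 2 * 0 = L); last by ring.
  apply: is_lim_seq_plus' => //.
  by apply: is_lim_seq_mult'; [exact: is_lim_seq_const | exact: Rpower_neg_lim].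
move=> A A0.
have h : is_lim_seq (fun n => Rabs (em_seq s A - em_seq s n.+1)) (Rabs (em_seq s A - L)).
  apply: (is_lim_seq_abs _ (em_seq s A - L)).
  by apply: is_lim_seq_minus' => //; apply: is_lim_seq_const.
apply: (is_lim_seq_le_loc _ _ _ _ _ h (is_lim_seq_const _)).
exists A => n /leP An; rewrite Rabs_minus_sym; apply: tel2; lia.
Qed.

(** * The divisor problem for [a b^3] *)

Lemma floor_psi (n : nat) (t : R) : INR n <= t < INR n + 1 ->
  INR n = t - psi t - 1 / 2.
Proof.
move=> [h1 h2]; rewrite /psi /frac_part.
rewrite -(Int_part_spec t (Z.of_nat n)) -?INR_IZR_INZ; [ring | lra].
Qed.

Lemma INR_divn (N d : nat) : (0 < d)%N ->
  INR (N %/ d) = INR N / INR d - psi (INR N / INR d) - 1 / 2.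
Proof.
move=> d0; have dR := INR_gt0 _ d0; apply: floor_psi; split.
  by apply/Rle_div_r => //; rewrite -mult_INR; apply: INR_leq; apply: leq_divM.
apply/Rlt_div_l => //.
by rewrite -S_INR -mult_INR; apply: INR_ltn; apply: ltn_ceil.
Qed.

Lemma sum_leq (A m : nat) : (\sum_(1 <= a < A.+1) (a <= m) = minn A m)%N.
Proof.
elim: A => [|A IH]; first by rewrite big_geq // min0n.
by rewrite big_nat_recr //= IH; lia.
Qed.

(** The number of pairs [(a, b)] of positive integers with [a b^3 <= N], that is, the summatory
    function of the coefficients of [zeta(s) zeta(3s)]. *)
Definition cube_sum (N : nat) : nat := (\sum_(1 <= b < N.+1) N %/ b ^ 3)%N.

(** With [A = N %/ B ^ 3], each pair has [b <= B] or [a <= A], and the whole rectangle [a <= A],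
    [b <= B] satisfies [a b^3 <= N], so exactly [A B] pairs are counted twice. The identity is kept
    additive to avoid truncated subtraction. *)
Lemma cube_sum_hyperbola (N B : nat) : (0 < B)%N -> (B ^ 3 <= N)%N ->
  (cube_sum N + N %/ B ^ 3 * B =
   \sum_(1 <= b < B.+1) N %/ b ^ 3 +
   \sum_(1 <= a < (N %/ B ^ 3).+1) \sum_(1 <= b < N.+1) (a * b ^ 3 <= N))%N.
Proof.
move=> B0 BN; set A := (N %/ B ^ 3)%N.
have BleN : (B <= N)%N by apply: leq_trans BN; rewrite -{1}[B]expn1 leq_pexp2l.
have E a : (1 <= a < A.+1)%N -> (\sum_(1 <= b < N.+1) (a * b ^ 3 <= N)
    = B + \sum_(B.+1 <= b < N.+1) (a * b ^ 3 <= N))%N.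
  move=> /andP[a1 aA]; rewrite (@big_cat_nat _ _ _ B.+1) //=; congr addn.
  rewrite big_nat (eq_bigr (fun=> 1%N)); last first.
    move=> b /andP[b1 bB].
    have -> // : (a * b ^ 3 <= N)%N.
    apply: (@leq_trans (A * B ^ 3)); last exact: leq_divM.
    by apply: leq_mul => //; rewrite leq_exp2r.
  by rewrite -big_nat sum_nat_const_nat; lia.
rewrite [X in _ = (_ + X)%N]big_nat (eq_bigr _ E) -big_nat big_split /=.
rewrite sum_nat_const_nat subn1 /=.
suff -> : cube_sum N = (\sum_(1 <= b < B.+1) N %/ b ^ 3 +
    \sum_(1 <= a < A.+1) \sum_(B.+1 <= b < N.+1) (a * b ^ 3 <= N))%N.
  by rewrite -addnA; congr addn; rewrite addnC.
rewrite /cube_sum (@big_cat_nat _ _ _ B.+1) //=; congr addn.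
rewrite exchange_big /=; apply: congr_big_nat => // b /andP[b1 bN].
rewrite (eq_bigr (fun a => nat_of_bool (a <= N %/ b ^ 3)%N)); last first.
  by move=> a _; rewrite leq_divRL // expn_gt0; lia.
(* For [b > B] the restriction to [a <= A] loses nothing, since [N %/ b ^ 3 <= N %/ B ^ 3]. *)
rewrite sum_leq; apply/esym/minn_idPr.
apply: leq_div2l; first by rewrite expn_gt0 B0.
by rewrite leq_exp2r //; lia.
Qed.

(** The admissible [b] form an initial segment that ends at the integer part of [(N / a)^(1/3)];
    comparing cubes identifies its end [m]. *)
Lemma cube_count_psi (N a : nat) : (0 < a)%N -> (0 < N)%N ->
  let t := Rpower (INR N) (1 / 3) * Rpower (INR a) (- (1 / 3)) in
  INR (\sum_(1 <= b < N.+1) (a * b ^ 3 <= N)%N) = t - psi t - 1 / 2.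
Proof.
move=> a0 N0 t.
have aR := INR_gt0 _ a0; have NR := INR_gt0 _ N0.
have bN b : (a * b ^ 3 <= N)%N -> (b <= N)%N.
  move=> h; apply: leq_trans h; apply: (@leq_trans (b ^ 3)); last by rewrite leq_pmull.
  by case: b => // b; rewrite -{1}[b.+1]expn1 leq_pexp2l.
have ex0 : exists b, (a * b ^ 3 <= N)%N by exists 0%N; rewrite exp0n ?muln0.
have [m hm mmax] := ex_maxnP ex0 bN.
have dn b : (a * b ^ 3 <= N)%N = (b <= m)%N.
  apply/idP/idP => [/mmax //|bm]; apply: leq_trans hm.
  by rewrite leq_mul2l leq_exp2r // bm orbT.
rewrite (eq_bigr (fun b => nat_of_bool (b <= m)%N)); last by move=> b _; rewrite dn.
rewrite sum_leq (minn_idPr (bN _ hm)).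
apply: floor_psi.
have t0 : 0 < t by apply: Rmult_lt_0_compat; apply: Rpower_pos.
have t3 : INR a * t ^ 3 = INR N.
  rewrite /t Rpow_mult_distr -!Rpower_pow; try exact: Rpower_pos.
  rewrite !Rpower_mult [INR 3]/=.
  have -> : 1 / 3 * (1 + 1 + 1) = 1 by field.
  have -> : - (1 / 3) * (1 + 1 + 1) = - (1) by field.
  rewrite Rpower_Ropp !Rpower_1 //; field; lra.
have pw b : INR (a * b ^ 3) = INR a * INR b ^ 3.
  by rewrite !expnS expn0 !mult_INR /=; ring.
have m0 := pos_INR m.
split.
  have h : INR a * INR m ^ 3 <= INR a * t ^ 3 by rewrite t3 -pw; apply: INR_leq.
  apply: Rnot_lt_le => lt.
  have : 0 < (INR m - t) * (INR m ^ 2 + INR m * t + t ^ 2).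
    by apply: Rmult_lt_0_compat; nra.
  nra.
have h : INR a * t ^ 3 < INR a * INR m.+1 ^ 3.
  by rewrite t3 -pw; apply: INR_ltn; rewrite ltnNge dn ltnn.
rewrite -S_INR; apply: Rnot_le_lt => le.
have : INR m.+1 ^ 3 <= t ^ 3 by apply: pow_incr; split => //; apply: pos_INR.
nra.
Qed.

(** What remains of the smooth terms after both Euler-Maclaurin expansions, for [b = B],
    [al = A^(1/3)] and [y = (N / B^3)^(1/3)]. In terms of [d = y - al], everything free of [d]
    cancels. The rounding of [A] forces [al^2 d <= 1/3], and with [b <= al^3] each remaining term is
    controlled by [al^2 d] or by [y^3 - al^3 <= 1]. *)
Lemma hyperbola_main (b y al : R) : 1 <= al -> al <= y -> 0 < b <= al ^ 3 ->
  y ^ 3 <= al ^ 3 + 1 ->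
  Rabs (b ^ 3 * y ^ 3 * (- (/ b ^ 2 / 2) + / b ^ 3 / 2) - b / 2
    + b * y * (3 / 2 * al ^ 2 + / al / 2) - al ^ 3 / 2 - al ^ 3 * b) <= 1.
Proof.
move=> al1 aly [b0 bal] y3.
pose d := y - al; have d0 : 0 <= d by rewrite /d; lra.
have yE : y = al + d by rewrite /d; ring.
have d1 : 3 * (al ^ 2 * d) <= y ^ 3 - al ^ 3.
  have -> : y ^ 3 - al ^ 3 = 3 * (al ^ 2 * d) + 3 * al * d ^ 2 + d ^ 3.
    by rewrite yE; ring.
  have : 0 <= al * d ^ 2 by apply: Rmult_le_pos; nra.
  have : 0 <= d ^ 3 by apply: pow_le.
  lra.
have -> : b ^ 3 * y ^ 3 * (- (/ b ^ 2 / 2) + / b ^ 3 / 2) - b / 2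
    + b * y * (3 / 2 * al ^ 2 + / al / 2) - al ^ 3 / 2 - al ^ 3 * b
  = - (3 / 2 * (b * al * d ^ 2)) - b * d ^ 3 / 2 + b * (d / al) / 2
    + (y ^ 3 - al ^ 3) / 2.
  by rewrite yE; field; lra.
have u0 : 0 <= al ^ 2 * d by apply: Rmult_le_pos => //; nra.
have h1 : 0 <= b * al * d ^ 2 <= (al ^ 2 * d) ^ 2.
  split; first by apply: Rmult_le_pos; nra.
  have -> : (al ^ 2 * d) ^ 2 = al ^ 3 * (al * d ^ 2) by ring.
  rewrite Rmult_assoc; apply: Rmult_le_compat_r => //.
  by apply: Rmult_le_pos; nra.
have h2 : 0 <= b * d ^ 3 <= (al ^ 2 * d) ^ 3.
  have p3 : 0 <= d ^ 3 by apply: pow_le.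
  split; first by apply: Rmult_le_pos; lra.
  have -> : (al ^ 2 * d) ^ 3 = al ^ 6 * d ^ 3 by ring.
  apply: Rmult_le_compat_r => //; apply: Rle_trans bal _.
  by apply: Rle_pow => //; lia.
have h3 : 0 <= b * (d / al) <= al ^ 2 * d.
  have p : 0 <= d / al by apply: Rdiv_le_0_compat; lra.
  split; first by apply: Rmult_le_pos; lra.
  have -> : al ^ 2 * d = al ^ 3 * (d / al) by field; lra.
  by apply: Rmult_le_compat_r.
set u := al ^ 2 * d in u0 d1 h1 h2 h3.
have u1 : u <= 1 / 3 by lra.
have u2 : u ^ 2 <= 1 / 9 by nra.
have u3 : u ^ 3 <= 1 / 9 by nra.
apply: Rabs_le; lra.
Qed.

Lemma nat_root (k N : nat) : (0 < k)%N -> (0 < N)%N ->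
  exists B, (B ^ k <= N < B.+1 ^ k)%N /\ (0 < B)%N.
Proof.
move=> k0 N0.
have ex1 : exists B, (B ^ k <= N)%N by exists 1%N; rewrite exp1n.
have bd B : (B ^ k <= N)%N -> (B <= N)%N.
  move=> h; apply: leq_trans h; case: B => // B.
  by rewrite -{1}[B.+1]expn1 leq_pexp2l.
have [B hB mx] := ex_maxnP ex1 bd.
exists B; split; last by apply: mx; rewrite exp1n.
by rewrite hB ltnNge; apply/negP => /mx; rewrite ltnn.
Qed.

Lemma INR_expn (b k : nat) : INR (b ^ k) = INR b ^ k.
Proof. by elim: k => [|k IH] //; rewrite expnS mult_INR IH. Qed.

Lemma Rpower_cube (y : R) : 0 < y -> Rpower y (1 / 3) ^ 3 = y.
Proof.
move=> y0; rewrite -Rpower_pow ?Rpower_mult; last exact: Rpower_pos.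
have -> : 1 / 3 * INR 3 = 1 by rewrite [INR 3]/=; field.
exact: Rpower_1.
Qed.

Lemma cube_le_inv (u v : R) : 0 <= u -> 0 <= v -> u ^ 3 <= v ^ 3 -> u <= v.
Proof.
move=> u0 v0 h; apply: Rnot_lt_le => lt.
have : 0 < (u - v) * (u ^ 2 + u * v + v ^ 2) by apply: Rmult_lt_0_compat; nra.
nra.
Qed.

(** The hyperbola identity with each integer part written as [t - psi t - 1/2]. The factor
    [Rpower x 1] is kept so that both sums of [psi] have the form required by [psi_sum_dyadic] and
    [block_conditions]. *)
Lemma cube_sum_psi (N B : nat) : (0 < B)%N -> (B ^ 4 <= N < B.+1 ^ 4)%N ->
  let A := (N %/ B ^ 3)%N in let x := INR N in
  INR (cube_sum N) =
    x * \big[Rplus/0]_(1 <= b < B.+1) Rpower (INR b) (- 3) - INR B / 2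
    - \big[Rplus/0]_(1 <= b < B.+1) psi (Rpower x 1 * Rpower (INR b) (- 3))
    + (Rpower x (1 / 3) * \big[Rplus/0]_(1 <= a < A.+1) Rpower (INR a) (- (1 / 3))
    - INR A / 2
    - \big[Rplus/0]_(1 <= a < A.+1) psi (Rpower x (1 / 3) * Rpower (INR a) (- (1 / 3))))
    - INR A * INR B.
Proof.
move=> B0 /andP[BN _] A x.
have N0 : (0 < N)%N by apply: leq_trans BN; rewrite expn_gt0 B0.
have BN3 : (B ^ 3 <= N)%N by apply: leq_trans BN; rewrite leq_pexp2l.
have xR : 0 < x by apply: INR_gt0.
have := f_equal INR (cube_sum_hyperbola N B B0 BN3).
rewrite -/A !plus_INR mult_INR => e.
have -> : INR (cube_sum N) = INR (\sum_(1 <= b < B.+1) N %/ b ^ 3)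
  + INR (\sum_(1 <= a < A.+1) \sum_(1 <= b < N.+1) (a * b ^ 3 <= N)%N)
  - INR A * INR B by lra.
congr (_ + _ - _).
  rewrite INR_sum big_nat.
  rewrite (eq_bigr (fun b => x * Rpower (INR b) (- 3) - 1 / 2
     - psi (Rpower x 1 * Rpower (INR b) (- 3)))); last first.
    move=> b /andP[b0 _]; have bR := INR_gt0 _ b0.
    rewrite INR_divn ?expn_gt0 ?b0 // Rpower_1 // Rpower_Ropp.
    have -> : Rpower (INR b) 3 = INR (b ^ 3).
      by rewrite INR_expn -Rpower_pow // (INR_IZR_INZ 3).
    by rewrite -/x /Rdiv; ring.
  rewrite -big_nat !rsum_minus rsum_scal rsum_const size_iota subn1 /=; lra.
rewrite INR_sum big_nat.
rewrite (eq_bigr (fun a => Rpower x (1 / 3) * Rpower (INR a) (- (1 / 3)) - 1 / 2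
     - psi (Rpower x (1 / 3) * Rpower (INR a) (- (1 / 3))))); last first.
  by move=> a /andP[a0 _]; rewrite cube_count_psi // -/x; ring.
rewrite -big_nat !rsum_minus rsum_scal rsum_const size_iota subn1 /=; lra.
Qed.

(** The constants enter only through their Euler-Maclaurin rates; that they are [zeta(3)] and
    [zeta(1/3)] is established separately. *)
Lemma cube_sum_asymp_dyadic (L3 L13 : R) :
  (forall A, (0 < A)%N ->
     Rabs (em_seq 3 A - L3) <= 3 * Rpower 2 (3 + 2) * Rpower (INR A) (- (3 + 1))) ->
  (forall A, (0 < A)%N ->
     Rabs (em_seq (1 / 3) A - L13)
       <= 1 / 3 * Rpower 2 (1 / 3 + 2) * Rpower (INR A) (- (1 / 3 + 1))) ->
  exists C, 0 <= C /\ forall N Z j : nat, (0 < N)%N -> (0 < Z)%N ->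
    (N <= Z ^ 5 <= 32 * N)%N -> (17 * N <= 2 ^ j)%N ->
    Rabs (INR (cube_sum N) - L3 * INR N - L13 * Rpower (INR N) (1 / 3))
      <= C * INR Z * (1 + INR j) ^ 2.
Proof.
move=> em3 em13.
pose c := exp (23 * ln 2).
have c0 : 0 < c by apply: exp_pos.
pose D3 := 40 * Rpower 2 (3 + 2) ^ 2 * (1 + 2 * c).
pose D13 := 40 * Rpower 2 (1 / 3 + 2) ^ 2 * (1 + 2 * c).
set C3 := 3 * Rpower 2 (3 + 2) in em3.
set C13 := 1 / 3 * Rpower 2 (1 / 3 + 2) in em13.
have C30 : 0 < C3 by apply: Rmult_lt_0_compat; [lra | exact: Rpower_pos].
have C130 : 0 < C13 by apply: Rmult_lt_0_compat; [lra | exact: Rpower_pos].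
have D30 : 0 <= D3.
  by apply: Rmult_le_pos; [have := pow2_ge_0 (Rpower 2 (3 + 2)); lra | lra].
have D130 : 0 <= D13.
  by apply: Rmult_le_pos; [have := pow2_ge_0 (Rpower 2 (1 / 3 + 2)); lra | lra].
(* [D3] and [D13] come from the sums of [psi] and 1 from [hyperbola_main]. The Euler-Maclaurin
   remainders contribute [C3 x / B^4] with [x < 16 B^4], and [C13 b y / al^4] with [b <= al^3] and
   [y <= 2 al]. *)
exists (D3 + D13 + 1 + 16 * C3 + 2 * C13); split; first by lra.
move=> N Z j N0 Z0 /andP[NZ ZN] Nj.
have [B [BN B0]] := nat_root 4 N isT N0.
have /andP[BN1 BN2] := BN.
set A := (N %/ B ^ 3)%N.
have B30 : (0 < B ^ 3)%N by rewrite expn_gt0 B0.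
have BA : (B <= A)%N by rewrite /A leq_divRL // -expnS.
have A0 : (0 < A)%N by lia.
(* From [N < (B + 1)^4 <= 16 B^4]. Thus both sums of [psi] have length at most [16 B], and
   [(16 B)^4 <= 65536 N] is the range allowed by [block_conditions]. *)
have A16 : (A <= 16 * B)%N.
  rewrite -ltnS /A ltn_divLR //; apply: (leq_trans BN2).
  apply: (@leq_trans ((2 * B) ^ 4)); first by rewrite leq_exp2r //; lia.
  by rewrite expnMn mulSn -mulnA -expnS; lia.
set x := INR N.
have xR : 1 <= x by apply: INR_ge1.
have ZR := INR_ge1 _ Z0; have BR := INR_ge1 _ B0; have AR := INR_ge1 _ A0.
have NZR := INR_leq _ _ NZ; rewrite INR_expn -/x in NZR.
have ZNR := INR_leq _ _ ZN; rewrite INR_expn mult_INR -/x in ZNR.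
have i32 : INR 32 = 32 by rewrite INR_IZR_INZ.
rewrite i32 in ZNR.
(* Both sums at once: [(3, 1)] stands for [N / b^3] and [(1/3, 1/3)] for [(N / a)^(1/3)]. The ranges
   reach the end because [16 B + 1 <= 17 N <= 2^j]. *)
have psi_bd s k E : (s = 3 /\ k = 1) \/ (s = 1 / 3 /\ k = 1 / 3) ->
    (E <= (16 * B).+1)%N ->
    Rabs (\big[Rplus/0]_(1 <= n < E) psi (Rpower x k * Rpower (INR n) (- s)))
    <= 40 * Rpower 2 (s + 2) ^ 2 * (1 + 2 * c) * INR Z * (1 + INR j) ^ 2.
  move=> sk EB; apply: psi_sum_dyadic => //; try lra.
  - exact: Rpower_pos.
  - move=> i iE; rewrite mult_INR.
    have p0 : (0 < 2 ^ i)%N by rewrite expn_gt0.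
    apply: block_conditions => //; first exact: INR_ge1.
    rewrite -mult_INR -INR_expn.
    have -> : 65536 = INR (16 ^ 4) by rewrite INR_expn (INR_IZR_INZ 16) /=; ring.
    rewrite -mult_INR; apply: INR_leq.
    apply: (@leq_trans ((16 * B) ^ 4)); first by rewrite leq_exp2r //; lia.
    by rewrite expnMn leq_mul2l BN1 orbT.
  - apply: (leq_trans EB).
    apply: (@leq_trans (2 ^ j)); last by rewrite leq_pmull.
    apply: leq_trans Nj.
    have : (B <= N)%N by apply: leq_trans BN1; rewrite -{1}[B]expn1 leq_pexp2l.
    lia.
have P3 := psi_bd 3 1 B.+1 (or_introl (conj erefl erefl)) ltac:(lia).
have P13 := psi_bd (1 / 3) (1 / 3) A.+1 (or_intror (conj erefl erefl)) ltac:(lia).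
rewrite (cube_sum_psi N B B0 BN) -/A -/x.
rewrite -/D3 in P3; rewrite -/D13 in P13.
set S3 := \big[Rplus/0]_(1 <= b < B.+1) Rpower (INR b) (- 3).
set S13 := \big[Rplus/0]_(1 <= b < A.+1) Rpower (INR b) (- (1 / 3)).
set Q3 := \big[Rplus/0]_(1 <= n < B.+1) _ in P3 *.
set Q13 := \big[Rplus/0]_(1 <= n < A.+1) _ in P13 *.
set b := INR B in BR *; set a := INR A in AR *.
set Y := x / b ^ 3.
have b3 : 0 < b ^ 3 by apply: pow_lt; lra.
have bB3 : INR (B ^ 3) = b ^ 3 by rewrite INR_expn.
have aY : a <= Y.
  by apply/Rle_div_r => //; rewrite -bB3 -mult_INR; apply: INR_leq; apply: leq_divM.
have Ya : Y < a + 1.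
  apply/Rlt_div_l => //; rewrite -bB3 -S_INR -mult_INR; apply: INR_ltn; exact: ltn_ceil.
pose y := Rpower Y (1 / 3); pose al := Rpower a (1 / 3).
have y3 : y ^ 3 = Y by apply: Rpower_cube; lra.
have al3 : al ^ 3 = a by apply: Rpower_cube; lra.
have y0 : 0 < y by apply: Rpower_pos.
have al0 : 0 < al by apply: Rpower_pos.
have al1 : 1 <= al by apply: cube_le_inv; lra.
have aly : al <= y by apply: cube_le_inv; lra.
have y2 : y <= 2 * al by apply: cube_le_inv; lra.
have ba : b <= a by apply: INR_leq.
have xE : x = b ^ 3 * y ^ 3 by rewrite y3 /Y; field; lra.
have x13 : Rpower x (1 / 3) = b * y.
  have e : Rpower x (1 / 3) ^ 3 = (b * y) ^ 3.
    by rewrite Rpower_cube; [rewrite Rpow_mult_distr | lra].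
  have p := Rpower_pos x (1 / 3).
  by apply: Rle_antisym; apply: cube_le_inv; nra.
have main := hyperbola_main b y al al1 aly ltac:(lra) ltac:(lra).
have e3 := em3 B B0; have e13 := em13 A A0.
rewrite /em_seq -/S3 -/b in e3; rewrite /em_seq -/S13 -/a in e13.
have pw t (n : nat) : 0 < t -> Rpower t (- INR n) = / t ^ n.
  by move=> t0; rewrite Rpower_Ropp Rpower_pow.
have r1 : Rpower b (1 - 3) = / b ^ 2.
  by rewrite -pw; [congr Rpower; simpl; ring | lra].
have r2 : Rpower b (- (3)) = / b ^ 3.
  by rewrite -pw; [congr Rpower; simpl; ring | lra].
have r3 : Rpower b (- (3 + 1)) = / b ^ 4.
  by rewrite -pw; [congr Rpower; simpl; ring | lra].
have r4 : Rpower a (1 - 1 / 3) = al ^ 2.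
  rewrite -Rpower_pow // /al Rpower_mult; congr Rpower; simpl; field.
have r5 : Rpower a (- (1 / 3)) = / al by rewrite Rpower_Ropp.
have r6 : Rpower a (- (1 / 3 + 1)) = / al ^ 4.
  by rewrite -pw // /al Rpower_mult; congr Rpower; simpl; field.
rewrite r1 r2 r3 in e3; rewrite r4 r5 r6 in e13.
set d3 := _ - L3 in e3; set d13 := _ - L13 in e13.
have -> : x * S3 - b / 2 - Q3 + (Rpower x (1 / 3) * S13 - a / 2 - Q13) - a * b
    - L3 * x - L13 * Rpower x (1 / 3)
  = (b ^ 3 * y ^ 3 * (- (/ b ^ 2 / 2) + / b ^ 3 / 2) - b / 2
    + b * y * (3 / 2 * al ^ 2 + / al / 2) - al ^ 3 / 2 - al ^ 3 * b)
    + (x * d3 + (b * y * d13 + (- Q3 + - Q13))).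
  rewrite x13 -xE /d3 /d13 al3; field; lra.
have t1 : Rabs (x * d3) <= 16 * C3.
  rewrite Rabs_mult Rabs_pos_eq; last by lra.
  apply: (Rle_trans _ (x * (C3 * / b ^ 4))).
    by apply: Rmult_le_compat_l; lra.
  have b4 : 0 < b ^ 4 by apply: pow_lt; lra.
  have -> : x * (C3 * / b ^ 4) = x / b ^ 4 * C3 by rewrite /Rdiv; ring.
  apply: Rmult_le_compat_r; first by lra.
  apply/Rle_div_l => //.
  have -> : 16 * b ^ 4 = INR (16 * B ^ 4).
    by rewrite mult_INR INR_expn (INR_IZR_INZ 16).
  apply: INR_leq; apply: ltnW; apply: (leq_trans BN2).
  by rewrite -[16%N]/(2 ^ 4)%N -expnMn leq_exp2r //; lia.
have t2 : Rabs (b * y * d13) <= 2 * C13.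
  rewrite Rabs_mult Rabs_pos_eq; last by nra.
  apply: (Rle_trans _ (b * y * (C13 * / al ^ 4))).
    by apply: Rmult_le_compat_l => //; nra.
  have a4 : 0 < al ^ 4 by apply: pow_lt.
  have -> : b * y * (C13 * / al ^ 4) = b * y / al ^ 4 * C13 by rewrite /Rdiv; ring.
  apply: Rmult_le_compat_r; first by lra.
  apply/Rle_div_l => //.
  have -> : 2 * al ^ 4 = al ^ 3 * (2 * al) by ring.
  by apply: Rmult_le_compat; lra.
have j0 := pos_INR j.
have ZJ : 1 <= INR Z * (1 + INR j) ^ 2.
  have : 1 <= (1 + INR j) ^ 2 by nra.
  nra.
have R1 := Rabs_triang (b ^ 3 * y ^ 3 * (- (/ b ^ 2 / 2) + / b ^ 3 / 2) - b / 2
    + b * y * (3 / 2 * al ^ 2 + / al / 2) - al ^ 3 / 2 - al ^ 3 * b)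
   (x * d3 + (b * y * d13 + (- Q3 + - Q13))).
have R2 := Rabs_triang (x * d3) (b * y * d13 + (- Q3 + - Q13)).
have R3 := Rabs_triang (b * y * d13) (- Q3 + - Q13).
have R4 := Rabs_triang (- Q3) (- Q13); rewrite !Rabs_Ropp in R4.
rewrite Rmult_assoc in P3; rewrite Rmult_assoc in P13; rewrite [X in _ <= X]Rmult_assoc.
set zj := INR Z * (1 + INR j) ^ 2 in P3 P13 ZJ *.
have : (1 + 16 * C3 + 2 * C13) <= (1 + 16 * C3 + 2 * C13) * zj by nra.
lra.
Qed.

Lemma nat_fifth_root (N : nat) : (0 < N)%N ->
  exists Z, (0 < Z)%N /\ (N <= Z ^ 5 <= 32 * N)%N.
Proof.
move=> N0; have [B [/andP[B1 B2] B0]] := nat_root 5 N isT N0.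
exists B.+1; split => //; rewrite (ltnW B2) /=.
apply: (@leq_trans ((2 * B) ^ 5)); first by rewrite leq_exp2r //; lia.
by rewrite expnMn -[(2 ^ 5)%N]/32%N leq_mul2l.
Qed.

Lemma cube_sum_asymp (L3 L13 : R) :
  (forall A, (0 < A)%N ->
     Rabs (em_seq 3 A - L3) <= 3 * Rpower 2 (3 + 2) * Rpower (INR A) (- (3 + 1))) ->
  (forall A, (0 < A)%N ->
     Rabs (em_seq (1 / 3) A - L13)
       <= 1 / 3 * Rpower 2 (1 / 3 + 2) * Rpower (INR A) (- (1 / 3 + 1))) ->
  forall eps, 0 < eps -> exists C, 0 <= C /\ forall N : nat, (0 < N)%N ->
    Rabs (INR (cube_sum N) - L3 * INR N - L13 * Rpower (INR N) (1 / 3))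
      <= C * Rpower (INR N) (1 / 5 + eps).
Proof.
move=> em3 em13 eps eps0.
have [C [C0 H]] := cube_sum_asymp_dyadic L3 L13 em3 em13.
have l0 : 0 < ln 2 by rewrite -ln_1; apply: ln_increasing; lra.
have l17 : 0 <= ln 17 by apply: ln_nonneg; lra.
(* The bound for [1 + j] divided by [P = N^(eps/2)]: 2 for the rounding in [up_log], then the binary
   logarithm of 17, then that of [N], using [ln N <= (2 / eps) P]. Since [1 + j] occurs squared,
   [P^2 = N^eps] is exactly what is available. *)
pose Q := 2 + ln 17 / ln 2 + 2 / eps / ln 2.
have Q1 : 0 <= ln 17 / ln 2 by apply: Rdiv_le_0_compat.
have Q2 : 0 <= 2 / eps / ln 2.
  by apply: Rdiv_le_0_compat => //; apply: Rdiv_le_0_compat; lra.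
exists (C * 2 * Q ^ 2); split.
  by apply: Rmult_le_pos; [lra | exact: pow2_ge_0].
move=> N N0; have [Z [Z0 NZ]] := nat_fifth_root N N0.
have NR := INR_ge1 _ N0.
have /andP[j1 j2] := @up_log_bounds 2 (17 * N) isT ltac:(lia).
set j := up_log 2 (17 * N) in j1 j2.
have jpos : (0 < j)%N by rewrite /j up_log_gt0; lia.
apply: Rle_trans (H N Z j N0 Z0 NZ j2) _.
set P := Rpower (INR N) (eps / 2).
have P1 : 1 <= P.
  by rewrite -(Rpower_O (INR N)); [apply: Rle_Rpower; lra | lra].
have lnP : ln (INR N) <= 2 / eps * P.
  have e : ln P = eps / 2 * ln (INR N) by rewrite /P /Rpower ln_exp.
  have h : ln P <= P.
    have := exp_ineq1_le (ln P); rewrite exp_ln; lra.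
  have -> : ln (INR N) = 2 / eps * ln P by rewrite e; field; lra.
  by apply: Rmult_le_compat_l => //; apply: Rdiv_le_0_compat; lra.
have jb : 1 + INR j <= Q * P.
  have hj : INR j - 1 <= (ln 17 + ln (INR N)) / ln 2.
    apply/Rle_div_r => //.
    have -> : INR j - 1 = INR j.-1 by rewrite -(prednK jpos) S_INR /=; ring.
    rewrite -ln_INR_pow2 -ln_mult; [|lra..].
    apply: ln_le; first by apply: INR_gt0; rewrite expn_gt0.
    have -> : 17 * INR N = INR (17 * N) by rewrite mult_INR (INR_IZR_INZ 17).
    by apply: INR_leq; apply: ltnW.
  have -> : Q * P = 2 * P + (ln 17 / ln 2) * P + (2 / eps * P) / ln 2.
    by rewrite /Q; field; lra.
  have h1 : ln 17 / ln 2 <= ln 17 / ln 2 * P by nra.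
  have h2 : ln (INR N) / ln 2 <= 2 / eps * P / ln 2.
    by apply: Rmult_le_compat_r => //; apply/Rlt_le/Rinv_0_lt_compat.
  rewrite Rdiv_plus_distr in hj.
  lra.
have Zb : INR Z <= 2 * Rpower (INR N) (1 / 5).
  have /andP[_ /INR_leq] := NZ; rewrite INR_expn mult_INR => h.
  have i32 : INR 32 = 32 by rewrite INR_IZR_INZ.
  rewrite i32 in h.
  apply: Rnot_lt_le => lt.
  set r := Rpower (INR N) (1 / 5) in lt.
  have r0 : 0 < r by apply: Rpower_pos.
  have r5 : r ^ 5 = INR N.
    rewrite -Rpower_pow // /r Rpower_mult -[RHS]Rpower_1; last by lra.
    by congr Rpower; simpl; field.
  have : (2 * r) ^ 5 < INR Z ^ 5.
    have : 0 <= (2 * r) ^ 5 by apply: pow_le; lra.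
    rewrite -!Rpower_pow; try lra.
    move=> _; apply: Rlt_Rpower_l; simpl; lra.
  rewrite Rpow_mult_distr r5; lra.
have -> : Rpower (INR N) (1 / 5 + eps) = Rpower (INR N) (1 / 5) * (P * P).
  by rewrite /P -!Rpower_plus; congr Rpower; field.
have -> : C * 2 * Q ^ 2 * (Rpower (INR N) (1 / 5) * (P * P))
  = C * (2 * Rpower (INR N) (1 / 5)) * (Q * P) ^ 2 by ring.
have Z1 := INR_ge1 _ Z0; have j0 := pos_INR j.
apply: Rmult_le_compat.
- by apply: Rmult_le_pos; lra.
- exact: pow2_ge_0.
- by apply: Rmult_le_compat_l.
- by apply: pow_incr; lra.
Qed.

(** * Multiplicative functions and Dirichlet convolution *)

Definition mulF (F : nat -> nat -> R) (n : nat) : R :=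
  \big[Rmult/1]_(p <- primes n) F p (logn p n).

Definition dconv (u v : nat -> R) (n : nat) : R :=
  \big[Rplus/0]_(d <- divisors n) (u d * v (n %/ d)%N).

Lemma mulF1 (F : nat -> nat -> R) : mulF F 1 = 1.
Proof. by rewrite /mulF big_nil. Qed.

Lemma logn_primeM (p a m : nat) : prime p -> (0 < m)%N -> ~~ (p %| m)%N ->
  logn p (p ^ a * m) = a.
Proof.
move=> pp m0 pm; rewrite lognM ?expn_gt0 ?(prime_gt0 pp) // pfactorK //.
by rewrite lognE (negPf pm) !andbF addn0.
Qed.

Lemma logn_primeM_neq (p q a m : nat) : prime p -> (0 < m)%N -> q != p ->
  logn q (p ^ a * m) = logn q m.
Proof.
move=> pp m0 qp; rewrite lognM ?expn_gt0 ?(prime_gt0 pp) //.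
by rewrite lognX (logn_prime q pp) (negPf qp) muln0.
Qed.

Lemma primes_primeM (p a m : nat) : prime p -> (0 < a)%N -> (0 < m)%N ->
  ~~ (p %| m)%N -> perm_eq (primes (p ^ a * m)) (p :: primes m).
Proof.
move=> pp a0 m0 pm.
have pn : p \notin primes m by rewrite mem_primes (negPf pm) !andbF.
apply: uniq_perm; rewrite ?primes_uniq //= ?pn ?primes_uniq //.
move=> q; rewrite primesM ?expn_gt0 ?(prime_gt0 pp) // primesX // primes_prime //.
by rewrite !inE.
Qed.

Lemma mulF_primeM (F : nat -> nat -> R) (p a m : nat) :
  (forall q, F q 0%N = 1) -> prime p -> (0 < m)%N -> ~~ (p %| m)%N ->
  mulF F (p ^ a * m) = F p a * mulF F m.
Proof.
move=> F0 pp m0 pm; case: (posnP a) => [->|a0].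
  by rewrite expn0 mul1n F0 Rmult_1_l.
rewrite /mulF (perm_big _ (primes_primeM p a m pp a0 m0 pm)) /= big_cons.
rewrite logn_primeM //; congr Rmult.
rewrite big_seq [RHS]big_seq; apply: eq_bigr => q qm.
rewrite logn_primeM_neq //; apply: contraNneq pm => <-.
by move: qm; rewrite mem_primes => /and3P[].
Qed.

Lemma prime_power_ind (P : nat -> Prop) : P 1%N ->
  (forall p a m, prime p -> (0 < a)%N -> (0 < m)%N -> ~~ (p %| m)%N ->
     P m -> P (p ^ a * m)%N) ->
  forall n, (0 < n)%N -> P n.
Proof.
move=> P1 PS n; have [k] := ubnP n; elim: k n => // k IH n nk n0.
case: (ltngtP n 1) => [|n1|->] //; first by case: n n0 {nk}.
have pp := pdiv_prime n1; set p := pdiv n in pp.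
have [m [pm e]] := pfactor_coprime pp n0.
have a0 : (0 < logn p n)%N by rewrite logn_gt0 pi_pdiv.
have m0 : (0 < m)%N by move: n0; rewrite e muln_gt0 => /andP[].
have pm' : ~~ (p %| m)%N by rewrite -prime_coprime.
rewrite e mulnC; apply: PS => //; apply: IH => //.
have h : (m < n)%N.
  rewrite e ltn_Pmulr //; apply: leq_trans (prime_gt1 pp) _.
  by rewrite -{1}(expn1 p) leq_pexp2l // prime_gt0.
by lia.
Qed.

Lemma divisors_primeM (p a m : nat) : prime p -> (0 < m)%N -> ~~ (p %| m)%N ->
  perm_eq (divisors (p ^ a * m))
    [seq (p ^ i * d)%N | i <- index_iota 0 a.+1, d <- divisors m].
Proof.
move=> pp m0 pm.
have p0 := prime_gt0 pp.
have dm d : d \in divisors m -> (0 < d)%N /\ ~~ (p %| d)%N.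
  rewrite -dvdn_divisors // => h; split; first exact: dvdn_gt0 h.
  by apply: contraNN pm => /dvdn_trans; apply.
apply: uniq_perm; first exact: divisors_uniq.
  apply: allpairs_uniq; [exact: iota_uniq | exact: divisors_uniq|].
  move=> x y /allpairsP [[i d] [_ hd ->]] /allpairsP [[j e] [_ he ->]] /= h.
  have [d0 pd] := dm _ hd; have [e0 pe] := dm _ he.
  have ij : i = j.
    by rewrite -(logn_primeM p i d) // h logn_primeM.
  move: h; rewrite ij => /eqP; rewrite eqn_pmul2l ?expn_gt0 ?p0 //.
  by move/eqP ->.
move=> x; rewrite -dvdn_divisors ?muln_gt0 ?expn_gt0 ?p0 //.
apply/idP/allpairsP => [h | [[i d] /= [hi hd ->]]]; last first.
  apply: dvdn_mul; last by rewrite dvdn_divisors.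
  by apply: dvdn_exp2l; move: hi; rewrite mem_index_iota; lia.
have x0 : (0 < x)%N by apply: dvdn_gt0 h; rewrite muln_gt0 expn_gt0 p0.
have [d [pd e]] := pfactor_coprime pp x0.
exists (logn p x, d); split => /=; last by rewrite mulnC.
  have := dvdn_leq_log p _ h; rewrite logn_primeM // mem_index_iota.
  by rewrite muln_gt0 expn_gt0 p0 => /(_ m0); lia.
rewrite -dvdn_divisors //.
have : (d %| p ^ a * m)%N by apply: dvdn_trans h; rewrite e dvdn_mulr.
by rewrite Gauss_dvdr // coprime_sym coprimeXl.
Qed.

(** Convolution is local: at each prime the generating series in the exponent are multiplied. So
    identities between Dirichlet series reduce to power series identities such as [hh_conv] and
    [gg_conv]. *)
Lemma dconv_mulF (F G : nat -> nat -> R) :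
  (forall q, F q 0%N = 1) -> (forall q, G q 0%N = 1) -> forall n : nat, (0 < n)%N ->
  dconv (mulF F) (mulF G) n =
  mulF (fun p a => \big[Rplus/0]_(0 <= i < a.+1) (F p i * G p (a - i)%N)) n.
Proof.
move=> F0 G0; pose H p a := \big[Rplus/0]_(0 <= i < a.+1) (F p i * G p (a - i)%N).
have H0 q : H q 0%N = 1 by rewrite /H big_nat1 F0 G0; ring.
rewrite -/H; apply: prime_power_ind => [|p a m pp a0 m0 pm IH].
  by rewrite /dconv /= big_cons big_nil /= !mulF1; ring.
rewrite mulF_primeM // -IH /dconv (perm_big _ (divisors_primeM p a m pp m0 pm)).
rewrite big_allpairs_dep /= {1}/H big_distrl /=.
rewrite big_nat [RHS]big_nat; apply: eq_bigr => i /andP[_ ia].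
rewrite big_distrr /= big_seq [RHS]big_seq; apply: eq_bigr => d.
rewrite -dvdn_divisors // => dm.
have d0 : (0 < d)%N by apply: dvdn_gt0 dm.
have p0 := prime_gt0 pp.
have pd : ~~ (p %| d)%N by apply: contraNN pm => /dvdn_trans; apply.
rewrite mulF_primeM //.
have -> : ((p ^ a * m) %/ (p ^ i * d) = p ^ (a - i) * (m %/ d))%N.
  rewrite -{1}(subnKC (_ : i <= a)%N) ?expnD; last by lia.
  rewrite -mulnA divnMl ?expn_gt0 ?p0 //.
  by rewrite muln_divA.
rewrite mulF_primeM //; first by ring.
  by rewrite divn_gt0 // dvdn_leq.
by apply: contraNN pm => /dvdn_trans; apply; apply: dvdn_div.
Qed.

(** For a divisor [d] of [n], equality of the prime supports says that every exponent is positive.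
    This turns the counting condition into one that splits prime by prime, from which
    multiplicativity follows. *)
Lemma phi_e_cond (n d : nat) : (0 < n)%N -> (d %| n)%N ->
  (primes d == primes n) && all (fun p => coprime (logn p d) (logn p n)) (primes n)
  = all (fun p => (0 < logn p d)%N && coprime (logn p d) (logn p n)) (primes n).
Proof.
move=> n0 dn; rewrite all_predI; congr andb.
have d0 : (0 < d)%N by apply: dvdn_gt0 dn.
apply/eqP/allP => [<- p|h]; first by rewrite -logn_gt0.
apply: (irr_sorted_eq ltn_trans ltnn); rewrite ?sorted_primes // => p.
apply/idP/idP => [|/h]; last by rewrite -logn_gt0.
rewrite !mem_primes => /and3P[-> _ pd]; rewrite n0 /=; exact: dvdn_trans dn.
Qed.

(** Moves the range from [0 <= i < a] to [1 <= i <= a]: for [a >= 2] neither 0 nor [a] is coprime to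
    [a], and for [a = 1] the index 1 takes over from 0. *)
Lemma totient_sum_pos (a : nat) : (0 < a)%N ->
  totient a = (\sum_(0 <= i < a.+1) ((0 < i)%N && coprime i a))%N.
Proof.
case: a => // -[|a] _; first by rewrite !big_nat_recr //= big_geq.
rewrite totient_count_coprime [RHS]big_nat_recr //=.
rewrite /coprime gcdnn addn0.
apply: eq_bigr => i _; rewrite -!/(coprime _ _) coprime_sym.
by case: i => // ; rewrite /coprime gcd0n.
Qed.

(** A multiplicative function needs the value 1 at exponent 0, whereas [totient 0] is 0. *)
Definition phit (a : nat) : R := if a == 0%N then 1 else INR (totient a).

Lemma phi_e_mulF (n : nat) : (0 < n)%N ->
  INR (phi_e n) = mulF (fun _ => phit) n.
Proof.
move: n; apply: prime_power_ind => [|p a m pp a0 m0 pm IH]; first by rewrite mulF1.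
rewrite mulF_primeM // -IH {1}/phit (negPf (lt0n_neq0 a0)) -mult_INR multE; congr INR.
have p0 := prime_gt0 pp.
have n0 : (0 < p ^ a * m)%N by rewrite muln_gt0 expn_gt0 p0.
have phE k : (0 < k)%N -> phi_e k = (\sum_(d <- divisors k)
    all (fun p => (0 < logn p d)%N && coprime (logn p d) (logn p k)) (primes k))%N.
  move=> k0; rewrite /phi_e -sum1_count big_mkcond /= big_seq [RHS]big_seq.
  by apply: eq_bigr => d; rewrite -dvdn_divisors // => dk; rewrite phi_e_cond //; case: all.
rewrite !phE // (perm_big _ (divisors_primeM p a m pp m0 pm)).
rewrite big_allpairs_dep /= totient_sum_pos // big_distrl /=.
rewrite big_nat [RHS]big_nat; apply: eq_bigr => i /andP[_ ia].
rewrite big_distrr /= big_seq [RHS]big_seq; apply: eq_bigr => d.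
rewrite -dvdn_divisors // => dm.
have d0 : (0 < d)%N by apply: dvdn_gt0 dm.
have pd : ~~ (p %| d)%N by apply: contraNN pm => /dvdn_trans; apply.
rewrite (perm_all _ (primes_primeM p a m pp a0 m0 pm)) /= !logn_primeM // mulnb.
congr (nat_of_bool (_ && _)); apply: eq_in_all => q qm.
have qp : q != p.
  by apply: contraNneq pm => <-; move: qm; rewrite mem_primes => /and3P[].
by rewrite !logn_primeM_neq.
Qed.

(** The coefficients of [1 / (1 - u^3)], the local factor of [zeta(3s)]; globally they give the
    indicator of cubes. *)
Definition cub (a : nat) : R := if (3 %| a)%N then 1 else 0.
Definition is_cube (n : nat) : bool := has (fun b => n == b ^ 3)%N (iota 0 n.+1).

Lemma is_cubeP (n : nat) : reflect (exists b, n = b ^ 3)%N (is_cube n).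
Proof.
apply: (iffP hasP) => [[b _ /eqP ->]|[b ->]]; exists b => //.
rewrite mem_iota /= add0n ltnS; case: b => // b.
by rewrite -{1}[b.+1]expn1 leq_pexp2l.
Qed.

Lemma mulF_cub (n : nat) : (0 < n)%N ->
  mulF (fun _ => cub) n = if is_cube n then 1 else 0.
Proof.
move: n; apply: prime_power_ind => [|p a m pp a0 m0 pm IH]; first by rewrite mulF1.
rewrite mulF_primeM // IH {1}/cub.
have p0 := prime_gt0 pp.
have -> : is_cube (p ^ a * m) = (3 %| a)%N && is_cube m.
  apply/is_cubeP/andP => [[c e]|[/dvdnP[k ->] /is_cubeP[b ->]]]; last first.
    by exists (p ^ k * b)%N; rewrite expnMn -expnM.
  have c0 : (0 < c)%N.
    have : (0 < c ^ 3)%N by rewrite -e muln_gt0 expn_gt0 p0.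
    by rewrite expn_gt0 orbF.
  have [c' [pc ec]] := pfactor_coprime pp c0.
  set k := logn p c in ec.
  have c'0 : (0 < c')%N by move: c0; rewrite ec muln_gt0 => /andP[].
  have pc3 : ~~ (p %| c' ^ 3)%N by rewrite -prime_coprime // coprimeXr.
  have e2 : (p ^ a * m = p ^ (k * 3) * c' ^ 3)%N by rewrite e ec expnMn mulnC expnM.
  have ea : a = (k * 3)%N.
    by rewrite -(logn_primeM p a m) // e2 logn_primeM // expn_gt0 c'0.
  split; first by rewrite ea dvdn_mull.
  apply/is_cubeP; exists c'; move/eqP: e2; rewrite -ea eqn_pmul2l ?expn_gt0 ?p0 //.
  by move/eqP.
by case: (3 %| a)%N => /=; [rewrite Rmult_1_l | rewrite Rmult_0_l].
Qed.

(** Writes [n = d k] and exchanges the sums. The weight [w] allows a second application to the inner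
    coefficients in [sum_phi_e], with the integer quotients produced by the first one. *)
Lemma sum_dconv (u v w : nat -> R) (N : nat) :
  \big[Rplus/0]_(1 <= n < N.+1) (dconv u v n * w n) =
  \big[Rplus/0]_(1 <= d < N.+1)
     (u d * \big[Rplus/0]_(1 <= k < (N %/ d).+1) (v k * w (d * k)%N)).
Proof.
transitivity (\big[Rplus/0]_(1 <= n < N.+1) \big[Rplus/0]_(1 <= d < N.+1 | (d %| n)%N)
    (u d * (v (n %/ d)%N * w n))).
  rewrite big_nat [RHS]big_nat; apply: eq_bigr => n /andP[n1 nN].
  rewrite /dconv big_distrl /= -[RHS]big_filter.
  rewrite (perm_big [seq d <- index_iota 1 N.+1 | (d %| n)%N]) /=.
    by apply: eq_bigr => d _; ring.
  apply: uniq_perm; rewrite ?divisors_uniq ?filter_uniq ?iota_uniq // => d.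
  rewrite mem_filter -dvdn_divisors // mem_index_iota.
  case dn: (d %| n)%N => //=; apply/esym/andP; split; first exact: dvdn_gt0 dn.
  by apply: leq_ltn_trans nN; apply: dvdn_leq.
rewrite (exchange_big_dep xpredT) //= big_nat [RHS]big_nat.
apply: eq_bigr => d /andP[d0 dN]; rewrite -big_distrr /=; congr Rmult.
rewrite -[LHS]big_filter.
rewrite (perm_big [seq (d * k)%N | k <- index_iota 1 (N %/ d).+1]) /=.
  by rewrite big_map; apply: eq_bigr => k _; rewrite mulKn.
apply: uniq_perm.
- by rewrite filter_uniq // iota_uniq.
- rewrite map_inj_uniq ?iota_uniq // => i j /eqP.
  by rewrite eqn_pmul2l // => /eqP.
move=> x; rewrite mem_filter mem_index_iota; apply/andP/mapP.
  move=> [/dvdnP[k ->] /andP[x1 xN]]; exists k; last by rewrite mulnC.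
  rewrite mem_index_iota ltnS leq_divRL //.
  by move: x1 xN; rewrite muln_gt0 ltnS => /andP[-> _] ->.
move=> [k]; rewrite mem_index_iota ltnS leq_divRL // => /andP[k0 kN] ->.
by rewrite dvdn_mulr // muln_gt0 d0 k0 ltnS mulnC.
Qed.

Lemma sum_cub (y : nat) :
  \big[Rplus/0]_(1 <= k < y.+1) (mulF (fun _ => cub) k * INR (y %/ k)) = INR (cube_sum y).
Proof.
transitivity (\big[Rplus/0]_(1 <= k < y.+1) \big[Rplus/0]_(1 <= b < y.+1)
   (if (k == b ^ 3)%N then INR (y %/ k) else 0)).
  rewrite big_nat [RHS]big_nat; apply: eq_bigr => k /andP[k0 ky].
  rewrite mulF_cub //; case: is_cubeP => [[b e]|nc].
    have b0 : (0 < b)%N by move: k0; rewrite e expn_gt0 orbF.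
    rewrite Rmult_1_l (bigD1_seq b) ?iota_uniq //=; last first.
      rewrite mem_index_iota b0 /=; apply: leq_ltn_trans ky; rewrite e.
      by rewrite -{1}[b]expn1 leq_pexp2l.
    rewrite e eqxx big1 ?Rplus_0_r // => c cb.
    by rewrite eqn_exp2r // eq_sym (negPf cb).
  rewrite Rmult_0_l big1 // => b _; case: eqP => // e.
  by case: nc; exists b.
rewrite exchange_big /= /cube_sum INR_sum big_nat [RHS]big_nat.
apply: eq_bigr => b /andP[b0 _].
have [le|gt] := leqP (b ^ 3) y.
  rewrite (bigD1_seq (b ^ 3)%N) ?iota_uniq //=; last first.
    by rewrite mem_index_iota expn_gt0 b0 ltnS.
  by rewrite eqxx big1 ?Rplus_0_r // => k /negPf ->.
rewrite divn_small // big_nat big1 // => k /andP[_ ky].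
by case: eqP => // e; move: gt; rewrite -e ltnNge -ltnS ky.
Qed.

(* As power series in [u], [hh] is [(1 - u)] times [phit] and [gg] is
   [(1 - u^3)] times [hh]: the local factors of [phi_e], of its quotient by
   [zeta(s)] and of its quotient by [zeta(s) zeta(3s)]. *)
Definition hh (a : nat) : R := phit a - (if a is a'.+1 then phit a' else 0).
Definition gg (a : nat) : R := hh a - (if a is a'.+3 then hh a' else 0).

Lemma hh_conv (a : nat) :
  \big[Rplus/0]_(0 <= i < a.+1) (hh i * 1) = phit a.
Proof.
elim: a => [|a IH]; first by rewrite big_nat1 /hh; ring.
by rewrite big_nat_recr //= IH /hh; ring.
Qed.

Lemma gg_conv (a : nat) :
  \big[Rplus/0]_(0 <= i < a.+1) (gg i * cub (a - i)) = hh a.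
Proof.
have [k] := ubnP a; elim: k a => // k IH [|[|[|a]]] ak.
- by rewrite big_nat1 /gg /cub /=; ring.
- by rewrite !big_nat_recr //= big_geq // /gg /cub /=; ring.
- by rewrite !big_nat_recr //= big_geq // /gg /cub /=; ring.
have s1 : (a.+3 - a.+2 = 1)%N by lia.
have s2 : (a.+3 - a.+1 = 2)%N by lia.
(* Of the last three indices only [a + 3] survives, since [cub 1] and [cub 2] vanish; as [cub] has
   period 3, the rest is the sum for [a], equal to [hh a] by induction. *)
rewrite (big_nat_recr a.+3) // (big_nat_recr a.+2) // (big_nat_recr a.+1) //.
rewrite subnn s1 s2.
rewrite big_nat (eq_bigr (fun i => gg i * cub (a - i))); last first.
  move=> i /andP[_ ia]; congr Rmult; rewrite /cub.
  have -> : (a.+3 - i = a - i + 3)%N by lia.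
  by rewrite dvdn_addl.
rewrite -big_nat IH; last by lia.
have -> : gg a.+3 = hh a.+3 - hh a by [].
have -> : cub 0 = 1 by [].
have -> : cub 1 = 0 by [].
have -> : cub 2 = 0 by [].
by move: (hh a) (hh a.+3) (gg a.+1) (gg a.+2) => * /=; ring.
Qed.

Lemma phit0 : phit 0 = 1. Proof. by []. Qed.
Lemma hh0 : hh 0 = 1. Proof. by rewrite /hh phit0; ring. Qed.
Lemma gg0 : gg 0 = 1. Proof. by rewrite /gg hh0; ring. Qed.

Lemma eq_mulF (F G : nat -> nat -> R) (n : nat) :
  (forall p a, F p a = G p a) -> mulF F n = mulF G n.
Proof. by move=> e; apply: eq_bigr => p _. Qed.

(** First [phi_e] is [hh] convolved with 1, so summation produces [N %/ d]; then [hh] is [gg]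
    convolved with the indicator of cubes, and the cubes gather these quotients into [cube_sum]. *)
Lemma sum_phi_e (N : nat) :
  INR (\sum_(1 <= n < N.+1) phi_e n)
   = \big[Rplus/0]_(1 <= m < N.+1) (mulF (fun _ => gg) m * INR (cube_sum (N %/ m))).
Proof.
have cub0 : cub 0 = 1 by [].
have one n : mulF (fun _ _ => 1) n = 1 by rewrite /mulF big1.
transitivity (\big[Rplus/0]_(1 <= n < N.+1)
    (dconv (mulF (fun _ => hh)) (mulF (fun _ _ => 1)) n * 1)).
  rewrite INR_sum big_nat [RHS]big_nat; apply: eq_bigr => n /andP[n0 _].
  rewrite dconv_mulF // => [|q]; last exact: hh0.
  rewrite phi_e_mulF // Rmult_1_r; apply: eq_mulF => p a.
  by rewrite hh_conv.
rewrite sum_dconv.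
transitivity (\big[Rplus/0]_(1 <= d < N.+1)
    (dconv (mulF (fun _ => gg)) (mulF (fun _ => cub)) d * INR (N %/ d))).
  rewrite big_nat [RHS]big_nat; apply: eq_bigr => d /andP[d0 _].
  rewrite dconv_mulF // => [|q]; last exact: gg0.
  congr Rmult; first by apply: eq_mulF => p a; rewrite gg_conv.
  rewrite (eq_bigr (fun=> 1)) ?rsum_const ?size_iota ?subn1 //=; first by ring.
  by move=> k _; rewrite one; ring.
rewrite sum_dconv; apply: eq_bigr => m _; congr Rmult.
by rewrite -sum_cub; apply: eq_bigr => k _; rewrite divnMA.
Qed.

(** * Euler products *)

(** The integers with all prime factors below [N] and all exponents below [A], enumerated as they
    appear when the truncated Euler product is expanded. *)
Fixpoint smooth (A N : nat) : seq nat :=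
  if N is n.+1 then
    if prime n then [seq (n ^ a * m)%N | a <- index_iota 0 A, m <- smooth A n]
    else smooth A n
  else [:: 1%N].

Lemma smooth_primes (A N m : nat) : m \in smooth A N ->
  (0 < m)%N /\ forall q, prime q -> (q %| m)%N -> (q < N)%N.
Proof.
elim: N m => [|N IH] m /=.
  rewrite inE => /eqP ->; split=> // q pq; rewrite dvdn1 => /eqP q1.
  by move: pq; rewrite q1.
case: ifP => pN; last by move=> /IH [m0 h]; split=> // q pq /(h q pq); lia.
case/allpairsP=> [[a d] /= [_ /IH [d0 h] ->]]; split.
  by rewrite muln_gt0 d0 expn_gt0 prime_gt0.
move=> q pq; rewrite Euclid_dvdM // => /orP[|/(h q pq)]; last by lia.
by rewrite Euclid_dvdX // => /andP[/dvdn_leq h2 _]; rewrite ltnS h2 // prime_gt0.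
Qed.

Lemma smooth_ndvd (A N m : nat) : prime N -> m \in smooth A N -> ~~ (N %| m)%N.
Proof.
move=> pN /smooth_primes [m0 h]; apply/negP => /(h N pN); by rewrite ltnn.
Qed.

Lemma smooth_uniq (A N : nat) : uniq (smooth A N).
Proof.
elim: N => [|N IH] //=; case: ifP => // pN.
apply: allpairs_uniq => //; first exact: iota_uniq.
move=> x y /allpairsP [[i d] [_ hd ->]] /allpairsP [[j e] [_ he ->]] /= h.
have [d0 _] := smooth_primes _ _ _ hd; have [e0 _] := smooth_primes _ _ _ he.
have nd := smooth_ndvd _ _ _ pN hd; have ne := smooth_ndvd _ _ _ pN he.
have ij : i = j by rewrite -(logn_primeM N i d) // h logn_primeM.
move: h; rewrite ij => /eqP; rewrite eqn_pmul2l ?expn_gt0 ?(prime_gt0 pN) //.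
by move/eqP ->.
Qed.

Lemma smooth_complete (A N m : nat) : (0 < m)%N ->
  (forall q, prime q -> (q %| m)%N -> (q < N)%N) ->
  (forall q, logn q m < A)%N -> m \in smooth A N.
Proof.
elim: N m => [|N IH] m m0 hq hA /=.
  rewrite inE; apply: contraT => m1.
  have h : (1 < m)%N by lia.
  by have := hq _ (pdiv_prime h) (pdiv_dvd m).
case: ifP => pN; last first.
  apply: IH => // q pq qm; have := hq q pq qm; rewrite ltnS leq_eqVlt.
  by case/orP => // /eqP e; move: pq; rewrite e pN.
have [d [pd e]] := pfactor_coprime pN m0.
have d0 : (0 < d)%N by move: m0; rewrite e muln_gt0 => /andP[].
apply/allpairsP; exists (logn N m, d); split => /=; last by rewrite mulnC.
  by rewrite mem_index_iota hA.
apply: IH => // q => [pq qd|].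
  have := hq q pq; rewrite e dvdn_mulr // => /(_ isT); rewrite ltnS leq_eqVlt.
  by case/orP => // /eqP eq; move: pd; rewrite prime_coprime // -eq qd.
apply: leq_ltn_trans (hA q); apply: dvdn_leq_log => //.
by rewrite e dvdn_mulr.
Qed.

Lemma smooth_sum (F : nat -> nat -> R) (A N : nat) : (forall q, F q 0%N = 1) ->
  \big[Rmult/1]_(0 <= p < N | prime p) \big[Rplus/0]_(0 <= a < A) F p a
   = \big[Rplus/0]_(m <- smooth A N) mulF F m.
Proof.
move=> F0; elim: N => [|N IH]; first by rewrite big_geq //= big_seq1 mulF1.
rewrite big_mkcond big_nat_recr //= -big_mkcond IH /=.
case: ifP => pN; last by rewrite Rmult_1_r.
rewrite big_allpairs_dep /= Rmult_comm big_distrl /=; apply: eq_bigr => a _.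
rewrite big_distrr /= big_seq [RHS]big_seq; apply: eq_bigr => m hm.
have [m0 _] := smooth_primes _ _ _ hm.
by rewrite mulF_primeM // (smooth_ndvd _ _ _ pN hm).
Qed.

Lemma logn_le (q m : nat) : (0 < m)%N -> (logn q m <= m)%N.
Proof.
move=> m0; case: (boolP (prime q)) => pq; last by rewrite lognE (negPf pq).
apply: (@leq_trans (q ^ logn q m)); last by rewrite dvdn_leq // pfactor_dvdnn.
by apply: ltnW; apply: ltn_expl; apply: prime_gt1.
Qed.

Lemma smooth_all (M m : nat) : (0 < m <= M)%N -> m \in smooth M.+1 M.+1.
Proof.
move=> /andP[m0 mM]; apply: smooth_complete => //.
  by move=> q pq /dvdn_leq h; rewrite ltnS; apply: leq_trans mM; apply: h.
by move=> q; rewrite ltnS; apply: leq_trans mM; apply: logn_le.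
Qed.

Lemma rsum_subset (s t : seq nat) (f : nat -> R) : uniq s -> uniq t ->
  {subset s <= t} -> (forall n, 0 <= f n) ->
  \big[Rplus/0]_(i <- s) f i <= \big[Rplus/0]_(i <- t) f i.
Proof.
move=> us ut st f0.
rewrite [X in _ <= X](bigID (mem s)) /= -[X in _ <= X + _]big_filter.
have ps : perm_eq [seq i <- t | i \in s] s.
  apply: uniq_perm => [||x] //; first exact: filter_uniq.
  by rewrite mem_filter; case xs: (x \in s) => //=; rewrite (st x xs).
rewrite (perm_big _ ps) /=.
rewrite -[X in X <= _]Rplus_0_r; apply: Rplus_le_compat_l.
by apply: rsum_ge0.
Qed.

Lemma series_nonneg_bounded (f : nat -> R) (B : R) : (forall n, 0 <= f n) ->
  (forall N, \big[Rplus/0]_(0 <= n < N) f n <= B) -> ex_series f.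
Proof.
move=> f0 hB.
have [l hl] : ex_finite_lim_seq (sum_n f).
  apply: (ex_finite_lim_seq_incr _ B) => n.
    by rewrite sum_Sn; have := f0 n.+1; rewrite /plus /=; lra.
  by rewrite -rsum_sum_n; apply: hB.
by exists l.
Qed.

Lemma rsum_le_series (f : nat -> R) (N : nat) : (forall n, 0 <= f n) ->
  ex_series f -> \big[Rplus/0]_(0 <= n < N) f n <= Series f.
Proof.
move=> f0 [l hl]; rewrite (is_series_unique _ _ hl).
apply: (Rle_trans _ (\big[Rplus/0]_(0 <= n < N.+1) f n)).
  by rewrite big_nat_recr //=; have := f0 N; lra.
rewrite rsum_sum_n.
have := is_lim_seq_incr_compare (sum_n f) l hl; apply => n.
by rewrite sum_Sn; have := f0 n.+1; rewrite /plus /=; lra.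
Qed.

Lemma rsum_shift1 (f : nat -> R) (M : nat) :
  \big[Rplus/0]_(1 <= n < M.+1) f n = \big[Rplus/0]_(0 <= n < M) f n.+1.
Proof. by rewrite big_add1. Qed.

Lemma rsum_list_le_series (f : nat -> R) (s : seq nat) : (forall n, 0 <= f n) ->
  ex_series (fun n => f n.+1) -> uniq s -> all (fun n => 0 < n)%N s ->
  \big[Rplus/0]_(n <- s) f n <= Series (fun n => f n.+1).
Proof.
move=> f0 ex us pos.
apply: Rle_trans (rsum_le_series (fun n => f n.+1) (\max_(n <- s) n) _ ex) => //.
rewrite -rsum_shift1; apply: rsum_subset => //; first exact: iota_uniq.
move=> n ns; rewrite mem_index_iota (allP pos n ns) /= ltnS.
by apply: (@leq_bigmax_seq _ s xpredT id).
Qed.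

Lemma rsum_list_approx (f : nat -> R) (s : seq nat) (M : nat) :
  ex_series (fun n => Rabs (f n.+1)) -> uniq s -> all (fun n => 0 < n)%N s ->
  (forall n, (0 < n <= M)%N -> n \in s) ->
  Rabs (\big[Rplus/0]_(n <- s) f n - \big[Rplus/0]_(0 <= n < M) f n.+1)
   <= Series (fun n => Rabs (f n.+1)) - \big[Rplus/0]_(0 <= n < M) Rabs (f n.+1).
Proof.
move=> ex us pos hs; rewrite -!rsum_shift1 -(rsum_shift1 (fun n => Rabs (f n))).
have E (g : nat -> R) : \big[Rplus/0]_(n <- s) g n =
   \big[Rplus/0]_(1 <= n < M.+1) g n + \big[Rplus/0]_(n <- s | (M < n)%N) g n.
  rewrite (bigID (fun n => n <= M)%N) /=; congr Rplus.
    rewrite -big_filter; apply: perm_big; apply: uniq_perm.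
    - by rewrite filter_uniq.
    - exact: iota_uniq.
    move=> n; rewrite mem_filter mem_index_iota ltnS; apply/andP/andP.
      by move=> [-> /(allP pos)].
    by move=> [n0 nM]; rewrite nM; split => //; apply: hs; rewrite n0.
  by apply: eq_bigl => n; rewrite ltnNge.
have h := rsum_list_le_series (fun n => Rabs (f n)) s (fun n => Rabs_pos _) ex us pos.
rewrite (E f); rewrite (E (fun n => Rabs (f n))) in h.
have -> : forall u v : R, u + v - u = v by move=> *; ring.
apply: Rle_trans (rsum_abs _ _ _ _) _; lra.
Qed.

Lemma rprod_lim (I : Type) (r : seq I) (P : pred I) (f : I -> nat -> R) (l : I -> R) :
  (forall i, P i -> is_lim_seq (f i) (l i)) ->
  is_lim_seq (fun n => \big[Rmult/1]_(i <- r | P i) f i n)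
    (\big[Rmult/1]_(i <- r | P i) l i).
Proof.
move=> h; elim: r => [|i r IH].
  apply: (is_lim_seq_ext (fun=> 1)); first by move=> n; rewrite big_nil.
  by rewrite big_nil; apply: is_lim_seq_const.
rewrite big_cons; case: ifP => Pi; last first.
  by apply: (is_lim_seq_ext _ _ _ _ IH) => n; rewrite big_cons Pi.
apply: (is_lim_seq_ext (fun n => f i n * \big[Rmult/1]_(i <- r | P i) f i n)).
  by move=> n; rewrite big_cons Pi.
by apply: is_lim_seq_mult' => //; apply: h.
Qed.

Lemma is_series_rsum (f : nat -> R) (l : R) : is_series f l ->
  is_lim_seq (fun N => \big[Rplus/0]_(0 <= n < N) f n) l.
Proof.
move=> h0; have h : is_lim_seq (sum_n f) l by [].
apply/is_lim_seq_incr_1.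
by apply: (is_lim_seq_ext _ _ _ _ h) => n; rewrite rsum_sum_n.
Qed.

(** For fixed [M], the product over primes up to [M] with exponents below [A] expands into a sum
    that contains all [n <= M]. It differs from the [M]-th partial sum by at most the tail of the
    absolute series, uniformly in [A > M]. Then [A] and afterwards [M] tend to infinity. *)
Lemma euler_product_limit (F : nat -> nat -> R) : (forall q, F q 0%N = 1) ->
  (forall p, prime p -> ex_series (F p)) ->
  ex_series (fun n => Rabs (mulF F n.+1)) ->
  is_lim_seq (fun N => \big[Rmult/1]_(0 <= p < N | prime p) Series (F p))
    (Series (fun n => mulF F n.+1)).
Proof.
move=> F0 loc ex.
have exf := ex_series_Rabs _ ex.
set f := mulF F in ex exf *.
pose tail M := Series (fun n => Rabs (f n.+1)) - \big[Rplus/0]_(0 <= n < M) Rabs (f n.+1).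
have tl : is_lim_seq tail 0.
  have -> : 0 = Series (fun n => Rabs (f n.+1)) - Series (fun n => Rabs (f n.+1)) by ring.
  apply: is_lim_seq_minus'; first exact: is_lim_seq_const.
  exact: is_series_rsum (Series_correct _ ex).
have key M : Rabs (\big[Rmult/1]_(0 <= p < M.+1 | prime p) Series (F p)
    - \big[Rplus/0]_(0 <= n < M) f n.+1) <= tail M.
  have h1 : is_lim_seq (fun A => Rabs (\big[Rmult/1]_(0 <= p < M.+1 | prime p)
         \big[Rplus/0]_(0 <= a < A) F p a - \big[Rplus/0]_(0 <= n < M) f n.+1))
     (Rabs (\big[Rmult/1]_(0 <= p < M.+1 | prime p) Series (F p)
      - \big[Rplus/0]_(0 <= n < M) f n.+1)).
    apply: (is_lim_seq_abs _ (\big[Rmult/1]_(0 <= p < M.+1 | prime p) Series (F p)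
      - \big[Rplus/0]_(0 <= n < M) f n.+1)).
    apply: is_lim_seq_minus'; last exact: is_lim_seq_const.
    apply: rprod_lim => p pp; apply: is_series_rsum; apply: Series_correct.
    exact: loc.
  apply: (is_lim_seq_le_loc _ _ _ _ _ h1 (is_lim_seq_const _)).
  exists M.+1 => A /leP MA.
  rewrite smooth_sum //; apply: rsum_list_approx => //; first exact: smooth_uniq.
    by apply/allP => m /smooth_primes [].
  move=> n /andP[n0 nM]; apply: smooth_complete => // [q pq /dvdn_leq qn|q].
    by rewrite ltnS; apply: leq_trans nM; apply: qn.
  by apply: leq_trans MA; rewrite ltnS; apply: leq_trans nM; apply: logn_le.
apply/is_lim_seq_incr_1.
have S0 := is_series_rsum _ _ (Series_correct _ exf).
apply: (is_lim_seq_ext (fun M => \big[Rplus/0]_(0 <= n < M) f n.+1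
   + (\big[Rmult/1]_(0 <= p < M.+1 | prime p) Series (F p)
    - \big[Rplus/0]_(0 <= n < M) f n.+1))); first by move=> n; ring.
rewrite -[Series _]Rplus_0_r; apply: is_lim_seq_plus' => //.
apply/is_lim_seq_abs_0.
apply: (is_lim_seq_le_le (fun=> 0) _ tail) => //; last exact: is_lim_seq_const.
by move=> n; split; [exact: Rabs_pos | exact: key].
Qed.

Lemma mulF_abs (F : nat -> nat -> R) (n : nat) :
  Rabs (mulF F n) = mulF (fun p a => Rabs (F p a)) n.
Proof.
rewrite /mulF; elim/big_rec2: _ => [|p x y _ <-]; first by rewrite Rabs_R1.
by rewrite Rabs_mult.
Qed.

Lemma exp_le_prod (b : nat -> R) (N : nat) : (forall p, 0 <= b p) ->
  \big[Rmult/1]_(0 <= p < N | prime p) (1 + b p)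
    <= exp (\big[Rplus/0]_(0 <= p < N) b p).
Proof.
move=> b0; elim: N => [|N IH]; first by rewrite !big_geq // exp_0; lra.
rewrite big_mkcond !big_nat_recr //= -big_mkcond exp_plus.
apply: Rmult_le_compat => //.
- elim/big_ind: _ => [|x y hx hy|p _]; [lra | exact: Rmult_le_pos | have := b0 p; lra].
- by case: ifP => _; have := b0 N; lra.
- have := exp_ineq1_le (b N); have := b0 N; case: ifP => _; lra.
Qed.

(** Any partial sum is part of an expanded finite Euler product, which is at most the product of the
    [1 + b p], hence at most [exp B]. *)
Lemma mulF_abs_summable (F : nat -> nat -> R) (b : nat -> R) (B : R) :
  (forall q, F q 0%N = 1) -> (forall p, 0 <= b p) ->
  (forall p A, prime p -> \big[Rplus/0]_(0 <= a < A) Rabs (F p a) <= 1 + b p) ->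
  (forall N, \big[Rplus/0]_(0 <= p < N) b p <= B) ->
  ex_series (fun n => Rabs (mulF F n.+1)).
Proof.
move=> F0 b0 hb hB.
apply: (series_nonneg_bounded _ (exp B)) => [n|M]; first exact: Rabs_pos.
rewrite -(rsum_shift1 (fun n => Rabs (mulF F n))).
apply: (Rle_trans _ (\big[Rplus/0]_(m <- smooth M.+1 M.+1) Rabs (mulF F m))).
  apply: rsum_subset => [|||n]; [exact: iota_uniq | exact: smooth_uniq | | exact: Rabs_pos].
  by move=> m; rewrite mem_index_iota ltnS => /smooth_all.
rewrite (eq_bigr (mulF (fun p a => Rabs (F p a)))); last first.
  by move=> m _; rewrite mulF_abs.
rewrite -smooth_sum; last by move=> q; rewrite F0 Rabs_R1.
apply: (Rle_trans _ (\big[Rmult/1]_(0 <= p < M.+1 | prime p) (1 + b p))).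
  have h : 0 <= \big[Rmult/1]_(0 <= p < M.+1 | prime p)
      \big[Rplus/0]_(0 <= a < M.+1) Rabs (F p a)
    <= \big[Rmult/1]_(0 <= p < M.+1 | prime p) (1 + b p); last by case: h.
  elim/big_rec2: _ => [|p x y pp [h1 h2]]; first by lra.
  have h3 : 0 <= \big[Rplus/0]_(0 <= a < M.+1) Rabs (F p a).
    by apply: rsum_ge0 => a _; apply: Rabs_pos.
  have h4 := hb p M.+1 pp; split; first exact: Rmult_le_pos.
  by apply: Rmult_le_compat.
apply: Rle_trans (exp_le_prod b M.+1 b0) _.
exact: exp_le.
Qed.

Lemma mulF_weight (c : nat -> R) (s : R) : c 0%N = 1 -> forall n, (0 < n)%N ->
  mulF (fun p a => c a * Rpower (INR p) (- (INR a * s))) n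
   = mulF (fun _ => c) n * Rpower (INR n) (- s).
Proof.
move=> c0.
have F0 q : c 0%N * Rpower (INR q) (- (INR 0 * s)) = 1.
  by rewrite c0 Rmult_0_l Ropp_0 /Rpower Rmult_0_l exp_0; ring.
apply: prime_power_ind => [|p a m pp a0 m0 pm IH].
  by rewrite !mulF1 /Rpower ln_1 Rmult_0_r exp_0; ring.
rewrite !mulF_primeM // IH mult_INR.
have pR := INR_gt0 _ (prime_gt0 pp).
rewrite -Rpower_mult_distr; first last.
- exact: INR_gt0.
- by apply: INR_gt0; rewrite expn_gt0 prime_gt0.
rewrite INR_expn -Rpower_pow // Rpower_mult.
by rewrite -Ropp_mult_distr_r; ring.
Qed.

(** * Size and summability of the coefficients of [G] *)

Lemma totient_leq (a : nat) : (totient a <= a)%N.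
Proof.
rewrite totient_count_coprime.
apply: (@leq_trans (\sum_(0 <= i < a) 1)).
  by apply: leq_sum => i _; case: coprime.
by rewrite sum_nat_const_nat subn0 muln1.
Qed.

Lemma phit_bound (a : nat) : 0 <= phit a <= INR a + 1.
Proof.
rewrite /phit; case: eqP => [->|_]; first by rewrite /=; lra.
have := INR_leq _ _ (totient_leq a); have := pos_INR (totient a); lra.
Qed.

Lemma hh_bound (a : nat) : Rabs (hh a) <= INR a + 1.
Proof.
case: a => [|a]; first by rewrite hh0 Rabs_R1 /=; lra.
have := phit_bound a; have := phit_bound a.+1; rewrite /hh S_INR.
by move=> [? ?] [? ?]; apply: Rabs_le; lra.
Qed.

Lemma gg_bound (a : nat) : Rabs (gg a) <= 2 * (INR a + 1).
Proof.
have h := hh_bound a; have a0 := pos_INR a.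
case: a h a0 => [|[|[|a]]] h a0; rewrite /gg ?Rminus_0_r; try lra.
have h2 := hh_bound a; have := Rabs_triang (hh a.+3) (- hh a).
rewrite Rabs_Ropp -/(Rminus _ _).
by have : INR a <= INR a.+3 by [apply: INR_leq; lia]; lra.
Qed.

(** The origin of the abscissa 1/5. The series [1 + u + u^2 + 2 u^3 + 2 u^4 + 4 u^5 + ...] becomes
    [1 + u^3 + 2 u^5 + ...] after multiplication by [1 - u], and [1 + 2 u^5 + ...] after
    multiplication by [1 - u^3]. *)
Lemma gg_small (a : nat) : (0 < a < 5)%N -> gg a = 0.
Proof.
have t3 : totient 3 = 2%N by [].
have t4 : totient 4 = 2%N by [].
case: a => [|[|[|[|[|a]]]]] //= _; rewrite /gg /hh /phit /= ?t3 ?t4 /=; ring.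
Qed.

Lemma geo_sum (w : R) (A : nat) : 0 <= w < 1 ->
  \big[Rplus/0]_(0 <= a < A) w ^ a <= / (1 - w).
Proof.
move=> [w0 w1].
have e : (1 - w) * \big[Rplus/0]_(0 <= a < A) w ^ a = 1 - w ^ A.
  elim: A => [|A IH]; first by rewrite big_geq //=; ring.
  by rewrite big_nat_recr //= Rmult_plus_distr_l IH; ring.
apply: (Rmult_le_reg_l (1 - w)); first by lra.
by rewrite e Rinv_r; [have := pow_le w A w0; lra | lra].
Qed.

Lemma lin_geo (w : R) (a : nat) : 0 <= w < 1 ->
  (INR a + 1) * w ^ a <= / (1 - w).
Proof.
move=> w01; have := geo_sum w a.+1 w01; apply: Rle_trans.
have -> : (INR a + 1) * w ^ a = \big[Rplus/0]_(0 <= i < a.+1) w ^ a.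
  by rewrite rsum_const size_iota subn0 S_INR.
rewrite !big_nat; apply: rsum_le => i /andP[_ ia].
have [k ->] : exists k, a = (i + k)%N by exists (a - i)%N; lia.
rewrite pow_add.
have h1 : w ^ k <= 1 by rewrite -(pow1 k); apply: pow_incr; lra.
have h2 := pow_le w i (proj1 w01); nra.
Qed.

(** Half of the geometric decay absorbs the linear growth of the coefficients; the other half
    remains summable. *)
Lemma lin_geo_sqrt (u : R) (a : nat) : 0 <= u < 1 ->
  (INR a + 1) * u ^ a <= / (1 - sqrt u) * sqrt u ^ a.
Proof.
move=> [u0 u1].
have s0 := sqrt_pos u.
have s1 : sqrt u < 1 by rewrite -sqrt_1; apply: sqrt_lt_1; lra.
rewrite -{1}(sqrt_sqrt u u0) Rpow_mult_distr -Rmult_assoc.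
apply: Rmult_le_compat_r; first exact: pow_le.
by apply: lin_geo.
Qed.

Lemma local_series (c : nat -> R) (u : R) : 0 <= u < 1 ->
  (forall a, Rabs (c a) <= 2 * (INR a + 1)) -> ex_series (fun a => c a * u ^ a).
Proof.
move=> u01 hc; have s0 := sqrt_pos u.
have s1 : sqrt u < 1 by rewrite -sqrt_1; apply: sqrt_lt_1; lra.
apply: (ex_series_le _ (fun a => 2 * / (1 - sqrt u) * sqrt u ^ a)).
  move=> a; rewrite /norm /= /abs /= Rabs_mult [Rabs (u ^ a)]Rabs_pos_eq; last first.
    by apply: pow_le; lra.
  have := lin_geo_sqrt u a u01; have := hc a; have := pow_le u a (proj1 u01).
  by move=> h1 h2 h3; nra.
apply: ex_series_scal; apply: ex_series_geom.
by rewrite Rabs_pos_eq.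
Qed.

(** Integral comparison, carried out by telescoping: the mean value theorem bounds each term by a
    difference of [n^(1-s) / (s - 1)]. *)
Lemma zeta_partial_bound (s : R) (N : nat) : 1 < s ->
  \big[Rplus/0]_(1 <= n < N.+1) Rpower (INR n) (- s) <= 1 + / (s - 1).
Proof.
move=> s1.
have is0 : 0 < / (s - 1) by apply: Rinv_0_lt_compat; lra.
have key : \big[Rplus/0]_(1 <= n < N.+2) Rpower (INR n) (- s)
   <= 1 + / (s - 1) * (1 - Rpower (INR N.+1) (- (s - 1))).
  elim: N => [|N IH].
    by rewrite big_nat1 /Rpower ln_1 !Rmult_0_r exp_0; lra.
  rewrite big_nat_recr //=; have NR := INR_ge1 N.+1 isT.
  rewrite -/(INR N.+2) (S_INR N.+1).
  have [c [[c1 c2] e]] := Rpower_mvt (- (s - 1)) (INR N.+1) (INR N.+1 + 1) ltac:(lra) ltac:(lra).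
  have h := Rpower_anti c (INR N.+1 + 1) s ltac:(lra) ltac:(lra).
  have e2 : Rpower (INR N.+1 + 1) (- (s - 1))
    = Rpower (INR N.+1) (- (s - 1)) - (s - 1) * Rpower c (- s).
    have -> : - s = - (s - 1) - 1 by ring.
    lra.
  rewrite e2.
  have -> : 1 + / (s - 1) * (1 - (Rpower (INR N.+1) (- (s - 1)) - (s - 1) * Rpower c (- s)))
   = 1 + / (s - 1) * (1 - Rpower (INR N.+1) (- (s - 1))) + Rpower c (- s) by field; lra.
  lra.
apply: (Rle_trans _ (\big[Rplus/0]_(1 <= n < N.+2) Rpower (INR n) (- s))).
  rewrite [X in _ <= X]big_nat_recr //= -/(INR N.+1).
  by have := Rpower_pos (INR N.+1) (- s); lra.
apply: Rle_trans key _; have := Rpower_pos (INR N.+1) (- (s - 1)); nra.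
Qed.

Lemma ex_series_Rpower (s : R) : 1 < s ->
  ex_series (fun n => Rpower (INR n.+1) (- s)).
Proof.
move=> s1; apply: (series_nonneg_bounded _ (1 + / (s - 1))).
  by move=> n; apply/Rlt_le/Rpower_pos.
by move=> N; rewrite -(rsum_shift1 (fun n => Rpower (INR n) (- s))); apply: zeta_partial_bound.
Qed.

Lemma Rpower_prime (p : nat) (s : R) : prime p -> 0 < s ->
  0 <= Rpower (INR p) (- s) <= Rpower 2 (- s) /\ Rpower 2 (- s) < 1.
Proof.
move=> pp s0; split.
  split; first exact/Rlt_le/Rpower_pos.
  apply: Rpower_anti; first by lra.
  by split; [lra | apply: (INR_leq 2); apply: prime_gt1].
have h : Rpower 2 (- s) < Rpower 2 0 by apply: Rpower_lt; lra.
by rewrite Rpower_O in h; lra.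
Qed.

Lemma Rpower_nat_exp (x s : R) (a : nat) :
  Rpower x (- (INR a * s)) = Rpower x (- s) ^ a.
Proof.
rewrite -Rpower_pow ?Rpower_mult; last exact: Rpower_pos.
by congr Rpower; ring.
Qed.

Definition gweight (s : R) (p a : nat) : R := gg a * Rpower (INR p) (- (INR a * s)).

Lemma gweight0 (s : R) (q : nat) : gweight s q 0 = 1.
Proof.
by rewrite /gweight gg0 Rmult_0_l Ropp_0 /Rpower Rmult_0_l exp_0; ring.
Qed.

Lemma gweight_series (s : R) (p : nat) : prime p -> 0 < s ->
  ex_series (gweight s p).
Proof.
move=> pp s0; have [[h1 h2] h3] := Rpower_prime p s pp s0.
apply: (ex_series_ext (fun a => gg a * Rpower (INR p) (- s) ^ a)).
  by move=> a; rewrite /gweight Rpower_nat_exp.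
by apply: local_series => [|a]; [lra | exact: gg_bound].
Qed.

Lemma gweight_summable (s : R) : 1 / 5 < s ->
  ex_series (fun n => Rabs (mulF (gweight s) n.+1)).
Proof.
move=> s5; set w := sqrt (Rpower 2 (- s)).
have [_ q2] := Rpower_prime 2 s isT ltac:(lra).
have w0 : 0 <= w by apply: sqrt_pos.
have q1 := Rpower_pos 2 (- s).
have w1 : w < 1 by rewrite -sqrt_1; apply: sqrt_lt_1; lra.
(* Beyond the first five terms, of which only the term 1 survives, [p^(-5s)] factors out. The 12
   comes from [2 (j + 6) <= 12 (j + 1)], one factor [1 / (1 - w)] from [lin_geo_sqrt] and the other
   from the geometric sum. Using the prime 2 in [w] makes [K] uniform in [p]. *)
set K := 12 * / (1 - w) * / (1 - w).
have iw : 0 < / (1 - w) by apply: Rinv_0_lt_compat; lra.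
have K0 : 0 <= K by rewrite /K; nra.
(* The index 0 is set apart because the bound on [b] is summed from 0, while the comparison series
   starts at 1. *)
pose b p := if p == 0%N then 0 else K * Rpower (INR p) (- (5 * s)).
have b0 p : 0 <= b p.
  rewrite /b; case: eqP => _; first by lra.
  by apply: Rmult_le_pos => //; apply/Rlt_le/Rpower_pos.
apply: (mulF_abs_summable _ b (K * (1 + / (5 * s - 1)))) => //.
- exact: gweight0.
- move=> p A pp; have [[u0 u2] _] := Rpower_prime p s pp ltac:(lra).
  set u := Rpower (INR p) (- s) in u0 u2.
  have wE a : Rabs (gweight s p a) = Rabs (gg a) * u ^ a.
    rewrite /gweight Rpower_nat_exp Rabs_mult -/u [X in _ * X]Rabs_pos_eq //.
    exact: pow_le.
  apply: (Rle_trans _ (\big[Rplus/0]_(0 <= a < A + 5) Rabs (gweight s p a))).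
    rewrite [X in _ <= X](@big_cat_nat _ _ _ A) ?leq_addr //=.
    rewrite -[X in X <= _]Rplus_0_r; apply: Rplus_le_compat_l.
    by apply: rsum_ge0 => a _; apply: Rabs_pos.
  rewrite (@big_cat_nat _ _ _ 5) ?leq_addl //=; apply: Rplus_le_compat.
    rewrite !big_nat_recr //= big_geq // !wE gg0 !gg_small // Rabs_R0 Rabs_R1 /=; lra.
  rewrite -{1}[5%N]add0n big_addn addnK.
  have -> : b p = Rpower (INR p) (- (5 * s)) * (12 * / (1 - w) * / (1 - w)).
    by rewrite /b -/K (negPf (lt0n_neq0 (prime_gt0 pp))); ring.
  have -> : Rpower (INR p) (- (5 * s)) = u ^ 5.
    rewrite /u -Rpower_nat_exp; congr Rpower; simpl; ring.
  apply: (Rle_trans _ (u ^ 5 * (12 * / (1 - w) * \big[Rplus/0]_(0 <= j < A) w ^ j))).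
    rewrite -Rmult_assoc -rsum_scal; apply: rsum_le => j _.
    rewrite wE pow_add.
    have g1 := gg_bound (j + 5).
    have g2 : 2 * (INR (j + 5) + 1) <= 12 * (INR j + 1).
      by rewrite plus_INR (INR_IZR_INZ 5) /=; have := pos_INR j; lra.
    have u5 : 0 <= u ^ 5 by apply: pow_le.
    have uj : 0 <= u ^ j by apply: pow_le.
    have h3 : u ^ j <= Rpower 2 (- s) ^ j by apply: pow_incr.
    have h4 := lin_geo_sqrt (Rpower 2 (- s)) j ltac:(lra); rewrite -/w in h4.
    have j0 := pos_INR j.
    have h5 : Rabs (gg (j + 5)) * u ^ j <= 12 * (/ (1 - w) * w ^ j).
      apply: (Rle_trans _ (12 * ((INR j + 1) * Rpower 2 (- s) ^ j))); last by lra.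
      rewrite -Rmult_assoc; apply: Rmult_le_compat => //; [exact: Rabs_pos | lra].
    nra.
  apply: Rmult_le_compat_l; first exact: pow_le.
  apply: Rmult_le_compat_l; first by lra.
  by apply: geo_sum.
- move=> N.
  apply: (Rle_trans _ (\big[Rplus/0]_(0 <= p < N.+1) b p)).
    by rewrite [X in _ <= X]big_nat_recr //=; have := b0 N; lra.
  rewrite big_ltn // {1}/b eqxx Rplus_0_l.
  rewrite big_nat (eq_bigr (fun p => K * Rpower (INR p) (- (5 * s)))); last first.
    by move=> p /andP[p0 _]; rewrite /b (negPf (lt0n_neq0 p0)).
  rewrite -big_nat rsum_scal; apply: Rmult_le_compat_l => //.
  by apply: zeta_partial_bound; lra.
Qed.

Definition gsum (s : R) : R :=
  Series (fun n => mulF (fun _ => gg) n.+1 * Rpower (INR n.+1) (- s)).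

Lemma gsum_abs (s : R) : 1 / 5 < s ->
  ex_series (fun n => Rabs (mulF (fun _ => gg) n.+1 * Rpower (INR n.+1) (- s))).
Proof.
move=> /gweight_summable; apply: ex_series_ext => n.
by rewrite /gweight mulF_weight // gg0.
Qed.

Lemma gweight_limit (s : R) : 1 / 5 < s ->
  is_lim_seq (fun N => \big[Rmult/1]_(0 <= p < N | prime p) Series (gweight s p)) (gsum s).
Proof.
move=> s5.
have -> : gsum s = Series (fun n => mulF (gweight s) n.+1).
  by apply: Series_ext => n; rewrite /gweight mulF_weight // gg0.
apply: euler_product_limit; first exact: gweight0.
  by move=> p pp; apply: gweight_series => //; lra.
exact: gweight_summable.
Qed.

(** * The two Euler products of the statement *)

Lemma term2_gweight (p k : nat) : prime p ->
  term2 p (5 + k)%N = gweight (1 / 3) p (5 + k)%N.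
Proof.
move=> pp; rewrite /term2 /gweight /Rdiv -Rpower_Ropp; congr Rmult; last first.
  by congr Rpower; field.
have -> : (5 + k - 1 = k.+4)%N by lia.
have -> : (5 + k - 3 = k.+2)%N by lia.
have -> : (5 + k - 4 = k.+1)%N by lia.
have -> : (5 + k = k.+4.+1)%N by lia.
by rewrite /gg /hh /phit /phiR /=; ring.
Qed.

(** As [gg] vanishes at 1, 2, 3 and 4, one plus the sum from 5 on is the full local series of [G] at
    1/3. From [a = 5] on, all four arguments are positive, where [phit] agrees with the totient. *)
Lemma euler_term2 :
  (forall p, prime p -> ex_series (fun k => term2 p (5 + k)%N)) /\
  is_lim_seq (euler_partial 5 term2) (gsum (1 / 3)).
Proof.
have ex p : prime p -> ex_series (fun k => gweight (1 / 3) p (5 + k)%N).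
  move=> pp; have := gweight_series (1 / 3) p pp ltac:(lra).
  by move/(ex_series_incr_n _ 5).
split=> [p pp|].
  by apply: ex_series_ext (ex p pp) => k; rewrite term2_gweight.
apply: is_lim_seq_ext (gweight_limit (1 / 3) ltac:(lra)) => N.
apply: eq_bigr => p pp; rewrite /euler_factor.
rewrite (Series_incr_n _ 5); [|lia|by apply: gweight_series => //; lra].
congr Rplus.
  by rewrite /= gweight0 /gweight !gg_small //; ring.
by apply: Series_ext => k; rewrite term2_gweight.
Qed.

(** The local terms of [zeta(3)]; the factor 1 gives the expression the shape expected by
    [mulF_weight]. *)
Definition zweight (p a : nat) : R := 1 * Rpower (INR p) (- (INR a * 3)).

(** The product [coefC1] removes only [zeta(s)] from the Dirichlet series, [coefC2] also [zeta(3s)].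
    So the local factor of the former is that of [G] at 1 times [1 / (1 - p^-3)]. *)
Lemma hh_local (p : nat) : prime p ->
  ex_series (fun a => hh a * (/ INR p) ^ a) /\
  Series (fun a => hh a * (/ INR p) ^ a) = Series (gweight 1 p) * Series (zweight p).
Proof.
move=> pp; set u := / INR p.
have p2 : 2 <= INR p by apply: (INR_leq 2); apply: prime_gt1.
have u0 : 0 < u by apply: Rinv_0_lt_compat; lra.
have u1 : u < 1 by rewrite -Rinv_1; apply: Rinv_lt_contravar; lra.
have uE : Rpower (INR p) (- (1)) = u by rewrite Rpower_Ropp Rpower_1 //; lra.
have exh : ex_series (fun a => hh a * u ^ a).
  apply: local_series => [|a]; first by lra.
  by have := hh_bound a; have := pos_INR a; lra.
split=> //.
have -> : Series (zweight p) = / (1 - u ^ 3).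
  rewrite -Series_geom; last first.
    rewrite Rabs_pos_eq; last by apply: pow_le; lra.
    have := pow_incr u 1 3; have : u * u < 1 by nra.
    by move=> h _; simpl; nra.
  apply: Series_ext => a; rewrite /zweight Rmult_1_l Rpower_nat_exp; congr pow.
  by rewrite /u pow_inv Rpower_Ropp -Rpower_pow ?(INR_IZR_INZ 3) //; lra.
have u3 : u ^ 3 < 1.
  have : u * u < 1 by nra.
  by move=> h; simpl; nra.
(* Multiplication of the series of [hh] by [u^3], as a shift of coefficients; the series of [gg] is
   that of [hh] minus this one. *)
pose sh a := if a is a'.+3 then hh a' * u ^ a else 0.
have exs : ex_series (fun k => sh (3 + k)%N).
  apply: (ex_series_ext (fun k => u ^ 3 * (hh k * u ^ k))).
    move=> k; have E : u ^ 3 * (hh k * u ^ k) = hh k * u ^ (3 + k)%N.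
      by rewrite pow_add; ring.
    exact: E.
  exact: ex_series_scal.
have exsh : ex_series sh by apply/(ex_series_incr_n _ 3).
have shE : Series sh = u ^ 3 * Series (fun a => hh a * u ^ a).
  rewrite (Series_incr_n _ 3) //=; last by lia.
  rewrite -Series_scal_l.
  have -> : 0 + 0 + 0 = 0 by ring.
  rewrite Rplus_0_l; apply: Series_ext => k.
  have E : u ^ 3 * (hh k * u ^ k) = hh k * u ^ (3 + k)%N by rewrite pow_add; ring.
  by rewrite E.
have -> : Series (gweight 1 p) = Series (fun a => hh a * u ^ a) - Series sh.
  rewrite -Series_minus //; apply: Series_ext => a.
  rewrite /gweight Rpower_nat_exp uE /gg /sh.
  by case: a => [|[|[|a]]]; ring.
rewrite shE; field; lra.
Qed.

Lemma term1_hh (p k : nat) :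
  term1 p (3 + k)%N = hh (3 + k)%N * (/ INR p) ^ (3 + k)%N.
Proof.
rewrite /term1 pow_inv; congr Rmult.
Qed.

(** Here [hh] vanishes at 1 and 2, so one plus the sum from 3 on is the full local series of [hh];
    by [hh_local] the product splits into those of [G(1)] and [zeta(3)]. *)
Lemma euler_term1 :
  (forall p, prime p -> ex_series (fun k => term1 p (3 + k)%N)) /\
  is_lim_seq (euler_partial 3 term1)
    (gsum 1 * Series (fun n => Rpower (INR n.+1) (- (3)))).
Proof.
have zE n : mulF zweight n.+1 = Rpower (INR n.+1) (- (3)).
  by rewrite /zweight mulF_weight // /mulF big1 // Rmult_1_l.
have lz : is_lim_seq (fun N => \big[Rmult/1]_(0 <= p < N | prime p) Series (zweight p))
    (Series (fun n => Rpower (INR n.+1) (- (3)))).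
  rewrite -(Series_ext _ _ zE); apply: euler_product_limit.
  - by move=> q; rewrite /zweight Rmult_0_l Ropp_0 /Rpower Rmult_0_l exp_0; ring.
  - move=> p pp; have [[h1 h2] h3] := Rpower_prime p 3 pp ltac:(lra).
    apply: (ex_series_ext (fun a => Rpower (INR p) (- (3)) ^ a)).
      by move=> a; rewrite /zweight Rpower_nat_exp Rmult_1_l.
    by apply: ex_series_geom; rewrite Rabs_pos_eq; lra.
  - apply: (ex_series_ext (fun n => Rpower (INR n.+1) (- (3)))).
      by move=> n; rewrite zE Rabs_pos_eq //; apply/Rlt_le/Rpower_pos.
    by apply: ex_series_Rpower; lra.
split=> [p pp|].
  have [ex _] := hh_local p pp; move/(ex_series_incr_n _ 3): ex.
  by apply: ex_series_ext => k; rewrite term1_hh.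
apply: is_lim_seq_ext (is_lim_seq_mult' _ _ _ _ (gweight_limit 1 ltac:(lra)) lz) => N.
rewrite -big_split /=; apply: eq_bigr => p pp.
have [ex <-] := hh_local p pp.
rewrite /euler_factor (Series_incr_n _ 3) //; last by lia.
congr Rplus.
  have h1 : hh 1 = 0 by rewrite /hh /phit /=; ring.
  have h2 : hh 2 = 0 by rewrite /hh /phit /=; ring.
  by rewrite /= hh0 h1 h2; ring.
by apply: Series_ext => k; rewrite term1_hh.
Qed.

(** * Complex series and the analytic continuation of [zeta] *)

Notation csum := (@sum_n C_AbelianMonoid).
Notation cseries := (@is_series C_AbsRing C_NormedModule).

Definition clim (u : nat -> C) (l : C) : Prop :=
  forall e, 0 < e -> exists N, forall n, (N <= n)%N -> Cmod (u n - l)%C < e.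

Lemma csum0 (a : nat -> C) : csum a 0%N = a 0%N.
Proof. exact: sum_O. Qed.

Lemma csumS (a : nat -> C) (N : nat) : csum a N.+1 = (csum a N + a N.+1)%C.
Proof. exact: sum_Sn. Qed.

Lemma cseries_clim (a : nat -> C) (l : C) : cseries a l <-> clim (csum a) l.
Proof.
rewrite /is_series; split.
  move=> /(filterlim_locally_ball_norm (K := C_AbsRing) (U := C_NormedModule)) h e e0.
  have [N hN] := h (mkposreal e e0); exists N => n /leP Nn.
  exact: hN n Nn.
move=> h; apply/(filterlim_locally_ball_norm (K := C_AbsRing) (U := C_NormedModule)) => e.
have [N hN] := h e (cond_pos e); exists N => n /leP Nn.
exact: hN n Nn.
Qed.

Lemma Cmod_minus_sym (x y : C) : Cmod (x - y)%C = Cmod (y - x)%C.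
Proof. by rewrite -Cmod_opp; congr Cmod; ring. Qed.

Lemma clim_unique (u : nat -> C) (l1 l2 : C) : clim u l1 -> clim u l2 -> l1 = l2.
Proof.
move=> h1 h2; apply: NNPP => ne.
have d : (l1 - l2)%C <> 0.
  move=> e; apply: ne; have h : l1 = ((l1 - l2) + l2)%C by ring.
  by rewrite h e; ring.
have /Cmod_gt_0 d0 := d.
have [N1 H1] := h1 (Cmod (l1 - l2) / 2) ltac:(lra).
have [N2 H2] := h2 (Cmod (l1 - l2) / 2) ltac:(lra).
have a1 := H1 (maxn N1 N2) (leq_maxl _ _); have a2 := H2 (maxn N1 N2) (leq_maxr _ _).
have := Cmod_triangle (l1 - u (maxn N1 N2)) (u (maxn N1 N2) - l2).
have -> : (l1 - u (maxn N1 N2) + (u (maxn N1 N2) - l2) = l1 - l2)%C by ring.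
rewrite Cmod_minus_sym in a1; lra.
Qed.

Lemma clim_ext (u v : nat -> C) (l : C) : (forall n, u n = v n) -> clim u l -> clim v l.
Proof. by move=> h hu e e0; have [N H] := hu e e0; exists N => n Nn; rewrite -h; apply: H. Qed.

Lemma clim_const (l : C) : clim (fun _ => l) l.
Proof.
move=> e e0; exists 0%N => n _; have -> : (l - l = 0)%C by ring.
by rewrite Cmod_0.
Qed.

Lemma clim_plus (u v : nat -> C) (l m : C) : clim u l -> clim v m ->
  clim (fun n => u n + v n)%C (l + m)%C.
Proof.
move=> h1 h2 e e0.
have [N1 H1] := h1 (e / 2) ltac:(lra); have [N2 H2] := h2 (e / 2) ltac:(lra).
exists (maxn N1 N2) => n hn.
have a1 := H1 n ltac:(lia); have a2 := H2 n ltac:(lia).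
have -> : (u n + v n - (l + m) = (u n - l) + (v n - m))%C by ring.
have := Cmod_triangle (u n - l) (v n - m); lra.
Qed.

Lemma clim_scal (c : C) (u : nat -> C) (l : C) : clim u l ->
  clim (fun n => c * u n)%C (c * l)%C.
Proof.
move=> h e e0; have c0 := Cmod_ge_0 c.
have [N H] := h (e / (Cmod c + 1)) ltac:(apply: Rdiv_lt_0_compat; lra).
exists N => n Nn; have -> : (c * u n - c * l = c * (u n - l))%C by ring.
rewrite Cmod_mult.
have a := H n Nn; have a0 := Cmod_ge_0 (u n - l)%C.
have : e = (Cmod c + 1) * (e / (Cmod c + 1)) by field; lra.
nra.
Qed.

Lemma clim_minus (u v : nat -> C) (l m : C) : clim u l -> clim v m ->
  clim (fun n => u n - v n)%C (l - m)%C.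
Proof.
move=> h1 h2; have -> : (l - m = l + (- (1)) * m)%C by ring.
apply: (clim_ext (fun n => u n + (- (1)) * v n)%C); first by move=> n; ring.
by apply: clim_plus => //; apply: clim_scal.
Qed.

Lemma clim_Re (u : nat -> C) (l : C) : clim u l -> is_lim_seq (fun n => Re (u n)) (Re l).
Proof.
move=> h; apply/is_lim_seq_spec => e.
have [N H] := h e (cond_pos e); exists N => n /leP Nn.
have := re_le_Cmod (u n - l)%C; have := H n Nn.
by rewrite /Re /=; rewrite /Rminus; lra.
Qed.

Lemma clim_bound (u : nat -> C) (l v : C) (B : R) (N : nat) : clim u l ->
  (forall n, (N <= n)%N -> Cmod (u n - v)%C <= B) -> Cmod (l - v)%C <= B.
Proof.
move=> h hB; apply: Rnot_lt_le => lt.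
have [M H] := h (Cmod (l - v)%C - B) ltac:(lra).
have a1 := H (maxn M N) (leq_maxl _ _); have a2 := hB (maxn M N) (leq_maxr _ _).
have := Cmod_triangle (l - u (maxn M N)) (u (maxn M N) - v).
have -> : (l - u (maxn M N) + (u (maxn M N) - v) = l - v)%C by ring.
rewrite Cmod_minus_sym in a1; lra.
Qed.

Lemma cseries_ex (a : nat -> C) (b : nat -> R) : (forall n, Cmod (a n) <= b n) ->
  ex_series b -> exists l, cseries a l.
Proof. exact: (@ex_series_le C_AbsRing C_CompleteNormedModule a b). Qed.

Lemma csum_Cmod (a : nat -> C) (N : nat) : Cmod (csum a N) <= sum_n (fun n => Cmod (a n)) N.
Proof.
elim: N => [|N IH]; first by rewrite csum0 sum_O; lra.
rewrite csumS sum_Sn; apply: Rle_trans (Cmod_triangle _ _) _.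
by apply: Rplus_le_compat_r.
Qed.

Lemma cseries_Cmod_le (a : nat -> C) (l : C) (B : R) : cseries a l ->
  (forall N, sum_n (fun n => Cmod (a n)) N <= B) -> Cmod l <= B.
Proof.
move=> /cseries_clim h hB; have -> : l = (l - 0)%C by ring.
apply: (clim_bound _ _ _ _ 0 h) => n _; have -> : (csum a n - 0 = csum a n)%C by ring.
exact: Rle_trans (csum_Cmod a n) (hB n).
Qed.

Lemma cseries_scal (c : C) (a : nat -> C) (l : C) : cseries a l ->
  cseries (fun n => c * a n)%C (c * l)%C.
Proof. exact: (@is_series_scal C_AbsRing C_NormedModule). Qed.

Lemma cseries_plus (a b : nat -> C) (l m : C) : cseries a l -> cseries b m ->
  cseries (fun n => a n + b n)%C (l + m)%C.
Proof. exact: (@is_series_plus C_AbsRing C_NormedModule). Qed.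

Lemma cseries_minus (a b : nat -> C) (l m : C) : cseries a l -> cseries b m ->
  cseries (fun n => a n - b n)%C (l - m)%C.
Proof. exact: (@is_series_minus C_AbsRing C_NormedModule). Qed.

Lemma cseries_ext (a b : nat -> C) (l : C) : (forall n, a n = b n) -> cseries a l -> cseries b l.
Proof. exact: (@is_series_ext C_AbsRing C_NormedModule). Qed.

Lemma cseries_unique (a : nat -> C) (l m : C) : cseries a l -> cseries a m -> l = m.
Proof. by move=> /cseries_clim h1 /cseries_clim h2; apply: clim_unique h1 h2. Qed.

Lemma cseries_csum (a : nat -> nat -> C) (b : nat -> C) (K : nat) :
  (forall k, cseries (fun n => a n k) (b k)) ->
  cseries (fun n => csum (a n) K) (csum b K).
Proof.
move=> h; elim: K => [|K IH].
  rewrite csum0; apply: (cseries_ext (fun n => a n 0%N)) => // n; by rewrite csum0.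
rewrite csumS; apply: (cseries_ext (fun n => csum (a n) K + a n K.+1)%C).
  by move=> n; rewrite csumS.
exact: cseries_plus.
Qed.

Lemma sum_n_le_compat (a b : nat -> R) (N : nat) : (forall n, a n <= b n) ->
  sum_n a N <= sum_n b N.
Proof.
move=> h; elim: N => [|N IH]; first by rewrite !sum_O.
by rewrite !sum_Sn; apply: Rplus_le_compat.
Qed.

Lemma sum_n_ge_term (a : nat -> R) (N k : nat) : (forall n, 0 <= a n) -> (k <= N)%N ->
  a k <= sum_n a N.
Proof.
move=> a0; elim: N => [|N IH].
  by rewrite leqn0 => /eqP ->; rewrite sum_O; lra.
have s0 M : 0 <= sum_n a M.
  elim: M => [|M IHM]; first by rewrite sum_O.
  by rewrite sum_Sn; apply: Rplus_le_le_0_compat.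
rewrite sum_Sn leq_eqVlt => /orP[/eqP ->|]; rewrite /plus /=.
  by have := s0 N; lra.
rewrite ltnS => /IH; have := a0 N.+1; lra.
Qed.

Lemma is_series_le_bound (a : nat -> R) (l B : R) : is_series a l ->
  (forall N, sum_n a N <= B) -> l <= B.
Proof.
move=> h hB; have h' : is_lim_seq (sum_n a) l by [].
exact: (is_lim_seq_le _ _ _ _ hB h' (is_lim_seq_const B)).
Qed.

Lemma ex_series_small_tail (M : nat -> R) (e : R) : (forall n, 0 <= M n) -> ex_series M ->
  0 < e -> exists N, forall P, sum_n M P - sum_n M N < e.
Proof.
move=> M0 [l hl] e0; have h : is_lim_seq (sum_n M) l by [].
have /is_lim_seq_spec /(_ (mkposreal e e0)) [N hN] := h.
exists N => P.
have a := hN N (le_n N); rewrite /= in a.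
have b : sum_n M P <= l.
  apply: is_lim_seq_incr_compare h _ P => n; rewrite sum_Sn; have := M0 n.+1.
  by rewrite /plus /=; lra.
by move/Rabs_lt_between: a => [a1 a2]; lra.
Qed.

(** Dominated convergence for series (Tannery): the tail is small uniformly in [K] thanks to [M],
    and the finitely many remaining terms tend to 0 with [K]. *)
Lemma cseries_dominated (D : nat -> nat -> C) (L : nat -> C) (M : nat -> R) :
  (forall K n, Cmod (D K n) <= M n) -> ex_series M ->
  (forall n, clim (fun K => D K n) 0) -> (forall K, cseries (D K) (L K)) ->
  clim L 0.
Proof.
move=> hM exM hD hL e e0.
have M0 n : 0 <= M n by apply: Rle_trans (hM 0%N n); apply: Cmod_ge_0.
have [N hN] := ex_series_small_tail M (e / 4) M0 exM ltac:(lra).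
have gen P d : 0 < d -> exists K0, forall K, (K0 <= K)%N ->
    sum_n (fun n => Cmod (D K n)) P < d.
  elim: P d => [|P IH] d d0.
    have [K0 h] := hD 0%N d d0; exists K0 => K /h; rewrite sum_O.
    by have -> : (D K 0%N - 0 = D K 0%N)%C by ring.
  have [K1 h1] := IH (d / 2) ltac:(lra).
  have [K2 h2] := hD P.+1 (d / 2) ltac:(lra).
  exists (maxn K1 K2) => K hK.
  have a1 := h1 K ltac:(lia); have := h2 K ltac:(lia).
  have -> : (D K P.+1 - 0 = D K P.+1)%C by ring.
  by rewrite sum_Sn /plus /=; lra.
have [K0 hK] := gen N (e / 4) ltac:(lra).
exists K0 => K /hK {}hK.
have -> : (L K - 0 = L K)%C by ring.
apply: (Rle_lt_trans _ (e / 2)); last by lra.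
apply: (cseries_Cmod_le _ _ _ (hL K)) => P.
have key : sum_n (fun n => Cmod (D K n)) P <= sum_n (fun n => Cmod (D K n)) N + e / 4.
  have [le|gt] := leqP P N.
    have : sum_n (fun n => Cmod (D K n)) P <= sum_n (fun n => Cmod (D K n)) N.
      elim: N le {hN hK} => [|N IH]; first by rewrite leqn0 => /eqP ->; lra.
      rewrite leq_eqVlt => /orP[/eqP ->|]; first by lra.
      rewrite ltnS => /IH; rewrite sum_Sn /plus /=; have := Cmod_ge_0 (D K N.+1); lra.
    lra.
  have h : sum_n (fun n => Cmod (D K n)) P - sum_n (fun n => Cmod (D K n)) N
      <= sum_n M P - sum_n M N.
    elim: P gt => // P IH; rewrite ltnS leq_eqVlt => /orP[/eqP <-|/IH h].
      by rewrite !sum_Sn /plus /=; have := hM K N.+1; lra.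
    by rewrite !sum_Sn /plus /=; have := hM K P.+1; lra.
  have := hN P; lra.
lra.
Qed.

(** The row remainders [S n - csum (a n) K] tend to 0 and are dominated by [2 M n]; by
    [cseries_dominated] so does their sum over [n], which is [T - csum b K]. *)
Lemma cseries_fubini (a : nat -> nat -> C) (S b : nat -> C) (M : nat -> R) (T : C) :
  (forall n K, sum_n (fun k => Cmod (a n k)) K <= M n) -> ex_series M ->
  (forall n, cseries (a n) (S n)) -> (forall k, cseries (fun n => a n k) (b k)) ->
  cseries S T -> cseries b T.
Proof.
move=> hM exM hS hb hT; apply/cseries_clim.
have hD : clim (fun K => T - csum b K)%C 0.
  apply: (cseries_dominated (fun K n => S n - csum (a n) K)%C _ (fun n => 2 * M n)).
  - move=> K n.
    have h1 := cseries_Cmod_le _ _ _ (hS n) (hM n).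
    have h2 := Rle_trans _ _ _ (csum_Cmod (a n) K) (hM n K).
    have := Cmod_triangle (S n) (- csum (a n) K); rewrite Cmod_opp -/(Cminus _ _); lra.
  - exact: (@ex_series_scal R_AbsRing R_NormedModule).
  - move=> n; have -> : RtoC 0 = (S n - S n)%C by ring.
    by apply: clim_minus; [exact: clim_const | apply/cseries_clim].
  - by move=> K; apply: cseries_minus => //; apply: cseries_csum.
apply: (clim_ext (fun K => T - (T - csum b K))%C); first by move=> n; ring.
have E : T = (T - 0)%C by ring.
rewrite [X in clim _ X]E.
by apply: clim_minus => //; apply: clim_const.
Qed.

(** * The complex exponential and its power series *)

Lemma Cexp_add (z w : C) : Cexp (z + w)%C = (Cexp z * Cexp w)%C.
Proof.
case: z => a b; case: w => c d.
rewrite /Cexp /Cmult /Cplus /Re /Im /= cos_plus sin_plus exp_plus.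
by congr pair; ring.
Qed.

Lemma Cexp_RtoC (x : R) : Cexp (RtoC x) = RtoC (exp x).
Proof.
by rewrite /Cexp /RtoC /Re /Im /= cos_0 sin_0; congr pair; ring.
Qed.

Lemma Cexp_0 : Cexp (RtoC 0) = RtoC 1.
Proof. by rewrite Cexp_RtoC exp_0. Qed.

Lemma Cmod_Cexp (z : C) : Cmod (Cexp z) = exp (Re z).
Proof.
case: z => a b; rewrite /Cexp /Cmod /Re /Im /=.
have -> : exp a * cos b * (exp a * cos b * 1) + exp a * sin b * (exp a * sin b * 1)
   = exp a * exp a * (Rsqr (sin b) + Rsqr (cos b)) by rewrite /Rsqr; ring.
rewrite sin2_cos2 Rmult_1_r; apply: sqrt_square; exact/Rlt_le/exp_pos.
Qed.

Lemma Cmod_le_abs (x y : R) : Cmod (x, y) <= Rabs x + Rabs y.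
Proof.
have -> : ((x, y) : C) = (RtoC x + Ci * RtoC y)%C.
  by rewrite /RtoC /Ci /Cmult /Cplus /=; congr pair; ring.
apply: Rle_trans (Cmod_triangle _ _) _.
by rewrite Cmod_mult Cmod_Ci !Cmod_R; lra.
Qed.

Lemma derive_compare (F dF G dG : R -> R) : F 0 = 0 -> G 0 = 0 ->
  (forall t, is_derive F t (dF t)) -> (forall t, is_derive G t (dG t)) ->
  (forall t, 0 <= t <= 1 -> Rabs (dF t) <= dG t) ->
  forall t, 0 <= t <= 1 -> Rabs (F t) <= G t.
Proof.
move=> F0 G0 hF hG hb t [t0 t1].
have cont (H dH : R -> R) : (forall t, is_derive H t (dH t)) -> forall x, continuity_pt H x.
  move=> h x; apply/derivable_continuous_pt/ex_derive_Reals_0.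
  by eexists; apply: h.
have mono (H dH : R -> R) : H 0 = 0 -> (forall t, is_derive H t (dH t)) ->
    (forall t, 0 <= t <= 1 -> 0 <= dH t) -> 0 <= H t.
  move=> H0 h p.
  have [|x _|c] := MVT_gen H 0 t dH; [by move=> x _; apply: h | exact: cont h x |].
  rewrite Rmin_left ?Rmax_right // H0 => -[[c0 ct]].
  rewrite !Rminus_0_r => ->; apply: Rmult_le_pos => //; apply: p; lra.
have h1 : 0 <= G t - F t.
  apply: (mono (fun t => G t - F t) (fun t => dG t - dF t)); first by lra.
    by move=> x; apply: is_derive_minus.
  by move=> x /hb /Rabs_le_between; lra.
have h2 : 0 <= G t + F t.
  apply: (mono (fun t => G t + F t) (fun t => dG t + dF t)); first by lra.
    by move=> x; apply: is_derive_plus.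
  by move=> x /hb /Rabs_le_between; lra.
by apply: Rabs_le; lra.
Qed.

Lemma INR_fact_gt0 (k : nat) : 0 < INR (fact k).
Proof. by apply: lt_0_INR; apply: lt_O_fact. Qed.

Lemma derive_pow_fact (k : nat) (t : R) :
  is_derive (fun t => t ^ k.+1 / INR (fact k.+1)) t (t ^ k / INR (fact k)).
Proof.
have f0 := INR_fact_gt0 k; have k0 := INR_gt0 k.+1 isT.
have : INR (fact k.+1) = INR k.+1 * INR (fact k) by rewrite fact_simpl mult_INR.
move: (INR (fact k.+1)) => c cE.
evar_last.
  apply: (is_derive_scal_l (fun t => t ^ k.+1) t _ (/ c)).
  by apply: is_derive_pow; apply: is_derive_id.
move: cE f0 k0; rewrite /scal /Hierarchy.one [Nat.pred _]/= /mult.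
move: (INR (fact k)) (INR k.+1) => f n -> f0 n0 /=; rewrite /mult /=.
field; lra.
Qed.

Definition expP (a : nat -> R) (K : nat) (t : R) : R :=
  sum_n (fun k => a k * (t ^ k / INR (fact k))) K.

Lemma derive_expP (a : nat -> R) (K : nat) (t : R) :
  is_derive (expP a K.+1) t (expP (fun k => a k.+1) K t).
Proof.
elim: K => [|K IH].
  apply: (is_derive_ext (fun t => a 0%N + a 1%N * (t ^ 1 / INR (fact 1)))).
    by move=> x; rewrite /expP sum_Sn sum_O /plus /=; field.
  rewrite /expP sum_O; evar_last.
    apply: is_derive_plus; first exact: is_derive_const.
    by apply: is_derive_scal; apply: derive_pow_fact.
  by rewrite /plus /Hierarchy.zero /=; ring.
apply: (is_derive_ext (fun t => expP a K.+1 t + a K.+2 * (t ^ K.+2 / INR (fact K.+2)))).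
  by move=> x; rewrite /expP [RHS]sum_Sn.
rewrite {2}/expP sum_Sn; apply: is_derive_plus => //.
by apply: is_derive_scal; apply: derive_pow_fact.
Qed.

Lemma expP_lin (x y : R) (a b : nat -> R) (K : nat) (t : R) :
  expP (fun k => x * a k + y * b k) K t = x * expP a K t + y * expP b K t.
Proof.
rewrite /expP; elim: K => [|K IH]; first by rewrite !sum_O; ring.
by rewrite !sum_Sn IH /plus /=; ring.
Qed.

(** The Taylor remainder after [K] terms; [expP a k] has [k + 1] terms, hence the case distinction.
    Differentiation then lowers [K] by one. *)
Definition exp_rem (phi : R -> R) (a : nat -> R) (K : nat) (t : R) : R :=
  if K is k.+1 then phi t - expP a k t else phi t.

(** The real and imaginary parts of [exp(t z)] satisfy a linear differential system. Their Taylor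
    remainders satisfy the same system with [K] lowered by one, so integrating the bounds from 0
    with [derive_compare] yields [E m^K t^K / K!] by induction on [K]. *)
Lemma cexp_series (z : C) :
  cseries (fun k => z ^ k * RtoC (/ INR (fact k)))%C (Cexp z).
Proof.
case: z => x y; set z : C := (x, y).
pose A k := Re (z ^ k)%C; pose B k := Im (z ^ k)%C.
have AS k : A k.+1 = x * A k + (- y) * B k.
  by rewrite /A /B Cpow_S /Cmult /Re /Im /=; ring.
have BS k : B k.+1 = x * B k + y * A k.
  by rewrite /A /B Cpow_S /Cmult /Re /Im /=; ring.
pose ph t := exp (t * x) * cos (t * y); pose ps t := exp (t * x) * sin (t * y).
have dph t : is_derive ph t (x * ph t + (- y) * ps t).
  by rewrite /ph /ps; auto_derive => //; ring.
have dps t : is_derive ps t (x * ps t + y * ph t).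
  by rewrite /ph /ps; auto_derive => //; ring.
have dA K t : is_derive (exp_rem ph A K.+1) t (x * exp_rem ph A K t + (- y) * exp_rem ps B K t).
  case: K => [|K]; evar_last.
  - apply: (is_derive_minus ph (fun t => expP A 0 t)); first exact: dph.
    apply: (is_derive_ext (fun _ => A 0%N)); last exact: is_derive_const.
    by move=> s; rewrite /expP sum_O /=; field.
  - by rewrite /minus /plus /opp /Hierarchy.zero /=; ring.
  - apply: (is_derive_minus ph (fun t => expP A K.+1 t)); first exact: dph.
    exact: derive_expP.
  rewrite /expP (sum_n_ext _ (fun k => (x * A k + (- y) * B k) * (t ^ k / INR (fact k)))).
    by rewrite -/(expP _ K t) expP_lin /minus /plus /opp /=; ring.
  by move=> k; rewrite AS.
have dB K t : is_derive (exp_rem ps B K.+1) t (x * exp_rem ps B K t + y * exp_rem ph A K t).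
  case: K => [|K]; evar_last.
  - apply: (is_derive_minus ps (fun t => expP B 0 t)); first exact: dps.
    apply: (is_derive_ext (fun _ => B 0%N)); last exact: is_derive_const.
    by move=> s; rewrite /expP sum_O /=; field.
  - by rewrite /minus /plus /opp /Hierarchy.zero /=; ring.
  - apply: (is_derive_minus ps (fun t => expP B K.+1 t)); first exact: dps.
    exact: derive_expP.
  rewrite /expP (sum_n_ext _ (fun k => (x * B k + y * A k) * (t ^ k / INR (fact k)))).
    by rewrite -/(expP _ K t) expP_lin /minus /plus /opp /=; ring.
  by move=> k; rewrite BS.
pose m := Rabs x + Rabs y; pose E := exp (Rabs x).
have m0 : 0 <= m by rewrite /m; have := Rabs_pos x; have := Rabs_pos y; lra.
have expP0 a K : expP a K 0 = a 0%N.
  rewrite /expP; elim: K => [|K IH]; first by rewrite sum_O /=; field.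
  rewrite sum_Sn IH /plus /= Rmult_0_l /Rdiv Rmult_0_l; ring.
have bd K t : 0 <= t <= 1 ->
    Rabs (exp_rem ph A K t) <= E * m ^ K * (t ^ K / INR (fact K)) /\
    Rabs (exp_rem ps B K t) <= E * m ^ K * (t ^ K / INR (fact K)).
  elim: K t => [|K IH] t t01.
    have e1 : exp (t * x) <= E.
      apply: exp_le; apply: Rle_trans (Rle_abs _) _; rewrite Rabs_mult.
      by rewrite (Rabs_pos_eq t); have := Rabs_pos x; nra.
    have e0 := exp_pos (t * x).
    have c1 : Rabs (cos (t * y)) <= 1 by apply: Rabs_le; have := COS_bound (t * y); lra.
    have s1 : Rabs (sin (t * y)) <= 1 by apply: Rabs_le; have := SIN_bound (t * y); lra.
    rewrite /= /ph /ps !Rabs_mult !(Rabs_pos_eq (exp _)); try lra.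
    have := Rabs_pos (cos (t * y)); have := Rabs_pos (sin (t * y)).
    have -> : E * 1 * (1 / 1) = E by field.
    by split; nra.
  have dG s : is_derive (fun t => E * m ^ K.+1 * (t ^ K.+1 / INR (fact K.+1))) s
      (E * m ^ K.+1 * (s ^ K / INR (fact K))).
    by apply: is_derive_scal; apply: derive_pow_fact.
  have G0 : E * m ^ K.+1 * (0 ^ K.+1 / INR (fact K.+1)) = 0.
    by rewrite pow_i; [rewrite /Rdiv; ring | lia].
  have lin u v w b : Rabs v <= b -> Rabs w <= b -> Rabs u <= Rabs y ->
      Rabs (x * v + u * w) <= m * b.
    move=> vb wb uy; apply: Rle_trans (Rabs_triang _ _) _; rewrite !Rabs_mult /m.
    have := Rabs_pos x; have := Rabs_pos v; have := Rabs_pos w; have := Rabs_pos u.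
    by nra.
  split.
    apply: (derive_compare _ _ _ _ _ G0 (dA K) dG) t01.
      by rewrite /= expP0 /ph /A !Rmult_0_l exp_0 cos_0 /=; ring.
    move=> s /IH [h1 h2]; have -> : E * m ^ K.+1 * (s ^ K / INR (fact K))
      = m * (E * m ^ K * (s ^ K / INR (fact K))) by simpl; ring.
    by apply: lin => //; rewrite Rabs_Ropp; lra.
  apply: (derive_compare _ _ _ _ _ G0 (dB K) dG) t01.
    by rewrite /= expP0 /ps /B !Rmult_0_l exp_0 sin_0 /=; ring.
  move=> s /IH [h1 h2]; have -> : E * m ^ K.+1 * (s ^ K / INR (fact K))
    = m * (E * m ^ K * (s ^ K / INR (fact K))) by simpl; ring.
  by apply: lin => //; lra.
apply/cseries_clim => e e0.
have sumE K : csum (fun k => z ^ k * RtoC (/ INR (fact k)))%C K = (expP A K 1, expP B K 1).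
  elim: K => [|K IH].
    rewrite csum0 /expP !sum_O /A /B /RtoC /Cmult /Re /Im /=.
    by congr pair; field.
  have f0 := INR_fact_gt0 K.+1.
  rewrite csumS IH /expP !sum_Sn -/(expP A K 1) -/(expP B K 1) /A /B /RtoC /Cplus /plus.
  move: (z ^ K.+1)%C => [u v]; rewrite /Cmult /Re /Im [fst _]/= [snd _]/= /=.
  by rewrite !pow1; congr pair; rewrite /Rdiv; ring.
have lim0 : is_lim_seq (fun K => m ^ K / INR (fact K)) 0.
  have h : ex_series (fun K => / INR (fact K) * m ^ K).
    by exists (exp m); apply: is_series_ext (is_exp_Reals m) => n;
       rewrite /scal /= /mult /= pow_n_pow; ring.
  apply: is_lim_seq_ext (ex_series_lim_0 _ h) => n; rewrite /Rdiv; ring.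
have E0 : 0 < E by apply: exp_pos.
have /is_lim_seq_spec h := lim0.
have [N hN] := h (mkposreal (e / (2 * E)) ltac:(apply: Rdiv_lt_0_compat; lra)).
exists N => n Nn.
rewrite sumE /Cexp /Re /Im /=.
pose c1 := exp x * cos y; pose c2 := exp x * sin y.
have -> : ((expP A n 1, expP B n 1) - (c1, c2))%C
  = (- exp_rem ph A n.+1 1, - exp_rem ps B n.+1 1).
  by rewrite /Cminus /Copp /Cplus /exp_rem /ph /ps /c1 /c2 /= !Rmult_1_l; congr pair; ring.
have [b1 b2] := bd n.+1 1 ltac:(lra).
apply: Rle_lt_trans (Cmod_le_abs _ _) _; rewrite !Rabs_Ropp.
have := hN n.+1 ltac:(lia); rewrite [pos _]/= Rminus_0_r => hn.
have hn' : m ^ n.+1 / INR (fact n.+1) < e / (2 * E).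
  exact: Rle_lt_trans (Rle_abs _) hn.
have eq : E * m ^ n.+1 * (1 ^ n.+1 / INR (fact n.+1)) = E * (m ^ n.+1 / INR (fact n.+1)).
  by rewrite pow1 /Rdiv; ring.
rewrite eq in b1 b2.
have : E * (m ^ n.+1 / INR (fact n.+1)) < E * (e / (2 * E)) by apply: Rmult_lt_compat_l.
have -> : E * (e / (2 * E)) = e / 2 by field; lra.
lra.
Qed.

(** On the disc [f] belongs to the Banach algebra of absolutely convergent power series, with norm
    at most [M]. A predicate on upper bounds is used because only bounds are ever propagated. *)
Definition wiener (c : C) (r M : R) (f : C -> C) : Prop :=
  exists a : nat -> C, (forall K, sum_n (fun k => Cmod (a k) * r ^ k) K <= M) /\
    forall w, Cmod w <= r -> cseries (fun k => a k * w ^ k)%C (f (c + w)%C).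

Lemma bounded_series (a : nat -> R) (B : R) : (forall n, 0 <= a n) ->
  (forall N, sum_n a N <= B) -> ex_series a /\ Series a <= B.
Proof.
move=> a0 hB; have ex : ex_series a.
  apply: (series_nonneg_bounded _ B) => // -[|N].
    by rewrite big_geq //; have := hB 0%N; rewrite sum_O; have := a0 0%N; lra.
  by rewrite rsum_sum_n.
by split=> //; apply: is_series_le_bound (Series_correct _ ex) hB.
Qed.

Lemma sum_n_le_Series (a : nat -> R) (N : nat) : (forall n, 0 <= a n) ->
  ex_series a -> sum_n a N <= Series a.
Proof. by move=> a0 ex; rewrite -rsum_sum_n; apply: rsum_le_series. Qed.

Lemma wiener_ge0 (c : C) (r M : R) (f : C -> C) : wiener c r M f -> 0 <= M.
Proof.
by move=> [a [h _]]; have := h 0%N; rewrite sum_O /= => h0; have := Cmod_ge_0 (a 0%N); lra.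
Qed.

Lemma wiener_term_le (a : nat -> C) (r : R) (w : C) (k : nat) : Cmod w <= r ->
  Cmod (a k * w ^ k)%C <= Cmod (a k) * r ^ k.
Proof.
move=> wr; rewrite Cmod_mult Cmod_pow; apply: Rmult_le_compat_l; first exact: Cmod_ge_0.
by apply: pow_incr; split => //; apply: Cmod_ge_0.
Qed.

Lemma wiener_bound (c : C) (r M : R) (f : C -> C) (w : C) : wiener c r M f ->
  Cmod w <= r -> Cmod (f (c + w)%C) <= M.
Proof.
move=> [a [h1 h2]] wr; apply: (cseries_Cmod_le _ _ _ (h2 w wr)) => N.
apply: Rle_trans (h1 N); apply: sum_n_le_compat => k; exact: wiener_term_le.
Qed.

Lemma wiener_ext (c : C) (r M : R) (f g : C -> C) :
  (forall w, Cmod w <= r -> f (c + w)%C = g (c + w)%C) ->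
  wiener c r M f -> wiener c r M g.
Proof.
by move=> e [a [h1 h2]]; exists a; split => // w wr; rewrite -e //; apply: h2.
Qed.

Lemma wiener_le (c : C) (r M M' : R) (f : C -> C) : M <= M' ->
  wiener c r M f -> wiener c r M' f.
Proof. by move=> le [a [h1 h2]]; exists a; split => // K; have := h1 K; lra. Qed.

(** Completeness of the algebra, in the role of Weierstrass's theorem on limits of analytic
    functions. The [k]-th coefficients are at most [M n / r^k], so they can be added over [n];
    [cseries_fubini] shows that the resulting power series represents [F]. *)
Lemma wiener_series (c : C) (r : R) (M : nat -> R) (f : nat -> C -> C) (F : C -> C) :
  0 < r -> (forall n, wiener c r (M n) (f n)) -> ex_series M ->
  (forall w, Cmod w <= r -> cseries (fun n => f n (c + w)%C) (F (c + w)%C)) ->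
  wiener c r (Series M) F.
Proof.
move=> r0 hf exM hF.
have M0 n : 0 <= M n by apply: wiener_ge0 (hf n).
pose a n := sval (constructive_indefinite_description _ (hf n)).
have aP n : (forall K, sum_n (fun k => Cmod (a n k) * r ^ k) K <= M n) /\
    forall w, Cmod w <= r -> cseries (fun k => a n k * w ^ k)%C (f n (c + w)%C).
  by rewrite /a; case: (constructive_indefinite_description _ _).
have p0 n k : 0 <= Cmod (a n k) * r ^ k.
  by apply: Rmult_le_pos; [exact: Cmod_ge_0 | apply: pow_le; lra].
have rk k : 0 < r ^ k by apply: pow_lt.
have exb k : exists b, cseries (fun n => a n k) b.
  apply: (cseries_ex _ (fun n => / r ^ k * M n)).
    move=> n; have := sum_n_ge_term _ k k (p0 n) (leqnn k).
    have := proj1 (aP n) k => h1 h2; have h3 := Rle_trans _ _ _ h2 h1.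
    apply: (Rmult_le_reg_r (r ^ k)) => //.
    have -> : / r ^ k * M n * r ^ k = M n by field; have := rk k; lra.
    exact: h3.
  exact: (@ex_series_scal R_AbsRing R_NormedModule).
pose b k := sval (constructive_indefinite_description _ (exb k)).
have bP k : cseries (fun n => a n k) (b k).
  by rewrite /b; case: (constructive_indefinite_description _ _).
exists b; split.
- move=> K.
  have key k : is_lim_seq (fun N => Cmod (csum (fun n => a n k) N) * r ^ k) (Cmod (b k) * r ^ k).
    apply: is_lim_seq_mult'; last exact: is_lim_seq_const.
    apply/is_lim_seq_spec => e; have /cseries_clim h := bP k.
    have [N hN] := h e (cond_pos e); exists N => n /leP /hN h1.
    apply: Rle_lt_trans h1.
    have t1 := Cmod_triangle (csum (a^~ k) n - b k) (b k).
    have t2 := Cmod_triangle (b k - csum (a^~ k) n) (csum (a^~ k) n).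
    have cancel (u v : C) : (u - v + v)%C = u by ring.
    rewrite cancel in t1; rewrite cancel in t2.
    rewrite Cmod_minus_sym in t2; apply: Rabs_le; lra.
  have lim K' : is_lim_seq (fun N => sum_n (fun k => Cmod (csum (fun n => a n k) N) * r ^ k) K')
      (sum_n (fun k => Cmod (b k) * r ^ k) K').
    elim: K' => [|K' IH].
      by rewrite sum_O; apply: is_lim_seq_ext (key 0%N) => N; rewrite sum_O.
    rewrite sum_Sn; apply: (is_lim_seq_ext (fun N =>
      sum_n (fun k => Cmod (csum (fun n => a n k) N) * r ^ k) K'
      + Cmod (csum (fun n => a n K'.+1) N) * r ^ K'.+1)).
      by move=> N; rewrite sum_Sn.
    exact: is_lim_seq_plus'.
  apply: (is_lim_seq_le _ _ _ _ _ (lim K) (is_lim_seq_const (Series M))) => N.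
  apply: Rle_trans (sum_n_le_Series M N M0 exM).
  apply: (Rle_trans _ (sum_n (fun k => sum_n (fun n => Cmod (a n k) * r ^ k) N) K)).
    apply: sum_n_le_compat => k; rewrite (sum_n_ext _ (fun n => mult (Cmod (a n k)) (r ^ k))) //.
    rewrite sum_n_mult_r; apply: Rmult_le_compat_r; first by have := rk k; lra.
    exact: csum_Cmod.
  rewrite sum_n_switch; apply: sum_n_le_compat => n; exact: (proj1 (aP n)).
- move=> w wr.
  apply: (cseries_fubini (fun n k => a n k * w ^ k)%C (fun n => f n (c + w)%C) _ M).
  + move=> n K; apply: Rle_trans (proj1 (aP n) K).
    by apply: sum_n_le_compat => k; apply: wiener_term_le.
  + exact: exM.
  + by move=> n; apply: (proj2 (aP n)).
  + move=> k; rewrite Cmult_comm; apply: (cseries_ext (fun n => w ^ k * a n k)%C).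
      by move=> n; rewrite Cmult_comm.
    exact: cseries_scal.
  + exact: hF.
Qed.

Lemma wiener_scal (l c : C) (r M : R) (f : C -> C) : wiener c r M f ->
  wiener c r (Cmod l * M) (fun s => l * f s)%C.
Proof.
move=> [a [h1 h2]]; exists (fun k => l * a k)%C; split=> [K|w wr].
  rewrite (sum_n_ext _ (fun k => mult (Cmod l) (Cmod (a k) * r ^ k))); last first.
    move=> k; have E : Cmod l * Cmod (a k) * r ^ k = Cmod l * (Cmod (a k) * r ^ k) by ring.
    by rewrite Cmod_mult; exact: E.
  by rewrite sum_n_mult_l; apply: Rmult_le_compat_l; [exact: Cmod_ge_0 | exact: h1].
apply: (cseries_ext (fun k => l * (a k * w ^ k))%C); first by move=> n; ring.
by apply: cseries_scal; apply: h2.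
Qed.

Lemma wiener_plus (c : C) (r M N : R) (f g : C -> C) : 0 <= r ->
  wiener c r M f -> wiener c r N g ->
  wiener c r (M + N) (fun s => f s + g s)%C.
Proof.
move=> r0 [a [h1 h2]] [b [h3 h4]]; exists (fun k => a k + b k)%C; split=> [K|w wr].
  apply: (Rle_trans _ (sum_n (fun k => plus (Cmod (a k) * r ^ k) (Cmod (b k) * r ^ k)) K)).
    apply: sum_n_le_compat => k; rewrite /plus /= -Rmult_plus_distr_r.
    by apply: Rmult_le_compat_r; [exact: pow_le | exact: Cmod_triangle].
  by rewrite sum_n_plus; apply: Rplus_le_compat.
apply: (cseries_ext (fun k => a k * w ^ k + b k * w ^ k)%C); first by move=> n; ring.
by apply: cseries_plus; [exact: h2 | exact: h4].
Qed.

Lemma cseries_decr (a : nat -> C) (l : C) : a 0%N = RtoC 0 ->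
  cseries (fun k => a k.+1) l -> cseries a l.
Proof.
move=> a0 h; apply: (@is_series_decr_1 C_AbsRing C_NormedModule).
have -> : @plus C_NormedModule l (opp (a 0%N)) = l; last exact: h.
have E : (l + - RtoC 0 = l)%C by ring.
rewrite a0; exact: E.
Qed.

Lemma cseries_incr (a : nat -> C) (l : C) :
  cseries a l -> cseries (fun k => a k.+1) (l - a 0%N)%C.
Proof.
move=> h; apply: (@is_series_incr_1 C_AbsRing C_NormedModule).
have -> : @plus C_NormedModule (l - a 0%N)%C (a 0%N) = l; last exact: h.
have E : (l - a 0%N + a 0%N = l)%C by ring.
exact: E.
Qed.

Lemma wiener_shift (c : C) (r M : R) (f : C -> C) : 0 <= r -> wiener c r M f ->
  wiener c r (r * M) (fun s => (s - c) * f s)%C.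
Proof.
move=> r0 W; have M0 := wiener_ge0 _ _ _ _ W; move: W => [a [h1 h2]].
exists (fun k => if k is j.+1 then a j else RtoC 0); split=> [[|K]|w wr].
- by rewrite sum_O Cmod_0; nra.
- have -> : sum_n (fun k => Cmod (if k is j.+1 then a j else RtoC 0) * r ^ k) K.+1
     = r * sum_n (fun k => Cmod (a k) * r ^ k) K.
    elim: K => [|K IH]; first by rewrite sum_Sn !sum_O Cmod_0 /plus /=; ring.
    by rewrite sum_Sn IH [in RHS]sum_Sn /plus /=; ring.
  exact: Rmult_le_compat_l.
apply: cseries_decr; first by ring.
have -> : (c + w - c = w)%C by ring.
apply: (cseries_ext (fun k => w * (a k * w ^ k))%C); first by move=> n; rewrite Cpow_S; ring.
by apply: cseries_scal; apply: h2.
Qed.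

Lemma wiener_const (c l : C) (r : R) : wiener c r (Cmod l) (fun _ => l).
Proof.
exists (fun k => if k is j.+1 then RtoC 0 else l); split=> [K|w wr].
  elim: K => [|K IH]; first by rewrite sum_O /=; lra.
  by rewrite sum_Sn Cmod_0 /plus /=; lra.
apply/cseries_clim; apply: (clim_ext (fun _ => l)); last exact: clim_const.
elim=> [|n IH]; first by rewrite csum0 /=; ring.
by rewrite csumS -IH; ring.
Qed.

Lemma wiener_aff (c l : C) (r : R) : 0 <= r ->
  wiener c r (Cmod (l + c)%C + r) (fun s => l + s)%C.
Proof.
move=> r0; have h := wiener_shift c r _ _ r0 (wiener_const c (RtoC 1) r).
have := wiener_plus c r _ _ _ _ r0 (wiener_const c (l + c)%C r) h.
rewrite Cmod_1 Rmult_1_r; apply: wiener_ext => w _; ring.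
Qed.

Lemma wiener_mulpow (c : C) (r M : R) (f : C -> C) (j : nat) : 0 <= r ->
  wiener c r M f -> wiener c r (r ^ j * M) (fun s => (s - c) ^ j * f s)%C.
Proof.
move=> r0 W; elim: j => [|j IH].
  rewrite [r ^ 0]/= Rmult_1_l; apply: (wiener_ext _ _ _ _ _ _ W) => w _.
  by rewrite -[(_ ^ 0)%C]/(RtoC 1); ring.
have := wiener_shift _ _ _ _ r0 IH; rewrite -Rmult_assoc.
by apply: wiener_ext => w _; rewrite Cpow_S; ring.
Qed.

(** Expands only [g]: the product is the sum of the [b j (s - c)^j f(s)], and multiplication by
    [s - c] scales the norm bound by [r]. Thus [wiener_series] applies and no Cauchy product is
    formed. *)
Lemma wiener_mult (c : C) (r M N : R) (f g : C -> C) : 0 < r ->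
  wiener c r M f -> wiener c r N g -> wiener c r (M * N) (fun s => f s * g s)%C.
Proof.
move=> r0 Wf Wg; have M0 := wiener_ge0 _ _ _ _ Wf.
move: (Wg) => [b [h1 h2]].
have p0 k : 0 <= Cmod (b k) * r ^ k.
  by apply: Rmult_le_pos; [exact: Cmod_ge_0 | apply: pow_le; lra].
have [ex1 le1] := bounded_series _ _ p0 h1.
pose Mj j := Cmod (b j) * (r ^ j * M).
have MjE j : Mj j = M * (Cmod (b j) * r ^ j) by rewrite /Mj; ring.
have exM : ex_series Mj.
  apply: (ex_series_ext (fun j => M * (Cmod (b j) * r ^ j))); first by move=> j; rewrite MjE.
  exact: (@ex_series_scal R_AbsRing R_NormedModule).
apply: (wiener_le _ _ (Series Mj)).
  by rewrite (Series_ext _ _ MjE) Series_scal_l; apply: Rmult_le_compat_l.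
apply: (wiener_series _ _ _ (fun j s => b j * ((s - c) ^ j * f s))%C) => // [j|w wr].
  by apply: wiener_scal; apply: wiener_mulpow => //; lra.
apply: (cseries_ext (fun j => f (c + w) * (b j * w ^ j))%C).
  move=> j; have -> : (c + w - c = w)%C by ring.
  by ring.
by apply: cseries_scal; apply: h2.
Qed.

Lemma wiener_pow (c : C) (r M : R) (u : C -> C) (k : nat) : 0 < r ->
  wiener c r M u -> wiener c r (M ^ k) (fun s => u s ^ k)%C.
Proof.
move=> r0 W; elim: k => [|k IH].
  by have := wiener_const c (RtoC 1) r; rewrite Cmod_1.
exact: (wiener_mult _ _ _ _ _ _ r0 W IH).
Qed.

Lemma exp_series (x : R) : is_series (fun k => / INR (fact k) * x ^ k) (exp x).
Proof.
by apply: is_series_ext (is_exp_Reals x) => n; rewrite /scal /= /mult /= pow_n_pow; ring.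
Qed.

Lemma wiener_exp (c : C) (r M : R) (u : C -> C) : 0 < r ->
  wiener c r M u -> wiener c r (exp M) (fun s => Cexp (u s)).
Proof.
move=> r0 W; rewrite -(is_series_unique _ _ (exp_series M)).
apply: (wiener_series _ _ _ (fun k s => RtoC (/ INR (fact k)) * u s ^ k)%C) => // [k||w wr].
- have f0 : 0 < / INR (fact k) by apply: Rinv_0_lt_compat; apply: INR_fact_gt0.
  rewrite -{1}(Rabs_pos_eq (/ INR (fact k))); last by lra.
  by rewrite -Cmod_R; apply: wiener_scal; apply: wiener_pow.
- by eexists; apply: exp_series.
- by apply: (cseries_ext _ _ _ _ (cexp_series _)) => k; ring.
Qed.

(** The terms from order 2 on, with [1 / (k + 2)! <= 1 / k!]. The factor [M^2] is the gain when [u]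
    is of size [1 / n]. *)
Lemma wiener_exp2 (c : C) (r M : R) (u : C -> C) : 0 < r -> wiener c r M u ->
  wiener c r (M ^ 2 * exp M) (fun s => Cexp (u s) - RtoC 1 - u s)%C.
Proof.
move=> r0 W; have M0 := wiener_ge0 _ _ _ _ W.
pose Mk k := / INR (fact k.+2) * M ^ k.+2.
have f0 k : 0 < / INR (fact k) by apply: Rinv_0_lt_compat; apply: INR_fact_gt0.
have Mk0 k : 0 <= Mk k.
  by apply: Rmult_le_pos; [have := f0 k.+2; lra | exact: pow_le].
have MkB k : Mk k <= M ^ 2 * (/ INR (fact k) * M ^ k).
  have -> : M ^ 2 * (/ INR (fact k) * M ^ k) = / INR (fact k) * M ^ k.+2 by simpl; ring.
  apply: Rmult_le_compat_r; first exact: pow_le.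
  apply: Rinv_le_contravar; first exact: INR_fact_gt0.
  by apply: le_INR; apply: fact_le; lia.
have exM : ex_series (fun k => M ^ 2 * (/ INR (fact k) * M ^ k)).
  by apply: (@ex_series_scal R_AbsRing R_NormedModule); eexists; apply: exp_series.
have exMk : ex_series Mk.
  apply: (@ex_series_le R_AbsRing R_CompleteNormedModule _ _ _ exM) => k.
  by rewrite /norm /= /abs /= Rabs_pos_eq.
apply: (wiener_le _ _ (Series Mk)).
  rewrite -(is_series_unique _ _ (exp_series M)) -Series_scal_l.
  by apply: Series_le => // k.
apply: (wiener_series _ _ _ (fun k s => RtoC (/ INR (fact k.+2)) * u s ^ k.+2)%C) => // [k|w wr].
  rewrite /Mk -{1}(Rabs_pos_eq (/ INR (fact k.+2))); last by have := f0 k.+2; lra.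
  by rewrite -Cmod_R; apply: wiener_scal; apply: wiener_pow.
have h := cseries_incr _ _ (cseries_incr _ _ (cexp_series (u (c + w)%C))).
have e : (Cexp (u (c + w)) - u (c + w) ^ 0 * RtoC (/ INR (fact 0))
   - u (c + w) ^ 1 * RtoC (/ INR (fact 1)) = Cexp (u (c + w)) - RtoC 1 - u (c + w))%C.
  by rewrite /= Rinv_1; ring.
rewrite e in h; apply: (cseries_ext _ _ _ _ h) => k; ring.
Qed.

Lemma cgeom_series (v : C) : Cmod v < 1 -> cseries (fun k => v ^ k)%C (/ (RtoC 1 - v))%C.
Proof.
move=> v1; have v0 := Cmod_ge_0 v.
have d : (RtoC 1 - v)%C <> RtoC 0.
  move=> e; have E : v = (RtoC 1 - (RtoC 1 - v))%C by ring.
  have ev : v = RtoC 1 by rewrite E e; ring.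
  by rewrite ev Cmod_1 in v1; lra.
apply/cseries_clim.
apply: (clim_ext (fun n => / (RtoC 1 - v) - / (RtoC 1 - v) * v ^ n.+1)%C).
  elim=> [|n IH]; first by rewrite csum0 /=; field.
  by rewrite csumS -IH !Cpow_S; field.
have E : (/ (RtoC 1 - v) = / (RtoC 1 - v) - / (RtoC 1 - v) * RtoC 0)%C by ring.
rewrite [X in clim _ X]E; apply: clim_minus; first exact: clim_const.
apply: clim_scal => e e0.
have := is_lim_seq_geom (Cmod v); rewrite Rabs_pos_eq // => /(_ v1).
move/is_lim_seq_spec => /(_ (mkposreal e e0)) [N hN].
exists N => n Nn; have -> : (v ^ n.+1 - RtoC 0 = v ^ n.+1)%C by ring.
rewrite Cmod_pow; have := hN n.+1 ltac:(lia); rewrite Rminus_0_r /= => h.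
exact: Rle_lt_trans (Rle_abs _) h.
Qed.

(** Geometric series around [c] in [-(s - c) / d], with [d = c - 1], whose norm is at most
    [r / |d| < 1]. *)
Lemma wiener_inv (c : C) (r : R) : c <> RtoC 1 -> 0 < r < Cmod (c - RtoC 1)%C ->
  exists M, wiener c r M (fun s => / (s - RtoC 1))%C.
Proof.
move=> c1 [r0 rc]; set d := (c - RtoC 1)%C in rc *.
have d0 : d <> RtoC 0.
  move=> e; apply: c1; have E : c = (d + RtoC 1)%C by rewrite /d; ring.
  by rewrite E e; ring.
have id0 : 0 < / Cmod d by apply: Rinv_0_lt_compat; lra.
pose rho := / Cmod d * (r * 1).
have Wv : wiener c r rho (fun s => - / d * ((s - c) * RtoC 1))%C.
  have := wiener_scal (- / d)%C _ _ _ _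
    (wiener_shift c r _ _ (Rlt_le _ _ r0) (wiener_const c (RtoC 1) r)).
  by rewrite Cmod_opp Cmod_inv // Cmod_1.
have rho1 : 0 <= rho < 1.
  split; first exact: wiener_ge0 Wv.
  by rewrite /rho Rmult_1_r Rmult_comm; apply/Rlt_div_l; lra.
exists (Cmod (/ d)%C * Series (fun k => rho ^ k)).
apply: (wiener_ext _ _ _ (fun s => / d * / (RtoC 1 - (- / d * ((s - c) * RtoC 1))))%C).
  move=> w wr.
  have nz : (d + w)%C <> RtoC 0.
    move=> e; have E : d = (d + w - w)%C by ring.
    have ew : d = (- w)%C by rewrite E e; ring.
    by move: rc; rewrite ew Cmod_opp; lra.
  have -> : (c + w - RtoC 1 = d + w)%C by rewrite /d; ring.
  have -> : (c + w - c = w)%C by ring.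
  have -> : (RtoC 1 - - / d * (w * RtoC 1) = (d + w) / d)%C by field.
  by field; split.
apply: wiener_scal.
apply: (wiener_series _ _ _ (fun k s => (- / d * ((s - c) * RtoC 1)) ^ k)%C) => // [k||w wr].
- exact: wiener_pow.
- by apply: ex_series_geom; rewrite Rabs_pos_eq; lra.
- apply: cgeom_series.
  by apply: Rle_lt_trans (wiener_bound _ _ _ _ w Wv wr) _; lra.
Qed.

Lemma wiener_analytic (c : C) (r M : R) (f : C -> C) : 0 < r -> wiener c r M f ->
  analytic_at f c.
Proof.
move=> r0 [a [_ h]]; exists a, (mkposreal r r0) => z /= zr.
have := h (z - c)%C (Rlt_le _ _ zr).
have -> : (c + (z - c) = z)%C by ring.
by apply: cseries_ext => n; rewrite Cmult_comm.
Qed.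

(** Rewriting with sums leaves equalities typed in an algebraic structure over [C]; they are
    restated in [C] itself before [ring]. *)
Ltac cring := match goal with |- @eq _ ?a ?b => change (@eq C a b); ring end.

(** * Construction of the continuation *)

Lemma Re_scal_R (z : C) (x : R) : Re (z * RtoC x)%C = Re z * x.
Proof. by case: z => a b; rewrite /Re /=; ring. Qed.

Definition zeta_incr (s : C) (n : nat) : C :=
  ((s - RtoC 1) * dirichlet_term s n.+1
   + (Cexp ((RtoC 1 - s) * RtoC (ln (INR n.+2)))
      - Cexp ((RtoC 1 - s) * RtoC (ln (INR n.+1)))))%C.

Lemma ln_step (x : R) : 0 < x ->
  / (x + 1) <= ln (x + 1) - ln x <= / x.
Proof.
move=> x0.
have i0 : 0 < / x by apply: Rinv_0_lt_compat.
have i1 : 0 < / (x + 1) by apply: Rinv_0_lt_compat; lra.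
have lnle y : 0 < y -> ln y <= y - 1.
  by move=> y0; have := exp_ineq1_le (ln y); rewrite exp_ln //; lra.
split.
  have h := lnle (x / (x + 1)) ltac:(apply: Rdiv_lt_0_compat; lra).
  rewrite ln_div in h; [|lra..].
  have : x / (x + 1) - 1 = - / (x + 1) by field; lra.
  lra.
have h := lnle ((x + 1) / x) ltac:(apply: Rdiv_lt_0_compat; lra).
rewrite ln_div in h; [|lra..].
have : (x + 1) / x - 1 = / x by field; lra.
lra.
Qed.

(** With [L] the logarithm of the base, the term is its value at [c] times [exp(-L (s - c))], whose
    norm is at most [exp(L r)]. The bound is the value at the leftmost point of the disc, so nothing
    is lost against the supremum. *)
Lemma dirichlet_wiener (c : C) (r : R) (n : nat) : 0 < r ->
  wiener c r (Rpower (INR n.+1) (- (Re c - r))) (fun s => dirichlet_term s n.+1).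
Proof.
move=> r0; have x1 := INR_ge1 n.+1 isT.
set L := ln (INR n.+1).
have L0 : 0 <= L by apply: ln_nonneg.
have W := wiener_scal (Cexp (- c * RtoC L)%C) _ _ _ _
  (wiener_exp c r _ _ r0 (wiener_scal (RtoC (- L)) _ _ _ _
    (wiener_shift c r _ _ (Rlt_le _ _ r0) (wiener_const c (RtoC 1) r)))).
rewrite Cmod_Cexp Cmod_1 Cmod_R Rabs_Ropp Rabs_pos_eq // -exp_plus Re_scal_R in W.
have -> : Rpower (INR n.+1) (- (Re c - r)) = exp (Re (- c)%C * L + L * (r * 1)).
  by rewrite /Rpower -/L; congr exp; case: c {W} => a b; rewrite /Re /=; ring.
apply: (wiener_ext _ _ _ _ _ _ W) => w _.
rewrite -Cexp_add /dirichlet_term -/L; congr Cexp.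
by rewrite RtoC_opp; ring.
Qed.

(** From [(x + 1)^(1-s) = x^(1-s) exp(d u)]. The first order part [x d u] nearly cancels
    [s - 1 = -u], leaving two terms of size [O(1 / x)], because [d] is within [O(1 / x^2)] of
    [1 / x]. *)
Lemma zeta_incr_factor (s : C) (n : nat) :
  let x := INR n.+1 in let d := ln (x + 1) - ln x in let u := (RtoC 1 - s)%C in
  zeta_incr s n = (dirichlet_term s n.+1 *
    (RtoC x * (Cexp (RtoC d * u) - RtoC 1 - RtoC d * u) + RtoC (x * d - 1) * u))%C.
Proof.
move=> x d u; have x1 : 1 <= x by apply: INR_ge1.
rewrite /zeta_incr /dirichlet_term -/x (_ : INR n.+2 = x + 1); last first.
  by rewrite (S_INR n.+1).
have e1 : Cexp ((RtoC 1 - s) * RtoC (ln x)) = (RtoC x * Cexp (- s * RtoC (ln x)))%C.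
  have -> : ((RtoC 1 - s) * RtoC (ln x) = RtoC (ln x) + - s * RtoC (ln x))%C by ring.
  by rewrite Cexp_add Cexp_RtoC exp_ln //; lra.
have e2 : Cexp ((RtoC 1 - s) * RtoC (ln (x + 1)))
   = (Cexp ((RtoC 1 - s) * RtoC (ln x)) * Cexp (RtoC d * u))%C.
  rewrite -Cexp_add; congr Cexp; rewrite /u /d RtoC_minus; ring.
rewrite e2 e1 /u RtoC_minus RtoC_mult; ring.
Qed.

(** The factor [1 / x] gained over the Dirichlet term moves the abscissa of convergence from 1 to
    0. *)
Lemma zeta_incr_wiener (c : C) (r : R) : 0 < r -> exists K, forall n,
  wiener c r (K * Rpower (INR n.+1) (- (1 + Re c - r))) (fun s => zeta_incr s n).
Proof.
move=> r0; pose U := Cmod (- (1) + c)%C + r.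
have U0 : 0 < U by rewrite /U; have := Cmod_ge_0 (- (1) + c)%C; lra.
exists (U ^ 2 * exp U + U) => n; set x := INR n.+1.
have x1 : 1 <= x by apply: INR_ge1.
pose d := ln (x + 1) - ln x.
have [d1 d2] := ln_step x ltac:(lra); rewrite -/d in d1 d2.
have ix : 0 < / x by apply: Rinv_0_lt_compat; lra.
have ix1 : 0 < / (x + 1) by apply: Rinv_0_lt_compat; lra.
have xi : x * / x = 1 by field; lra.
have Wu : wiener c r U (fun s => RtoC 1 - s)%C.
  have := wiener_scal (- (1))%C _ _ _ _ (wiener_aff c (- (1))%C r (Rlt_le _ _ r0)).
  rewrite Cmod_m1 Rmult_1_l; apply: wiener_ext => w _; ring.
have Wdu := wiener_scal (RtoC d) _ _ _ _ Wu.
rewrite Cmod_R Rabs_pos_eq in Wdu; last by lra.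
have W1 := wiener_scal (RtoC x) _ _ _ _ (wiener_exp2 _ _ _ _ r0 Wdu).
have W2 := wiener_scal (RtoC (x * d - 1)) _ _ _ _ Wu.
have W := wiener_mult _ _ _ _ _ _ r0 (dirichlet_wiener c r n r0)
  (wiener_plus _ _ _ _ _ _ (Rlt_le _ _ r0) W1 W2).
apply: (wiener_ext _ _ _ _ _ _ (wiener_le _ _ _ _ _ _ W)).
  by move=> w _; rewrite zeta_incr_factor.
rewrite !Cmod_R (Rabs_pos_eq x) -/x; last by lra.
have -> : Rpower x (- (1 + Re c - r)) = Rpower x (- (Re c - r)) * / x.
  have -> : - (1 + Re c - r) = - (Re c - r) + - (1) by ring.
  by rewrite Rpower_plus [Rpower x (- (1))]Rpower_Ropp Rpower_1 //; lra.
have P := Rpower_pos x (- (Re c - r)).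
have b2 : Rabs (x * d - 1) <= / x.
  apply: Rabs_le.
  have : x * d <= x * / x by apply: Rmult_le_compat_l; lra.
  have : x * / (x + 1) <= x * d by apply: Rmult_le_compat_l; lra.
  have : x * / (x + 1) = 1 - / (x + 1) by field; lra.
  have : / (x + 1) <= / x by apply: Rinv_le_contravar; lra.
  lra.
have d3 : d <= 1 by apply: Rle_trans d2 _; rewrite -Rinv_1; apply: Rinv_le_contravar; lra.
have ex : exp (d * U) <= exp U by apply: exp_le; nra.
have e0 := exp_pos (d * U).
have b1 : x * ((d * U) ^ 2 * exp (d * U)) <= U ^ 2 * exp U * / x.
  have xd : x * d ^ 2 <= / x.
    have -> : x * d ^ 2 = x * d * d by ring.
    have : x * d <= 1 by rewrite -xi; apply: Rmult_le_compat_l; lra.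
    have : 0 <= d by lra.
    by nra.
  have -> : x * ((d * U) ^ 2 * exp (d * U)) = (x * d ^ 2) * (U ^ 2 * exp (d * U)) by ring.
  have -> : U ^ 2 * exp U * / x = / x * (U ^ 2 * exp U) by ring.
  have U2 : 0 <= U ^ 2 by apply: pow_le; lra.
  apply: Rmult_le_compat => //.
  - by apply: Rmult_le_pos; [lra | exact: pow2_ge_0].
  - by apply: Rmult_le_pos; lra.
  - exact: Rmult_le_compat_l.
have b3 : Rabs (x * d - 1) * U <= U * / x.
  by rewrite [U * _]Rmult_comm; apply: Rmult_le_compat_r; lra.
have -> : (U ^ 2 * exp U + U) * (Rpower x (- (Re c - r)) * / x)
  = Rpower x (- (Re c - r)) * (U ^ 2 * exp U * / x + U * / x) by ring.
apply: Rmult_le_compat_l; lra.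
Qed.

(** Chosen by [epsilon], so determined only where the series converges; [zeta_tailP] covers
    [Re s > 0]. *)
Definition zeta_tail (s : C) : C :=
  epsilon (inhabits (RtoC 0)) (fun l => cseries (zeta_incr s) l).

Lemma zeta_tailP (s : C) : 0 < Re s -> cseries (zeta_incr s) (zeta_tail s).
Proof.
move=> s0; apply: epsilon_spec.
have [K hK] := zeta_incr_wiener s (Re s / 2) ltac:(lra).
apply: (cseries_ex _ (fun n => K * Rpower (INR n.+1) (- (1 + Re s - Re s / 2)))).
  move=> n; have := wiener_bound _ _ _ _ (RtoC 0) (hK n).
  have -> : (s + RtoC 0 = s)%C by ring.
  by rewrite Cmod_0; apply; lra.
apply: (@ex_series_scal R_AbsRing R_NormedModule).
by apply: ex_series_Rpower; lra.
Qed.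

Lemma Re_plus_gt0 (c w : C) (r : R) : Cmod w <= r -> r < Re c -> 0 < Re (c + w)%C.
Proof.
move=> wr rc; have := re_le_Cmod w; have -> : Re (c + w)%C = Re c + Re w by [].
by move=> h; have := Rabs_le_between (Re w) (Cmod w); move=> [/(_ h) [h1 h2] _]; lra.
Qed.

Definition zetaF (s : C) : C := ((RtoC 1 + zeta_tail s) * / (s - RtoC 1))%C.

Lemma zetaF_analytic (s : C) : 0 < Re s -> s <> RtoC 1 -> analytic_at zetaF s.
Proof.
move=> s0 s1.
have m0 : 0 < Cmod (s - RtoC 1)%C.
  apply/Cmod_gt_0 => e; apply: s1.
  have E : s = (s - RtoC 1 + RtoC 1)%C by ring.
  by rewrite E e; ring.
(* The disc must stay in the half-plane, where the increments are summable, and away from the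
   pole. *)
pose r := Rmin (Re s) (Cmod (s - RtoC 1)%C) / 2.
have ra := Rmin_l (Re s) (Cmod (s - RtoC 1)%C).
have rb := Rmin_r (Re s) (Cmod (s - RtoC 1)%C).
have r0 : 0 < r by rewrite /r; have := Rmin_glb_lt _ _ 0 s0 m0; lra.
have rs : r < Re s by rewrite /r; lra.
have [K hK] := zeta_incr_wiener s r r0.
have Wt : wiener s r (Series (fun n => K * Rpower (INR n.+1) (- (1 + Re s - r)))) zeta_tail.
  apply: (wiener_series _ _ _ (fun n s => zeta_incr s n)) => // [|w wr].
    apply: (@ex_series_scal R_AbsRing R_NormedModule).
    by apply: ex_series_Rpower; lra.
  by apply: zeta_tailP; apply: Re_plus_gt0 wr rs.
have [M Wi] := wiener_inv s r s1 ltac:(split => //; rewrite /r; lra).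
apply: (wiener_analytic _ _ _ _ r0 (wiener_mult _ _ _ _ _ _ r0
  (wiener_plus _ _ _ _ _ _ (Rlt_le _ _ r0) (wiener_const s (RtoC 1) r) Wt) Wi)).
Qed.

Lemma zeta_incr_sum (s : C) (N : nat) :
  csum (zeta_incr s) N = ((s - RtoC 1) * csum (fun n => dirichlet_term s n.+1) N
     + Cexp ((RtoC 1 - s) * RtoC (ln (INR N.+2))) - RtoC 1)%C.
Proof.
elim: N => [|N IH].
  rewrite !csum0 /zeta_incr [INR 1]/= ln_1.
  have -> : ((RtoC 1 - s) * RtoC 0 = RtoC 0)%C by ring.
  by rewrite Cexp_0; cring.
by rewrite !csumS IH /zeta_incr; cring.
Qed.

(** In the telescoped identity [zeta_incr_sum] the boundary term has modulus [N^(1 - Re s)], which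
    tends to 0 here. *)
Lemma zetaF_dirichlet (s : C) : 1 < Re s ->
  cseries (fun n => dirichlet_term s n.+1) (zetaF s).
Proof.
move=> s1; have s0 : 0 < Re s by lra.
have d : (s - RtoC 1)%C <> RtoC 0.
  move=> e; have E : s = (s - RtoC 1 + RtoC 1)%C by ring.
  by move: s1; rewrite E e /Re /=; lra.
have /cseries_clim h := zeta_tailP s s0.
apply/cseries_clim.
pose v N := Cexp ((RtoC 1 - s) * RtoC (ln (INR N.+2))).
have v0 : clim v (RtoC 0).
  move=> e e0.
  have /is_lim_seq_spec lim := Rpower_neg_lim (Re s - 1) ltac:(lra).
  have [N hN] := lim (mkposreal e e0); exists N => n Nn.
  have -> : (v n - RtoC 0 = v n)%C by ring.
  rewrite /v Cmod_Cexp Re_scal_R.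
  have := hN n.+1 ltac:(lia); rewrite Rminus_0_r [pos _]/= => h1.
  apply: Rle_lt_trans h1; apply: Rle_trans (Rle_abs _); apply: Req_le.
  rewrite /Rpower; congr exp; have -> : Re (RtoC 1 - s)%C = 1 - Re s by [].
  by ring.
apply: (clim_ext (fun N => / (s - RtoC 1) * ((RtoC 1 + csum (zeta_incr s) N) - v N))%C).
  by move=> n; rewrite zeta_incr_sum /v; field.
have -> : zetaF s = (/ (s - RtoC 1) * ((RtoC 1 + zeta_tail s) - RtoC 0))%C.
  by rewrite /zetaF; ring.
apply: clim_scal; apply: clim_minus => //.
by apply: clim_plus => //; apply: clim_const.
Qed.

Lemma zetaF_is_zeta : is_riemann_zeta zetaF.
Proof. split=> s; [exact: zetaF_dirichlet | exact: zetaF_analytic]. Qed.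

Lemma dirichlet_term_R (s : R) (n : nat) : (0 < n)%N ->
  dirichlet_term (RtoC s) n = RtoC (Rpower (INR n) (- s)).
Proof.
by move=> n0; rewrite /dirichlet_term -RtoC_opp -RtoC_mult Cexp_RtoC.
Qed.

(** For real [s] the partial sums in [zeta_incr_sum], increased by 1 and divided by [s - 1], are the
    Euler-Maclaurin expressions up to a term [N^-s], so the two limits agree. *)
Lemma zetaF_real (s L : R) : 0 < s -> s <> 1 ->
  is_lim_seq (fun A => \big[Rplus/0]_(1 <= a < A.+2) Rpower (INR a) (- s)
                          - Rpower (INR A.+1) (1 - s) / (1 - s)) L ->
  Re (zetaF (RtoC s)) = L.
Proof.
move=> s0 s1 hL.
have /cseries_clim h := zeta_tailP (RtoC s) s0.
have hr := clim_Re _ _ h.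
have ps N : csum (fun n => dirichlet_term (RtoC s) n.+1) N
   = RtoC (\big[Rplus/0]_(1 <= a < N.+2) Rpower (INR a) (- s)).
  elim: N => [|N IH]; first by rewrite csum0 big_nat1 dirichlet_term_R.
  rewrite csumS IH dirichlet_term_R // (big_nat_recr N.+2) //.
  by rewrite RtoC_plus.
have E N : \big[Rplus/0]_(1 <= a < N.+3) Rpower (INR a) (- s)
      - Rpower (INR N.+2) (1 - s) / (1 - s)
   = / (s - 1) * (1 + Re (csum (zeta_incr (RtoC s)) N)) + Rpower (INR N.+2) (- s).
  have -> : csum (zeta_incr (RtoC s)) N =
      RtoC ((s - 1) * \big[Rplus/0]_(1 <= a < N.+2) Rpower (INR a) (- s)
        + Rpower (INR N.+2) (1 - s) - 1).
    rewrite zeta_incr_sum ps -!RtoC_minus -!RtoC_mult Cexp_RtoC.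
    by rewrite RtoC_minus RtoC_plus.
  have -> x : Re (RtoC x) = x by [].
  rewrite (big_nat_recr N.+2) //.
  move: (Rpower _ _) (Rpower _ _) (\big[_/_]_(_ <- _) _) => u v w /=.
  by field; lra.
have lim2 : is_lim_seq (fun A => \big[Rplus/0]_(1 <= a < A.+3) Rpower (INR a) (- s)
    - Rpower (INR A.+2) (1 - s) / (1 - s)) (/ (s - 1) * (1 + Re (zeta_tail (RtoC s))) + 0).
  apply: (is_lim_seq_ext (fun N => / (s - 1) * (1 + Re (csum (zeta_incr (RtoC s)) N))
     + Rpower (INR N.+2) (- s))); first by move=> n; rewrite E.
  apply: is_lim_seq_plus'.
    apply: is_lim_seq_mult'; first exact: is_lim_seq_const.
    by apply: is_lim_seq_plus' => //; apply: is_lim_seq_const.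
  by have := Rpower_neg_lim s s0; move/is_lim_seq_incr_1.
move/is_lim_seq_incr_1 in hL.
have e := is_lim_seq_unique _ _ lim2; rewrite (is_lim_seq_unique _ _ hL) in e.
have {e} e : L = / (s - 1) * (1 + Re (zeta_tail (RtoC s))) + 0 by injection e.
have zE : zetaF (RtoC s) = ((RtoC 1 + zeta_tail (RtoC s)) * RtoC (/ (s - 1)))%C.
  by rewrite /zetaF -RtoC_minus RtoC_inv //; lra.
rewrite e zE Re_scal_R.
have -> : Re (RtoC 1 + zeta_tail (RtoC s))%C = 1 + Re (zeta_tail (RtoC s)) by [].
by ring.
Qed.

(** * Uniqueness of the continuation at 1/3 *)

Lemma clim_bounded (u : nat -> C) (l : C) : clim u l ->
  exists B, 0 < B /\ forall n, Cmod (u n) <= B.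
Proof.
move=> h; have [N hN] := h 1 Rlt_0_1.
have fin M : exists B, 0 < B /\ forall n, (n < M)%N -> Cmod (u n) <= B.
  elim: M => [|M [B [B0 hB]]]; first by exists 1; split; [lra|].
  exists (B + Cmod (u M)); have := Cmod_ge_0 (u M) => p; split; first by lra.
  by move=> n; rewrite ltnS leq_eqVlt => /orP[/eqP ->|/hB]; lra.
have [B [B0 hB]] := fin N.
exists (B + (1 + Cmod l)); have p := Cmod_ge_0 l; split; first by lra.
move=> n; case: (ltnP n N) => [/hB|/hN h1]; first by lra.
have := Cmod_triangle (u n - l) l.
have -> : (u n - l + l = u n)%C by ring.
lra.
Qed.

Lemma cseries_terms_bounded (a : nat -> C) (l : C) : cseries a l ->
  exists B, 0 < B /\ forall n, Cmod (a n) <= B.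
Proof.
move=> /cseries_clim /clim_bounded [B [B0 hB]]; exists (2 * B); split; first by lra.
case=> [|n]; first by have := hB 0%N; rewrite csum0; lra.
have := Cmod_triangle (csum a n.+1) (- csum a n); rewrite Cmod_opp.
have -> : (csum a n.+1 + - csum a n = a n.+1)%C by rewrite csumS; cring.
have := hB n; have := hB n.+1; lra.
Qed.

(** Isolation of zeros: at a zero [w] near 0 the first nonzero term [a m * w^m] would have to be
    balanced by the later terms, which are of order [|w|^(m+1)]. *)
Lemma pseries_coef_eq0 (a : nat -> C) (r : R) (D : C -> C) : 0 < r ->
  (forall w, Cmod w < r -> cseries (fun k => a k * w ^ k)%C (D w)) ->
  (forall e, 0 < e -> exists w, [/\ w <> RtoC 0, Cmod w < e & D w = RtoC 0]) ->
  forall m, a m = RtoC 0.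
Proof.
move=> r0 hD hz.
pose rho := r / 2.
have rho0 : 0 < rho by rewrite /rho; lra.
have rhoC : Cmod (RtoC rho) = rho by rewrite Cmod_R Rabs_pos_eq; lra.
have [B [B0 hB]] := cseries_terms_bounded _ _ (hD (RtoC rho) ltac:(rewrite rhoC /rho; lra)).
have aB k : Cmod (a k) * rho ^ k <= B.
  by have := hB k; rewrite Cmod_mult Cmod_pow rhoC.
move=> m; have [k] := ubnP m; elim: k m => // k IH m mk.
apply: NNPP => /Cmod_gt_0 am.
have rm : 0 < rho ^ m.+1 by apply: pow_lt.
(* The first bound gives [q <= 1/2], so the terms after [m] add up to at most [2 B q^(m+1)]. The
   second contradicts the resulting inequality [|a m| rho^(m+1) <= 2 B |w|]. *)
pose e := Rmin (rho / 2) (Cmod (a m) * rho ^ m.+1 / (2 * B)).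
have e1 := Rmin_l (rho / 2) (Cmod (a m) * rho ^ m.+1 / (2 * B)).
have e2 := Rmin_r (rho / 2) (Cmod (a m) * rho ^ m.+1 / (2 * B)).
have p2 : 0 < Cmod (a m) * rho ^ m.+1 / (2 * B).
  by apply: Rdiv_lt_0_compat; [apply: Rmult_lt_0_compat | lra].
have e0 : 0 < e by apply: Rmin_glb_lt; lra.
have [w [/Cmod_gt_0 w0 we Dw]] := hz e e0; rewrite -/e in e1 e2.
have q0 : 0 < Cmod w / rho by apply: Rdiv_lt_0_compat.
have q2 : Cmod w / rho <= 1 / 2 by apply/Rle_div_l => //; lra.
set q := Cmod w / rho in q0 q2.
have wE : Cmod w = q * rho by rewrite /q; field; lra.
have qm : 0 < q ^ m.+1 by apply: pow_lt.
have /cseries_clim lim := hD w ltac:(rewrite /rho in e1; lra).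
rewrite Dw in lim.
have term j : Cmod (a j * w ^ j)%C <= B * q ^ j.
  rewrite Cmod_mult Cmod_pow wE Rpow_mult_distr.
  have := aB j; have : 0 <= q ^ j by apply: pow_le; lra.
  have -> : Cmod (a j) * (q ^ j * rho ^ j) = (Cmod (a j) * rho ^ j) * q ^ j by ring.
  by move=> h1 h2; apply: Rmult_le_compat_r.
have base : csum (fun k => a k * w ^ k)%C m = (a m * w ^ m)%C.
  case: m mk {am rm e e1 e2 p2 e0 we qm} => [|m] mk; first by rewrite csum0.
  rewrite csumS (_ : csum _ m = RtoC 0); first by cring.
  have : forall j, (j <= m)%N -> a j = RtoC 0 by move=> j jm; apply: IH; lia.
  elim: m {mk} => [|m IHm] h; first by rewrite csum0 h //; cring.
  by rewrite csumS IHm ?h //; [cring | move=> j jm; apply: h; lia].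
have half j : 0 <= (1 / 2) ^ j by apply: pow_le; lra.
have key j : Cmod (csum (fun k => a k * w ^ k)%C (m + j)%N - a m * w ^ m)%C
    <= 2 * B * q ^ m.+1 * (1 - (1 / 2) ^ j).
  elim: j => [|j IHj].
    rewrite addn0 base.
    have -> : (a m * w ^ m - a m * w ^ m = RtoC 0)%C by ring.
    by rewrite Cmod_0 /=; lra.
  rewrite addnS csumS.
  have -> : (csum (fun k => a k * w ^ k) (m + j) + a (m + j).+1 * w ^ (m + j).+1
     - a m * w ^ m = (csum (fun k => a k * w ^ k) (m + j) - a m * w ^ m)
     + a (m + j).+1 * w ^ (m + j).+1)%C by ring.
  apply: Rle_trans (Cmod_triangle _ _) _.
  have t := term (m + j).+1.
  have t2 : B * q ^ (m + j).+1 <= B * q ^ m.+1 * (1 / 2) ^ j.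
    rewrite -addSn pow_add Rmult_assoc; apply: Rmult_le_compat_l; first by lra.
    apply: Rmult_le_compat_l; first by lra.
    by apply: pow_incr; lra.
  have -> : 2 * B * q ^ m.+1 * (1 - (1 / 2) ^ j.+1)
    = 2 * B * q ^ m.+1 * (1 - (1 / 2) ^ j) + B * q ^ m.+1 * (1 / 2) ^ j by simpl; field.
  lra.
have fin : Cmod (RtoC 0 - a m * w ^ m)%C <= 2 * B * q ^ m.+1.
  apply: (clim_bound _ _ _ _ m lim) => n mn.
  rewrite -(subnKC mn); apply: Rle_trans (key _) _.
  have : 0 <= 2 * B * q ^ m.+1 by nra.
  by have := half (n - m)%N; nra.
have E : (RtoC 0 - a m * w ^ m = - (a m * w ^ m))%C by ring.
rewrite E Cmod_opp Cmod_mult Cmod_pow wE Rpow_mult_distr in fin.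
have qm0 : 0 < q ^ m by apply: pow_lt.
have f2 : Cmod (a m) * rho ^ m <= 2 * B * q.
  apply: (Rmult_le_reg_r (q ^ m)) => //; simpl in fin; lra.
have f3 : Cmod (a m) * rho ^ m.+1 <= 2 * B * Cmod w.
  by rewrite wE; simpl; nra.
have f4 : Cmod w < Cmod (a m) * rho ^ m.+1 / (2 * B) by lra.
have : Cmod w * (2 * B) < Cmod (a m) * rho ^ m.+1 by apply/Rlt_div_r; lra.
lra.
Qed.

Lemma analytic_zero_disc (f g : C -> C) (c : C) :
  analytic_at f c -> analytic_at g c ->
  (forall e, 0 < e -> exists z, [/\ z <> c, Cmod (z - c)%C < e & f z = g z]) ->
  exists r, 0 < r /\ forall z, Cmod (z - c)%C < r -> f z = g z.
Proof.
move=> [a [r1 h1]] [b [r2 h2]] hz.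
pose r := Rmin r1 r2.
have ra := Rmin_l r1 r2; have rb := Rmin_r r1 r2.
have r0 : 0 < r by apply: Rmin_glb_lt; apply: cond_pos.
exists r; split=> //.
have hD w : Cmod w < r ->
    cseries (fun k => (a k - b k) * w ^ k)%C (f (c + w) - g (c + w))%C.
  move=> wr; have E : (c + w - c = w)%C by ring.
  have k1 := h1 (c + w)%C; have k2 := h2 (c + w)%C; rewrite E in k1 k2.
  apply: (cseries_ext (fun k => w ^ k * a k - w ^ k * b k)%C); first by move=> k; ring.
  by apply: cseries_minus; [apply: k1 | apply: k2]; rewrite /r in wr; lra.
have ab := pseries_coef_eq0 (fun k => a k - b k)%C r (fun w => f (c + w) - g (c + w))%C r0 hD.
have {}ab m : (a m - b m)%C = RtoC 0.
  apply: ab => e e0; have [z [zc ze fz]] := hz e e0.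
  exists (z - c)%C; split=> //.
    move=> E; apply: zc; have E2 : z = (z - c + c)%C by ring.
    by rewrite E2 E; ring.
  have -> : (c + (z - c) = z)%C by ring.
  by rewrite fz; ring.
move=> z zr; have h := hD (z - c)%C zr.
have E : (c + (z - c) = z)%C by ring.
rewrite E in h.
have h0 : cseries (fun k => (a k - b k) * (z - c) ^ k)%C (RtoC 0).
  apply/cseries_clim; apply: (clim_ext (fun _ => RtoC 0)); last exact: clim_const.
  elim=> [|n IH]; first by rewrite csum0 ab; ring.
  by rewrite csumS -IH ab; cring.
have d := cseries_unique _ _ _ h h0.
have E2 : f z = (f z - g z + g z)%C by ring.
by rewrite E2 d; ring.
Qed.

(* Continuation along the segment from [2 + i] to [1/3], which avoids the
   pole at [1]. *)
Lemma zeta_unique_third (f g : C -> C) :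
  is_riemann_zeta f -> is_riemann_zeta g -> f (RtoC (1 / 3)) = g (RtoC (1 / 3)).
Proof.
move=> [f1 f2] [g1 g2].
pose ga (t : R) : C := (2 - 5 / 3 * t, 1 - t).
pose P t := forall t', 0 <= t' <= t -> f (ga t') = g (ga t').
pose E t := 0 <= t <= 1 /\ P t.
(* For [t <= 1/2] the real part is at least 7/6, where both functions are the sum of the Dirichlet
   series. The supremum [T] of [E] is then pushed to 1. *)
have Phalf : E (1 / 2).
  split; first by lra.
  move=> t [t0 t1]; have s1 : 1 < Re (ga t) by rewrite /ga /Re /=; lra.
  exact: cseries_unique (f1 _ s1) (g1 _ s1).
have [T [ub lub]] : {m | is_lub E m}.
  apply: completeness; last by exists (1 / 2).
  by exists 1 => t [[_ h] _].
have T1 : T <= 1 by apply: lub => t [[_ h] _].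
have T0 : 1 / 2 <= T by apply: ub.
have below t : 0 <= t < T -> f (ga t) = g (ga t).
  move=> [t0 tT]; apply: NNPP => ne.
  have : T <= t; last by lra.
  apply: lub => u [[u0 u1] Pu]; apply: Rnot_lt_le => tu.
  by apply: ne; apply: Pu; lra.
have gas t : Re (ga t) = 2 - 5 / 3 * t by [].
have gp : 0 < Re (ga T) by rewrite gas; lra.
(* The imaginary part [1 - T] vanishes only for [T = 1], and there the real part is 1/3. *)
have gn1 : ga T <> RtoC 1.
  by rewrite /ga /RtoC => -[h1 h2]; lra.
have dist s t : Cmod (ga s - ga t)%C <= 3 * Rabs (s - t).
  have -> : (ga s - ga t)%C = (- (5 / 3) * (s - t), - (s - t)).
    by rewrite /ga /Cminus /Copp /Cplus /=; congr pair; ring.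
  apply: Rle_trans (Cmod_le_abs _ _) _.
  rewrite Rabs_mult !Rabs_Ropp (Rabs_pos_eq (5 / 3)); last by lra.
  by have := Rabs_pos (s - t); lra.
have [r [r0 hr]] : exists r, 0 < r /\ forall z, Cmod (z - ga T)%C < r -> f z = g z.
  apply: analytic_zero_disc; [exact: f2 | exact: g2 |].
  move=> e e0; pose h := Rmin (1 / 2) (e / 4).
  have h1 := Rmin_l (1 / 2) (e / 4); have h2 := Rmin_r (1 / 2) (e / 4).
  have h0 : 0 < h by apply: Rmin_glb_lt; lra.
  rewrite -/h in h1 h2.
  exists (ga (T - h)); split.
  - by rewrite /ga => -[? ?]; lra.
  - apply: Rle_lt_trans (dist _ _) _.
    have -> : T - h - T = - h by ring.
    by rewrite Rabs_Ropp Rabs_pos_eq; lra.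
  - by apply: below; lra.
(* Parameters within [r / 4] of [T] stay in the disc, since [ga] is Lipschitz with constant 3. Hence
   [E u], and [u <= T] forces [u = 1]. *)
pose u := Rmin 1 (T + r / 4).
have u1 := Rmin_l 1 (T + r / 4); have u2 := Rmin_r 1 (T + r / 4).
rewrite -/u in u1 u2.
have u0 : T <= u by apply: Rmin_glb; lra.
have Eu : E u.
  split; first by lra.
  move=> t [t0 tu]; case: (Rlt_le_dec t T) => tT; first by apply: below.
  apply: hr; apply: Rle_lt_trans (dist _ _) _; rewrite Rabs_pos_eq; lra.
have uT := ub _ Eu.
have u_1 : u = 1.
  have e : u = T by lra.
  move: e; rewrite /u /Rmin; case: Rle_dec => // _; lra.
have := proj2 Eu 1 ltac:(lra).
have -> // : ga 1 = RtoC (1 / 3).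
by rewrite /ga /RtoC; congr pair; field.
Qed.

(** [zetaF] witnesses that the specification is satisfiable, so the function chosen by [epsilon]
    satisfies it too; uniqueness at 1/3 transfers the value. *)
Lemma zeta_third (L : R) :
  is_lim_seq (fun A => \big[Rplus/0]_(1 <= a < A.+2) Rpower (INR a) (- (1 / 3))
                - Rpower (INR A.+1) (1 - 1 / 3) / (1 - 1 / 3)) L ->
  Re (zeta (RtoC (1 / 3))) = L.
Proof.
move=> hL; rewrite -(zetaF_real (1 / 3) L) //; try lra.
congr Re; apply: zeta_unique_third; last exact: zetaF_is_zeta.
by apply: epsilon_spec; exists zetaF; apply: zetaF_is_zeta.
Qed.

(** * The summatory function *)

Lemma zeta3_series (L : R) :
  is_lim_seq (fun A => \big[Rplus/0]_(1 <= a < A.+2) Rpower (INR a) (- (3))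
                - Rpower (INR A.+1) (1 - 3) / (1 - 3)) L ->
  Series (fun n => Rpower (INR n.+1) (- (3))) = L.
Proof.
move=> hL.
have ex := ex_series_Rpower 3 ltac:(lra).
have h := is_series_rsum _ _ (Series_correct _ ex).
move/is_lim_seq_incr_1 in h.
have h2 : is_lim_seq (fun A => \big[Rplus/0]_(0 <= n < A.+1) Rpower (INR n.+1) (- (3)) ) (L + - (1 / 2) * 0).
  apply: (is_lim_seq_ext (fun A => (\big[Rplus/0]_(1 <= a < A.+2) Rpower (INR a) (- (3))
                - Rpower (INR A.+1) (1 - 3) / (1 - 3)) + - (1 / 2) * Rpower (INR A.+1) (- (2)))).
    move=> n; rewrite (rsum_shift1 (fun a => Rpower (INR a) (- (3)))).
    have -> : 1 - 3 = - (2) by ring.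
    by field.
  apply: is_lim_seq_plus' => //.
  by apply: is_lim_seq_mult'; [exact: is_lim_seq_const | apply: Rpower_neg_lim; lra].
have e := is_lim_seq_unique _ _ h2; rewrite (is_lim_seq_unique _ _ h) in e.
have {e} e : Series (fun n => Rpower (INR n.+1) (- (3))) = L + - (1 / 2) * 0 by injection e.
by rewrite e; ring.
Qed.

Lemma Series_abs_bound (a b : nat -> R) (K : R) : (forall n, Rabs (a n) <= K * b n) ->
  ex_series b -> Rabs (Series a) <= K * Series b.
Proof.
move=> hab exb.
have exKb : ex_series (fun n => K * b n) by exact: (@ex_series_scal R_AbsRing R_NormedModule).
have exa : ex_series (fun n => Rabs (a n)).
  apply: (@ex_series_le R_AbsRing R_CompleteNormedModule _ _ _ exKb) => n.
  by rewrite /norm /= /abs /= Rabs_Rabsolu.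
apply: Rle_trans (Series_Rabs _ exa) _.
rewrite -Series_scal_l; apply: Series_le => // n; split => //; exact: Rabs_pos.
Qed.

(** The count is compared with its main terms at the real point [x / m], for every [m] and not only
    for [m <= x]. The main terms then sum exactly to multiples of [gsum 1] and [gsum (1 / 3)], and
    one series, absolutely convergent because [th > 1/5], bounds the error and the completion of the
    tails together. *)
Lemma summatory_asymp (L3 L13 : R) (eps : R) : 0 < eps -> eps <= 1 / 10 ->
  (exists C, 0 <= C /\ forall N : nat, (0 < N)%N ->
    Rabs (INR (cube_sum N) - L3 * INR N - L13 * Rpower (INR N) (1 / 3))
      <= C * Rpower (INR N) (1 / 5 + eps)) ->
  exists K, forall x, 1 <= x ->
    Rabs (summatory phi_e x - (L3 * gsum 1 * x + L13 * gsum (1 / 3) * Rpower x (1 / 3)))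
      <= K * Rpower x (1 / 5 + eps).
Proof.
move=> eps0 eps1 [C [C0 hC]].
set th := 1 / 5 + eps in hC *.
pose C' := C + 3 * (Rabs L3 + Rabs L13).
have a3 := Rabs_pos L3; have a13 := Rabs_pos L13.
(* For [y < 1] the main terms themselves are [O(y ^ th)], since [th < 1/3]. *)
have D y N : 0 < y -> INR N <= y < INR N + 1 ->
    Rabs (INR (cube_sum N) - L3 * y - L13 * Rpower y (1 / 3)) <= C' * Rpower y th.
  move=> y0 [Ny yN]; have Py := Rpower_pos y th.
  case: (posnP N) yN Ny => [-> yN _|N0 yN Ny].
    have y1 : y < 1 by rewrite /= in yN; lra.
    have pl a : th <= a -> Rpower y a <= Rpower y th.
      move=> ha; rewrite /Rpower; apply: exp_le.
      have : ln y < 0 by rewrite -ln_1; apply: ln_increasing.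
      by nra.
    have h1 := pl 1 ltac:(rewrite /th; lra); have h2 := pl (1 / 3) ltac:(rewrite /th; lra).
    rewrite Rpower_1 // in h1.
    have -> : INR (cube_sum 0) = 0 by rewrite /cube_sum big_geq.
    have -> : 0 - L3 * y - L13 * Rpower y (1 / 3) = - (L3 * y) + - (L13 * Rpower y (1 / 3)) by ring.
    apply: Rle_trans (Rabs_triang _ _) _; rewrite !Rabs_Ropp !Rabs_mult.
    rewrite (Rabs_pos_eq y) ?(Rabs_pos_eq (Rpower y _)); try lra; last exact/Rlt_le/Rpower_pos.
    by rewrite /C'; nra.
  have NR := INR_ge1 _ N0.
  have h := hC N N0.
  have p1 : Rpower (INR N) th <= Rpower y th.
    by apply: Rle_Rpower_l; [rewrite /th; lra | lra].
  have p2 : 1 <= Rpower y th.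
    by rewrite -(Rpower_O y) //; apply: Rle_Rpower; rewrite /th; lra.
  have d3 : 0 <= Rpower y (1 / 3) - Rpower (INR N) (1 / 3) <= 1.
    have [c [[c1 c2] ->]] := Rpower_mvt (1 / 3) (INR N) y ltac:(lra) Ny.
    have : Rpower c (1 / 3 - 1) <= 1.
      rewrite -[X in _ <= X](Rpower_O c); last by lra.
      by apply: Rle_Rpower; lra.
    by have := Rpower_pos c (1 / 3 - 1); nra.
  have -> : INR (cube_sum N) - L3 * y - L13 * Rpower y (1 / 3)
    = (INR (cube_sum N) - L3 * INR N - L13 * Rpower (INR N) (1 / 3))
      + (- (L3 * (y - INR N)) + - (L13 * (Rpower y (1 / 3) - Rpower (INR N) (1 / 3)))) by ring.
  apply: Rle_trans (Rabs_triang _ _) _.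
  have t := Rabs_triang (- (L3 * (y - INR N))) (- (L13 * (Rpower y (1 / 3) - Rpower (INR N) (1 / 3)))).
  rewrite !Rabs_Ropp !Rabs_mult (Rabs_pos_eq (y - INR N)) in t; last by lra.
  rewrite (Rabs_pos_eq (Rpower y _ - _)) in t; last by lra.
  have : C * Rpower (INR N) th <= C * Rpower y th by apply: Rmult_le_compat_l.
  by rewrite /C'; nra.
have exth := gsum_abs th ltac:(rewrite /th; lra).
exists (C' * Series (fun n => Rabs (mulF (fun _ => gg) n.+1 * Rpower (INR n.+1) (- th)))).
move=> x x1.
set N := Z.to_nat (Int_part x).
have [i1 i2] := base_Int_part x.
have ip : (0 <= Int_part x)%Z.
  suff : (0 < Int_part x + 1)%Z by lia.
  by apply: lt_IZR; rewrite plus_IZR; lra.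
have NE : INR N = IZR (Int_part x) by rewrite INR_IZR_INZ /N Z2Nat.id.
have Nx : INR N <= x < INR N + 1 by rewrite NE; lra.
rewrite /summatory -/N sum_phi_e.
pose g m := mulF (fun _ => gg) m.
pose E m := g m * (INR (cube_sum (N %/ m)) - L3 * (x / INR m) - L13 * Rpower (x / INR m) (1 / 3)).
have fl m : (0 < m)%N -> INR (N %/ m) <= x / INR m < INR (N %/ m) + 1.
  move=> m0; have mR := INR_gt0 _ m0; split.
    apply/Rle_div_r => //; rewrite -mult_INR.
    by apply: Rle_trans (INR_leq _ _ (leq_divM N m)) _; lra.
  apply/Rlt_div_l => //.
  by have := INR_leq _ _ (ltn_ceil N m0); rewrite mult_INR !S_INR; lra.
have xm m : (0 < m)%N -> 0 < x / INR m.
  by move=> m0; apply: Rdiv_lt_0_compat; [lra | exact: INR_gt0].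
have pw m a : (0 < m)%N -> Rpower (x / INR m) a = Rpower x a * Rpower (INR m) (- a).
  move=> m0; have mR := INR_gt0 _ m0; rewrite /Rpower ln_div //; last by lra.
  by rewrite -exp_plus; congr exp; ring.
have Eb n : Rabs (E n.+1) <= (C' * Rpower x th) * Rabs (g n.+1 * Rpower (INR n.+1) (- th)).
  rewrite /E Rabs_mult.
  have h := D (x / INR n.+1) (N %/ n.+1) (xm n.+1 isT) (fl n.+1 isT).
  rewrite (pw n.+1 th) // in h.
  rewrite Rabs_mult (Rabs_pos_eq (Rpower _ (- th))); last exact/Rlt_le/Rpower_pos.
  have := Rabs_pos (g n.+1).
  have -> : C' * Rpower x th * (Rabs (g n.+1) * Rpower (INR n.+1) (- th))
    = Rabs (g n.+1) * (C' * (Rpower x th * Rpower (INR n.+1) (- th))) by ring.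
  by move=> g0; apply: Rmult_le_compat_l.
have ex1 := ex_series_Rabs _ (gsum_abs 1 ltac:(lra)).
have ex3 := ex_series_Rabs _ (gsum_abs (1 / 3) ltac:(lra)).
have s1 := is_series_scal (L3 * x) _ _ (Series_correct _ ex1).
have s3 := is_series_scal (L13 * Rpower x (1 / 3)) _ _ (Series_correct _ ex3).
(* The finite sum as an infinite series: for [m > N] the quotient is 0 and [cube_sum 0] vanishes. *)
have sS : is_series (fun n => g n.+1 * INR (cube_sum (N %/ n.+1)))
    (\big[Rplus/0]_(1 <= m < N.+1) (g m * INR (cube_sum (N %/ m)))).
  have z n : (N <= n)%N -> g n.+1 * INR (cube_sum (N %/ n.+1)) = 0.
    by move=> Nn; rewrite divn_small ?ltnS // /cube_sum big_geq //= Rmult_0_r.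
  rewrite (rsum_shift1 (fun m => g m * INR (cube_sum (N %/ m)))).
  have st k : sum_n (fun n => g n.+1 * INR (cube_sum (N %/ n.+1))) (N + k)
     = \big[Rplus/0]_(0 <= n < N) (g n.+1 * INR (cube_sum (N %/ n.+1))).
    rewrite -rsum_sum_n (@big_cat_nat _ _ _ N) //=; last by lia.
    rewrite [X in _ + X]big_nat [X in _ + X]big1 ?Rplus_0_r // => i /andP[Ni _].
    exact: z.
  have h : is_lim_seq (sum_n (fun n => g n.+1 * INR (cube_sum (N %/ n.+1))))
     (\big[Rplus/0]_(0 <= n < N) (g n.+1 * INR (cube_sum (N %/ n.+1)))).
    apply/(is_lim_seq_incr_n _ N).
    apply: (is_lim_seq_ext (fun _ => \big[Rplus/0]_(0 <= n < N) (g n.+1 * INR (cube_sum (N %/ n.+1))))).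
      by move=> n; rewrite -(st n) addnC.
    exact: is_lim_seq_const.
  exact: h.
have sE := is_series_minus _ _ _ _ (is_series_minus _ _ _ _ sS s1) s3.
have eE : Series (fun n => E n.+1) =
   \big[Rplus/0]_(1 <= m < N.+1) (g m * INR (cube_sum (N %/ m)))
   - L3 * x * gsum 1 - L13 * Rpower x (1 / 3) * gsum (1 / 3).
  apply: is_series_unique; apply: (is_series_ext _ _ _ _ sE) => n.
  have mR := INR_gt0 n.+1 isT.
  have e1 : Rpower (INR n.+1) (- (1)) = / INR n.+1 by rewrite Rpower_Ropp Rpower_1.
  rewrite /E pw // /scal /minus /plus /opp /= /mult /= -/(INR n.+1) e1 -/(g n.+1).
  have factor (u v w y i z : R) : w * u + - (v * (w * i)) + - (y * (w * z))
     = w * (u - v * i - y * z) by ring.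
  rewrite factor; congr Rmult; rewrite /Rdiv; ring.
have -> : \big[Rplus/0]_(1 <= m < N.+1) (mulF (fun _ => gg) m * INR (cube_sum (N %/ m)))
   - (L3 * gsum 1 * x + L13 * gsum (1 / 3) * Rpower x (1 / 3)) = Series (fun n => E n.+1).
  by rewrite eE /g; ring.
apply: Rle_trans (Series_abs_bound _ _ _ Eb exth) _.
by apply: Req_le; rewrite /g; ring.
Qed.

Theorem theorem1 :
  euler_product_converges 3 term1 /\ euler_product_converges 5 term2 /\
  forall eps : R, 0 < eps ->
    exists K X : R, 0 < X /\ forall x : R, X <= x ->
      Rabs (summatory phi_e x - (coefC1 * x + coefC2 * Rpower x (1 / 3)))
        <= K * Rpower x (1 / 5 + eps).
Proof.
have [ex1 lim1] := euler_term1; have [ex2 lim2] := euler_term2.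
split; first by split=> //; eexists; exact: lim1.
split; first by split=> //; eexists; exact: lim2.
move=> eps eps0.
have [L3 [l3 em3]] := em_limit 3 ltac:(lra) ltac:(lra).
have [L13 [l13 em13]] := em_limit (1 / 3) ltac:(lra) ltac:(lra).
have C1E : coefC1 = L3 * gsum 1.
  rewrite /coefC1 /euler_product (is_lim_seq_unique _ _ lim1) /=.
  by rewrite (zeta3_series _ l3) Rmult_comm.
have C2E : coefC2 = L13 * gsum (1 / 3).
  rewrite /coefC2 /euler_product (is_lim_seq_unique _ _ lim2) /=.
  by rewrite (zeta_third _ l13).
(* Keeps the exponent [1/5 + e] below 1/3, as [summatory_asymp] requires. A larger [eps] only
   weakens the claim for [x >= 1], once [K] is replaced by its absolute value. *)
pose e := Rmin eps (1 / 10).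
have e1 := Rmin_l eps (1 / 10); have e2 := Rmin_r eps (1 / 10).
have e0 : 0 < e by apply: Rmin_glb_lt; lra.
have [K hK] := summatory_asymp L3 L13 e e0 e2 (cube_sum_asymp L3 L13 em3 em13 e e0).
exists (Rabs K), 1; split=> [|x x1]; first by lra.
rewrite C1E C2E; apply: Rle_trans (hK x x1) _.
apply: (Rle_trans _ (Rabs K * Rpower x (1 / 5 + e))).
  by apply: Rmult_le_compat_r; [exact/Rlt_le/Rpower_pos | exact: Rle_abs].
apply: Rmult_le_compat_l; first exact: Rabs_pos.
by apply: Rle_Rpower; rewrite /e; lra.
Qed.
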